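(* Let $\kappa>0$, let $B$ be a $d$-dimensional Brownian motion, and for $x\in\mathbb R^d$ let $X^x$ be the Ornstein–Uhlenbeck process on $\mathbb R^d$ solving $$dX^x_t=-\kappa X^x_t\,dt+dB_t,\qquad X^x_0=x.$$ Then for all $R,T>0$ and $x\in\mathbb R^d$, $$\mathbb P\left(\left|\frac1T\int_0^T|X^x_t|^2\,dt-\mathbb E\left[\frac1T\int_0^T|X^x_t|^2\,dt\right]\right|\ge R\right)\le2^{1/3}\left(1\wedge\frac{R+D}{3\kappa^2R^2T}\right)^{1/3}\exp\left(-\frac{\kappa^2R^2T}{3(R+D)}\right)$$ with $$D=\frac{|x|^2}{\kappa T}+\frac d\kappa .$$
   Context: $a\wedge b=\min(a,b)$; $|\cdot|$ is the Euclidean norm. *)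

(* Defs.v *)
From HB Require Import structures.
From mathcomp Require Export all_boot all_order all_algebra.
From mathcomp Require Export all_classical all_reals all_analysis.

Set Implicit Arguments.
Unset Strict Implicit.
Unset Printing Implicit Defensive.

Import Order.TTheory GRing.Theory Num.Theory.
Import numFieldNormedType.Exports.

Local Open Scope classical_set_scope.
Local Open Scope ring_scope.

(* Euclidean norm; the canonical norm `|x| on 'rV[R]_n is the sup norm. *)
Definition enorm (R : realType) (n : nat) (x : 'rV[R]_n) : R :=
  Num.sqrt (\sum_i x 0 i ^+ 2).

(* Mutual independence of a finite family of real random variables. Since the
   A i may be setT, this contains the product rule for every subfamily. *)
Definition mutually_independent (dO : measure_display)
    (Omega : measurableType dO) (R : realType) (P : probability Omega R)
    (I : finType) (Y : I -> Omega -> R) : Prop :=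
  forall A : I -> set R, (forall i, measurable (A i)) ->
    P (\bigcap_(i in [set: I]) (Y i @^-1` A i)) =
    (\prod_(i : I) P (Y i @^-1` A i))%E.

(* A process on [0, +oo[ with values in R^n is a function
   R -> Omega -> 'rV[R]_n of which only the values at times t >= 0 matter. *)

(* Standard n-dimensional Brownian motion started at 0. The fourth clause says
   that over successive time intervals the increments are independent and of
   law N(0, (t_(k+1) - t_k) I_n): the coordinates of all the increments form an
   independent family of centred normal variables. The second argument of
   normal_prob is the standard deviation. *)
Definition brownian_motion (dO : measure_display)
    (Omega : measurableType dO) (R : realType) (P : probability Omega R)
    (n : nat) (B : R -> Omega -> 'rV[R]_n) : Prop :=
  [/\ forall t, 0 <= t -> forall i,
        measurable_fun [set: Omega] (fun w => B t w 0 i),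
      {ae P, forall w, B 0 w = 0},
      {ae P, forall w, forall i,
        {within `[0, +oo[, continuous (fun t => B t w 0 i)}},
      forall t : nat -> R, 0 <= t 0%N -> (forall k, t k < t k.+1) ->
        forall m : nat,
          mutually_independent P
            (fun (p : 'I_m * 'I_n) w =>
               B (t p.1.+1) w 0 p.2 - B (t p.1) w 0 p.2) &
      forall s t : R, 0 <= s -> s < t ->
        forall (i : 'I_n) (A : set R), measurable A ->
          P [set w | A (B t w 0 i - B s w 0 i)] =
          normal_prob 0 (Num.sqrt (t - s)) A].

(* X solves dX_t = - kappa X_t dt + dB_t, X_0 = x. As the noise is additive,
   the integrated equation X_t = x - kappa \int_0^t X_s ds + B_t involves no
   stochastic integral. X is jointly measurable in (t, w), which any process
   all of whose paths are continuous is; path continuity and the equation are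
   required almost surely, simultaneously for all t >= 0. *)
Definition ou_solution (dO : measure_display)
    (Omega : measurableType dO) (R : realType) (P : probability Omega R)
    (n : nat) (kappa : R) (x : 'rV[R]_n) (B X : R -> Omega -> 'rV[R]_n) : Prop :=
  [/\ forall i, measurable_fun
        ([set p | 0 <= p.1] : set (measurableTypeR R * Omega))
        (fun p => X p.1 p.2 0 i),
      {ae P, forall w, forall i,
        {within `[0, +oo[, continuous (fun t => X t w 0 i)}} &
      {ae P, forall w, forall t, 0 <= t -> forall i,
        X t w 0 i =
        x 0 i - kappa * (\int[lebesgue_measure]_(s in `[0, t]) X s w 0 i)
        + B t w 0 i}].

(* (1/T) \int_0^T |X_t|^2 dt *)
Definition mean_square (Omega : Type) (R : realType) (n : nat)
    (X : R -> Omega -> 'rV[R]_n) (T : R) (w : Omega) : R :=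
  T^-1 * \int[lebesgue_measure]_(t in `[0, T]) (enorm (X t w) ^+ 2).

(* Main.v *)
From HB Require Import structures.
Require Import Defs.
From mathcomp Require Import measurable_realfun ring lra.
Import Order.TTheory GRing.Theory Num.Theory.
Import numFieldNormedType.Exports.

(** Write F for the time average of |X|^2 over [0, T] and
    y = kappa^2 r^2 T / (r + D). After cubing both sides, the claim reads
    P(|F - E F| >= r)^3 <= tail_bound y with
    tail_bound y = 2 min(1, 1/(3y)) e^(-y).

    The process is replaced by the Gaussian chain Y_(k+1) = c Y_k + (increment
    of B), with step h = T/n, and F by F_n = (1/n) sum_(k < n) |Y_k|^2. Chain
    and process are driven by the same noise; as the noise is additive, the
    integrated equation gives |Y_k - X_(kh)| -> 0 uniformly in k on almost
    every path, using only the uniform continuity of X on [0, T]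
    (cvg_chain_square). Since E F_n^2 stays bounded, F_n -> F in L^1 (L1_cvg),
    which brings the bounds for Z = F_n - E F_n to F in the limit
    (deviation_approx, deviation_mean_square).

    For the chain, integrating out one Gaussian increment after the other
    turns exp(a Y_(k+1)^2) into a multiple of exp(a' Y_k^2), so that
    E exp(theta F_n) = exp(a_n |x|^2) prod_(j < n) (1 - 2 h a_j)^(-d/2) with
    a_0 = 0, a_(j+1) = theta/n + c^2 a_j / (1 - 2 h a_j) (integral_chain), a
    discrete Riccati equation. Comparing a_j with its second order expansion in
    theta gives, with sigma2 = D / (2 kappa^2 T) and some w <= sigma2,

    - E exp(t Z) <= exp(2 t^2 sigma2 / (2 - p)^2) when
      t <= kappa^2 T p (2 - p) / 2 and p < 1,
    - E exp(- t Z) <= exp(t^2 w / 2),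
    - E exp(t Z) + E exp(- t Z) >= 2 exp(t^2 w / 2).

    Letting t -> 0, these three bounds force E Z = 0, E Z^2 <= w and
    E Z^4 >= 3 w^2 (moments_of_expmoment). All this is recorded as
    subgamma_below_above and proved in subgamma_chain.

    It remains to deduce the tail bound from these data (deviation_bound),
    according to the size of y. For y <= 43/100 the right-hand side is at
    least 1. For y >= 9/2 the Chernoff bounds e^(-y/2) and e^(-y) for the two
    tails suffice. For 3/5 <= y <= 9/2 Chebyshev's inequality, which gives
    P <= 1/(2y), is enough, because y^2 e^(-y) >= 3/16 there. In the gap
    43/100 <= y <= 3/5 Chebyshev's inequality in the sharper form
    P <= 1/(2 (1 + r/D) y) still works when r/D is not too small. The
    remaining case is the delicate one: a second moment bound is not enough,
    and one uses that a variable whose fourth moment is at least 3 (E Z^2)^2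
    cannot concentrate at |Z| = r. This is done with a polynomial of degree 4
    in Z^2 whose higher powers are dominated by a cosh, hence by the
    exponential moments (fourth_moment_tail, gap_cell). *)

Set Implicit Arguments.
Unset Strict Implicit.
Unset Printing Implicit Defensive.

Local Open Scope classical_set_scope.
Local Open Scope ring_scope.

(** * Elementary bounds for cosh and the inverse square root *)

Definition cosh {R : realType} (x : R) : R := (expR x + expR (- x)) / 2.

Definition cosh_taylor {R : realType} (n : nat) (x : R) : R :=
  \sum_(0 <= k < n) x ^+ k.*2 / (k.*2)`!%:R.

Lemma cosh_taylorS (R : realType) n (x : R) :
  cosh_taylor n.+1 x = cosh_taylor n x + x ^+ n.*2 / (n.*2)`!%:R.
Proof. by rewrite /cosh_taylor big_nat_recr. Qed.

Lemma cvg_cosh_taylor (R : realType) (x : R) :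
  cosh_taylor ^~ x @ \oo --> cosh x.
Proof.
have -> : cosh_taylor ^~ x =
    (fun n => (series (exp_coeff x) n.*2 + series (exp_coeff (- x)) n.*2) / 2).
  apply/funext; elim => [|n IHn].
    by rewrite /cosh_taylor /series /= !big_geq// addr0 mul0r.
  rewrite cosh_taylorS IHn /series /= doubleS !big_nat_recr//= /exp_coeff /=.
  have evenE : (- x) ^+ n.*2 = x ^+ n.*2 by rewrite -mul2n !exprM sqrrN.
  have -> : (- x) ^+ n.*2.+1 = - x ^+ n.*2.+1 by rewrite !exprS evenE mulNr.
  rewrite evenE mulNr; set u := _ / (n.*2)`!%:R; set v := _ / (n.*2.+1)`!%:R.
  by set s1 := \sum_(_ <= _ < _) _; set s2 := \sum_(_ <= _ < _) _; lra.
apply: cvgM; last exact: cvg_cst.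
have sub (y : R) : series (exp_coeff y) n.*2 @[n --> \oo] --> expR y.
  have cvgy : series (exp_coeff y) @ \oo --> expR y.
    exact: is_cvg_series_exp_coeff.
  apply: (cvg_comp (fun n => n.*2) (series (exp_coeff y)) _ cvgy).
  apply/cvgnyPge => N; near=> n.
  rewrite -addnn; apply: leq_trans (leq_addr _ _); near: n.
  exact: nbhs_infty_ge.
exact: cvgD.
Unshelve. all: by end_near. Qed.

Lemma cosh_taylor_le (R : realType) n (x : R) : cosh_taylor n x <= cosh x.
Proof.
have nd : nondecreasing_seq (cosh_taylor ^~ x).
  apply/nondecreasing_seqP => m; rewrite cosh_taylorS lerDl divr_ge0//.
  by rewrite -mul2n exprM exprn_ge0// sqr_ge0.
have := nondecreasing_cvgn_le nd (cvgP _ (@cvg_cosh_taylor R x)) n.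
by rewrite (cvg_lim _ (@cvg_cosh_taylor R x)).
Qed.

(** Every term of the series of cosh beyond the n first ones carries a factor t^(2n) when
    its argument is scaled by t <= 1. *)
Lemma cosh_scale_le (R : realType) n (t x : R) : 0 <= t <= 1 ->
  cosh (t * x) <= cosh_taylor n (t * x) + t ^+ n.*2 * cosh x.
Proof.
move=> /andP[t0 t1].
have ev (y : R) k : 0 <= y ^+ k.*2 / (k.*2)`!%:R.
  by rewrite divr_ge0// -mul2n exprM exprn_ge0// sqr_ge0.
have part m : cosh_taylor (n + m) (t * x) <=
    cosh_taylor n (t * x) + t ^+ n.*2 * cosh_taylor (n + m) x.
  elim: m => [|m IHm].
    rewrite addn0 lerDl mulr_ge0 ?exprn_ge0// /cosh_taylor.
    by rewrite sumr_ge0.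
  rewrite addnS !cosh_taylorS mulrDr addrA lerD// exprMn -mulrA ler_wpM2r//.
  by rewrite ler_wiXn2l// leq_double leq_addr.
have c1 : cosh_taylor (n + m)%N (t * x) @[m --> \oo] --> cosh (t * x).
  have := @cvg_cosh_taylor R (t * x); rewrite -(cvg_shiftn n) /=.
  by under eq_fun do rewrite addnC.
have c2 : cosh_taylor (n + m)%N x @[m --> \oo] --> cosh x.
  have := @cvg_cosh_taylor R x; rewrite -(cvg_shiftn n) /=.
  by under eq_fun do rewrite addnC.
apply: (ler_cvg_to c1) => //; last by near=> m; exact: part.
apply: cvgD; first exact: cvg_cst.
by apply: cvgM => //; exact: cvg_cst.
Unshelve. all: by end_near. Qed.

(** A function vanishing at 0 whose derivative has the sign of t is nonnegative on
    both sides of 0; stated on ]-oo, b[ because the functions below live on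
    ]-oo, 1[. *)
Lemma ge0_of_is_derive (R : realType) (f df : R -> R) (b x : R) :
  0 < b -> x < b -> (forall t, t < b -> is_derive t 1 f (df t)) -> f 0 = 0 ->
  (forall t, t < b -> 0 < t * x -> 0 <= t * df t) -> 0 <= f x.
Proof.
move=> b0 xb dfE f0 df_ge0.
have cont u v : v < b -> {within `[u, v], continuous f}.
  move=> vb; apply: derivable_within_continuous => t.
  by rewrite in_itv/= => /andP[_ /le_lt_trans -/(_ _ vb)]/dfE[].
have dfE' u v t : v < b -> t \in `]u, v[ -> is_derive t 1 f (df t).
  by move=> vb; rewrite in_itv/= => /andP[_ tv]; apply: dfE; exact: lt_trans vb.
have [x0|x0|->] := ltgtP x 0; last by rewrite f0.
- have [c] := MVT x0 (fun t => @dfE' x 0 t b0) (cont x 0 b0).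
  rewrite in_itv/= => /andP[xc c0] fE.
  have := df_ge0 c (lt_trans c0 b0); rewrite nmulr_rgt0// => /(_ x0).
  rewrite nmulr_rge0// f0 in fE * => dc.
  have -> : f x = df c * x by lra.
  exact: mulr_le0 (ltW x0).
- have [c] := MVT x0 (fun t => @dfE' 0 x t xb) (cont 0 x xb).
  rewrite in_itv/= => /andP[c0 cx] fE.
  have := df_ge0 c (lt_trans cx xb); rewrite pmulr_rgt0// => /(_ x0).
  rewrite pmulr_rge0// f0 in fE * => dc.
  have -> : f x = df c * x by lra.
  exact: mulr_ge0 (ltW x0).
Qed.

Lemma is_derive_polyexp (R : realType) (a b : R) (p q : R -> R) (x dp dq : R) :
  is_derive x 1 p dp -> is_derive x 1 q dq ->
  is_derive x 1 (fun x => a + b * (p x * expR (q x)))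
    (b * ((dp + p x * dq) * expR (q x))).
Proof.
move=> Hp Hq.
have Hexp : is_derive x 1 (expR \o q) (expR (q x) * dq).
  exact: is_derive1_comp.
apply: is_derive_eq; rewrite /GRing.scale/= add0r.
ring.
Qed.

(** The exponent is the Taylor polynomial of - ln (1 - x), whose remainder
    x^4/4 + ... has the sign of x^4 on both sides of 0; the cubic term is what
    the lower bound on the sum of the two exponential moments requires. *)
Lemma onem_expR_le1 (R : realType) (x : R) : x < 1 ->
  (1 - x) * expR (x + x ^+ 2 / 2 + x ^+ 3 / 3) <= 1.
Proof.
move=> x1; rewrite -subr_ge0 -mulN1r.
have dq (t : R) : is_derive t 1 (fun x : R => x + x ^+ 2 / 2 + x ^+ 3 / 3)
    (1 + t + t ^+ 2).
  by apply: is_derive_eq; rewrite /GRing.scale/=; field.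
have dp (t : R) : is_derive t 1 (fun x : R => 1 - x) (-1).
  by apply: is_derive_eq; ring.
apply: (@ge0_of_is_derive R _ _ 1 x _ x1
  (fun t _ => @is_derive_polyexp R 1 (-1) _ _ t _ _ (dp t) (dq t))) => //.
  by rewrite !expr0n/= !mul0r !addr0 expR0 subr0; ring.
move=> t _ _; have -> : forall e : R,
  t * (-1 * ((-1 + (1 - t) * (1 + t + t ^+ 2)) * e)) = (t ^+ 2) ^+ 2 * e.
  by move=> e; ring.
by rewrite mulr_ge0 ?expR_ge0// exprn_ge0// sqr_ge0.
Qed.

Lemma onem_expR_ge1_le0 (R : realType) (x : R) : x <= 0 ->
  1 <= (1 - x) * expR (x + x ^+ 2 / 2).
Proof.
move=> x0; rewrite -subr_ge0 addrC.
have dq (t : R) : is_derive t 1 (fun x : R => x + x ^+ 2 / 2) (1 + t).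
  by apply: is_derive_eq; rewrite /GRing.scale/=; field.
have dp (t : R) : is_derive t 1 (fun x : R => 1 - x) (-1).
  by apply: is_derive_eq; ring.
rewrite -[X in _ + X]mul1r.
apply: (@ge0_of_is_derive R _ _ 1 x _ (le_lt_trans x0 ltr01)
  (fun t _ => @is_derive_polyexp R (-1) 1 _ _ t _ _ (dp t) (dq t))) => //.
  by rewrite !expr0n/= !mul0r !addr0 expR0 subr0; ring.
move=> t _ tx; have -> : forall e : R,
  t * (1 * ((-1 + (1 - t) * (1 + t)) * e)) = t ^+ 2 * (- t) * e.
  by move=> e; ring.
have t0 : t <= 0.
  rewrite leNgt; apply/negP => t0; move: tx; rewrite pmulr_rgt0// => x0'.
  by rewrite ltNge x0 in x0'.
by rewrite mulr_ge0 ?expR_ge0// mulr_ge0 ?sqr_ge0// oppr_ge0.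
Qed.

(** Here the remainder x^3/3 + x^4/4 + ... of - ln (1 - x) is absorbed into the
    quadratic term by summing a geometric series. *)
Lemma onem_expR_ge1 (R : realType) (x : R) : 0 <= x < 1 ->
  1 <= (1 - x) * expR (x + x ^+ 2 / (2 * (1 - x))).
Proof.
move=> /andP[x0 x1]; rewrite -subr_ge0 addrC -[X in _ + X]mul1r.
have dp (t : R) : is_derive t 1 (fun x : R => 1 - x) (-1).
  by apply: is_derive_eq; ring.
have dq (t : R) : t < 1 ->
    is_derive t 1 (fun x : R => x + x ^+ 2 / (2 * (1 - x)))
      (1 + t * (2 - t) / (2 * (1 - t) ^+ 2)).
  move=> t1; have t1' : 1 - t != 0 by rewrite subr_eq0 eq_sym lt_eqF.
  have d2 : is_derive t 1 (fun x : R => 2 * (1 - x)) (-2).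
    by apply: is_derive_eq; rewrite /GRing.scale/=; ring.
  have n2 : 2 * (1 - t) != 0 by rewrite mulf_neq0// pnatr_eq0.
  have d3 := is_deriveV n2.
  apply: is_derive_eq.
  rewrite /GRing.scale/=; field.
  by rewrite t1'.
apply: (@ge0_of_is_derive R _ _ 1 x _ x1
  (fun t t1 => @is_derive_polyexp R (-1) 1 _ _ t _ _ (dp t) (dq t t1))) => //.
  by rewrite !expr0n/= !mul0r !addr0 expR0 subr0; ring.
move=> t t1 tx; have -> : forall e : R,
  t * (1 * ((-1 + (1 - t) * (1 + t * (2 - t) / (2 * (1 - t) ^+ 2))) * e)) =
  t ^+ 2 * t / (2 * (1 - t)) * e.
  by move=> e; field; rewrite subr_eq0 eq_sym lt_eqF.
have t0 : 0 <= t.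
  by rewrite leNgt; apply/negP => t0; move: tx; rewrite nmulr_rgt0// ltNge x0.
rewrite mulr_ge0 ?expR_ge0// divr_ge0 ?mulr_ge0 ?sqr_ge0// subr_ge0.
exact: ltW.
Qed.

Lemma expR_le_invsqrt (R : realType) (x : R) : x < 1 ->
  expR (x / 2 + x ^+ 2 / 4 + x ^+ 3 / 6) <= (Num.sqrt (1 - x))^-1.
Proof.
move=> x1; have s0 : 0 < Num.sqrt (1 - x) by rewrite sqrtr_gt0 subr_gt0.
rewrite -[leRHS]mul1r ler_pdivlMr// -(@ler_pXn2r _ 2)// ?nnegrE ?mulr_ge0//.
  rewrite exprMn sqr_sqrtr ?subr_ge0 ?(ltW x1)// expr1n -expRM_natl mulrC.
  rewrite (le_trans _ (onem_expR_le1 x1))// ler_wpM2l ?subr_ge0 ?(ltW x1)//.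
  by rewrite ler_expR; lra.
Qed.

Lemma invsqrt_le_expR_le0 (R : realType) (x : R) : x <= 0 ->
  (Num.sqrt (1 - x))^-1 <= expR (x / 2 + x ^+ 2 / 4).
Proof.
move=> x0; have x1 : 0 < 1 - x by lra.
have s0 : 0 < Num.sqrt (1 - x) by rewrite sqrtr_gt0.
rewrite -[leLHS]mul1r ler_pdivrMr// -(@ler_pXn2r _ 2)// ?nnegrE ?mulr_ge0//.
  rewrite exprMn sqr_sqrtr ?(ltW x1)// expr1n -expRM_natl mulrC.
  rewrite (le_trans (onem_expR_ge1_le0 x0))// ler_wpM2l ?(ltW x1)//.
  by rewrite ler_expR; lra.
Qed.

Lemma invsqrt_le_expR_ge0 (R : realType) (x : R) : 0 <= x < 1 ->
  (Num.sqrt (1 - x))^-1 <= expR (x / 2 + x ^+ 2 / (4 * (1 - x))).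
Proof.
move=> /[dup] /andP[_ x1'] /onem_expR_ge1 x1; have x2 : 0 < 1 - x by lra.
have s0 : 0 < Num.sqrt (1 - x) by rewrite sqrtr_gt0.
rewrite -[leLHS]mul1r ler_pdivrMr// -(@ler_pXn2r _ 2)// ?nnegrE ?mulr_ge0//.
  rewrite exprMn sqr_sqrtr ?(ltW x2)// expr1n -expRM_natl mulrC.
  rewrite (le_trans x1)// ler_wpM2l ?(ltW x2)// ler_expR.
  by rewrite le_eqVlt; apply/orP; left; apply/eqP; field; rewrite gt_eqF.
Qed.

(** * The discrete Riccati equation *)

(** The coefficient of |Y_(n-j)|^2 in the exponent after integrating out the last j
    steps of the chain, with q the square of the contraction factor and e the
    weight theta/n of each square in the exponent. *)
Definition riccati {R : realType} (h q e : R) (j : nat) : R :=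
  iter j (fun a => e + q * (a / (1 - 2 * h * a))) 0.

(** The derivative of riccati h q (t * v) j at t = 0; it enters the mean of the
    time average. *)
Definition riccati1 {R : realType} (q v : R) (j : nat) : R :=
  iter j (fun l => v + q * l) 0.

(** The second order coefficient of riccati h q (t * v) j at t = 0; it enters
    half the variance parameter of the time average. *)
Fixpoint riccati2 {R : realType} (h q v : R) (j : nat) : R :=
  if j is k.+1 then q * (riccati2 h q v k + 2 * h * riccati1 q v k ^+ 2) else 0.

Lemma riccatiS (R : realType) (h q e : R) j : riccati h q e j.+1 =
  e + q * (riccati h q e j / (1 - 2 * h * riccati h q e j)).
Proof. by []. Qed.

Lemma riccati1S (R : realType) (q v : R) j :
  riccati1 q v j.+1 = v + q * riccati1 q v j.
Proof. by []. Qed.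

Lemma riccati_quad (R : realType) (h a : R) : 1 - 2 * h * a != 0 ->
  a / (1 - 2 * h * a) = a + 2 * h * a ^+ 2 / (1 - 2 * h * a).
Proof. by move=> ?; field. Qed.

Lemma riccati1_ge0 (R : realType) (q v : R) j : 0 <= q -> 0 <= v ->
  0 <= riccati1 q v j.
Proof.
by move=> q0 v0; elim: j => //= j IH; rewrite addr_ge0// mulr_ge0.
Qed.

Lemma riccati2_ge0 (R : realType) (h q v : R) j : 0 <= q -> 0 <= h ->
  0 <= riccati2 h q v j.
Proof.
move=> q0 h0; elim: j => //= j IH.
by rewrite mulr_ge0// addr_ge0// mulr_ge0 ?sqr_ge0// mulr_ge0.
Qed.

(** (2 kappa T)^-1 is the fixed point of the recursion for q = 1 - 2 kappa h. *)
Lemma riccati1_le (R : realType) (kappa T h q v : R) j :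
  0 < kappa -> 0 < T -> v * T = h -> 0 <= q <= 1 - 2 * kappa * h -> 0 <= h ->
  riccati1 q v j <= (2 * kappa * T)^-1.
Proof.
move=> k0 T0 vT /andP[q0 q1] h0; set l := _^-1.
have l0 : 0 <= l by rewrite invr_ge0 !mulr_ge0// ltW.
elim: j => // j; rewrite riccati1S => IH.
have -> : l = v + (1 - 2 * kappa * h) * l.
  by rewrite /l -vT; field; rewrite !gt_eqF.
by rewrite lerD2l; nra.
Qed.

Lemma riccati2_le (R : realType) (kappa T h q v : R) j :
  0 < kappa -> 0 < T -> v * T = h -> 0 <= q <= 1 - 2 * kappa * h -> 0 < h ->
  riccati2 h q v j <=
  (1 - 2 * kappa * h) * ((2 * kappa * T)^-1 ^+ 2 / kappa).
Proof.
move=> k0 T0 vT /[dup] qb /andP[q0 q1] h0.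
have v0 : 0 <= v by rewrite -(pmulr_lge0 _ T0) vT ltW.
set l := _^-1; set M := l ^+ 2 / kappa.
have l0 : 0 <= l by rewrite invr_ge0 !mulr_ge0// ltW.
have M0 : 0 <= M by rewrite divr_ge0 ?sqr_ge0// ltW.
have kM : kappa * M = l ^+ 2 by rewrite /M; field; rewrite gt_eqF.
elim: j => /= [|j IH]; first by rewrite mulr_ge0//; lra.
have lj : riccati1 q v j ^+ 2 <= l ^+ 2.
  rewrite ler_pXn2r ?nnegrE ?riccati1_ge0//.
  exact: (@riccati1_le _ kappa T h _ _ _ k0 T0 vT qb (ltW h0)).
have : riccati2 h q v j + 2 * h * riccati1 q v j ^+ 2 <= M.
  have : 2 * h * riccati1 q v j ^+ 2 <= 2 * h * l ^+ 2.
    by rewrite ler_wpM2l// mulr_ge0// ltW.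
  by rewrite -kM; lra.
have : 0 <= riccati2 h q v j + 2 * h * riccati1 q v j ^+ 2.
  by rewrite addr_ge0 ?riccati2_ge0 ?(ltW h0)// mulr_ge0 ?sqr_ge0// mulr_ge0 ?(ltW h0).
by nra.
Qed.

(** The factor 1 - 2 kappa h kept in riccati2_le leaves exactly the room needed for
    the term h^2 lambda_j^2. *)
Lemma riccati_step_var_le (R : realType) (kappa T h q v : R) j :
  0 < kappa -> 0 < T -> v * T = h -> 0 <= q <= 1 - 2 * kappa * h -> 0 < h ->
  h * riccati2 h q v j + h ^+ 2 * riccati1 q v j ^+ 2 <=
  h * ((2 * kappa * T)^-1 ^+ 2 / kappa).
Proof.
move=> k0 T0 vT qb h0.
have v0 : 0 <= v by rewrite -(pmulr_lge0 _ T0) vT ltW.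
have := @riccati2_le _ kappa T h q v j k0 T0 vT qb h0.
have := @riccati1_le _ kappa T h q v j k0 T0 vT qb (ltW h0).
case/andP: qb => q0 q1; have := @riccati1_ge0 _ q v j q0 v0.
set l := _^-1; set M := l ^+ 2 / kappa => l1 l2 B.
have l0 : 0 <= l by rewrite invr_ge0 !mulr_ge0// ltW.
have kM : kappa * M = l ^+ 2 by rewrite /M; field; rewrite gt_eqF.
have M0 : 0 <= M by rewrite divr_ge0 ?sqr_ge0// ltW.
have lj : riccati1 q v j ^+ 2 <= l ^+ 2 by rewrite ler_pXn2r ?nnegrE.
have hh : 0 <= h ^+ 2 by rewrite sqr_ge0.
have : h ^+ 2 * riccati1 q v j ^+ 2 <= h ^+ 2 * (kappa * M).
  by rewrite ler_wpM2l// kM.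
have : h * riccati2 h q v j <= h * ((1 - 2 * kappa * h) * M).
  by rewrite ler_wpM2l// ltW.
have h2kM : 0 <= h ^+ 2 * kappa * M.
  by rewrite mulr_ge0// mulr_ge0// ltW.
lra.
Qed.

(** For a negative exponent the denominators are at least 1, so that the solution stays
    between its first and second order expansions. *)
Lemma riccati_neg (R : realType) (h q v t : R) j :
  0 <= q -> 0 <= h -> 0 <= v -> 0 <= t ->
  riccati h q (- t * v) j <= 0 /\
  0 <= riccati h q (- t * v) j + t * riccati1 q v j <= t ^+ 2 * riccati2 h q v j.
Proof.
move=> q0 h0 v0 t0; elim: j => [|j [a0 /andP[b0 b1]]].
  by rewrite /riccati /riccati1 /= !mulr0 addr0 lexx.
rewrite riccatiS riccati1S /=.
have := riccati1_ge0 j q0 v0.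
move: a0 b0 b1; set a := riccati _ _ _ j; set l := riccati1 _ _ j.
set B := riccati2 _ _ _ j => a0 b0 b1 l0.
have D1 : 1 <= 1 - 2 * h * a by rewrite lerDl; nra.
have D0 : 0 < 1 - 2 * h * a by lra.
have -> : a / (1 - 2 * h * a) = a + 2 * h * (a ^+ 2 / (1 - 2 * h * a)).
  by rewrite riccati_quad ?gt_eqF// mulrA.
set A2 := a ^+ 2 / _.
have A20 : 0 <= A2 by rewrite divr_ge0 ?sqr_ge0// ltW.
have A2l : A2 <= (t * l) ^+ 2.
  apply: (@le_trans _ _ (a ^+ 2)).
    by rewrite ler_pdivrMr// ler_peMr ?sqr_ge0.
  by rewrite -(sqrrN a) ler_pXn2r ?nnegrE ?mulr_ge0 ?oppr_ge0//; lra.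
have qa : a + 2 * h * A2 <= 0.
  have -> : a + 2 * h * A2 = a / (1 - 2 * h * a).
    by rewrite /A2; field; rewrite gt_eqF.
  by rewrite mulr_le0_ge0// invr_ge0 ltW.
have hA : 0 <= h * A2 by rewrite mulr_ge0.
have hA' : h * A2 <= h * (t * l) ^+ 2 by rewrite ler_wpM2l.
split; first by nra.
have -> : - t * v + q * (a + 2 * h * A2) + t * (v + q * l) =
  q * (a + t * l + 2 * h * A2) by ring.
rewrite mulr_ge0//=; last by nra.
rewrite [leRHS]mulrCA ler_wpM2l//; nra.
Qed.

Lemma riccati_neg_step (R : realType) (h q v t : R) j :
  0 <= q -> 0 <= h -> 0 <= v -> 0 <= t ->
  h * riccati h q (- t * v) j + h ^+ 2 * riccati h q (- t * v) j ^+ 2 <=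
  - t * (h * riccati1 q v j) +
  t ^+ 2 * (h * riccati2 h q v j + h ^+ 2 * riccati1 q v j ^+ 2).
Proof.
move=> q0 h0 v0 t0; set a := riccati _ _ _ _; set l := riccati1 _ _ _.
have [a0 /andP[b0 b1]] := riccati_neg j q0 h0 v0 t0.
rewrite -/a -/l in a0 b0 b1.
have l0 : 0 <= l by exact: riccati1_ge0.
have a2 : a ^+ 2 <= (t * l) ^+ 2.
  by rewrite -(sqrrN a) ler_pXn2r ?nnegrE ?mulr_ge0 ?oppr_ge0//; lra.
have : h ^+ 2 * a ^+ 2 <= h ^+ 2 * (t * l) ^+ 2 by rewrite ler_wpM2l ?sqr_ge0.
have : h * (a + t * l) <= h * (t ^+ 2 * riccati2 h q v j) by rewrite ler_wpM2l.
by rewrite exprMn; lra.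
Qed.

(** A = t / (kappa T (2 - p)) is a supersolution of the recursion, because 2 A <= kappa p.
    Bounding a_j by A in the second order terms, one compares a_j - t lambda_j with
    the fixed point of the resulting linear recursion. *)
Lemma riccati_pos (R : realType) (kappa T h q v t p : R) j :
  0 < kappa -> 0 < T -> v * T = h -> 0 <= q <= 1 - 2 * kappa * h -> 0 < h ->
  0 <= p < 1 -> 0 <= t <= kappa ^+ 2 * T * p * (2 - p) / 2 ->
  let A := t / (kappa * T * (2 - p)) in
  let a := riccati h q (t * v) j in
  [/\ 0 <= 2 * h * A < 1, 2 * A <= kappa, 0 <= a <= A,
    t ^+ 2 * riccati2 h q v j <= a - t * riccati1 q v j &
    a - t * riccati1 q v j <=
      (1 - 2 * kappa * h) * (A ^+ 2 / (kappa * (1 - 2 * h * A)))].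
Proof.
move=> k0 T0 vT /andP[q0 q1] h0 /andP[p0 p1] /andP[t0 tp] A a.
have v0 : 0 <= v by rewrite -(pmulr_lge0 _ T0) vT ltW.
have p2 : 0 < 2 - p by lra.
have A0 : 0 <= A by rewrite divr_ge0 ?mulr_ge0// ?ltW.
have Ap : 2 * A <= kappa * p.
  rewrite /A mulrA ler_pdivrMr ?mulr_gt0//; nra.
have tvE : t * v = h * (A * kappa * (2 - p)).
  by rewrite /A -vT; field; rewrite !gt_eqF.
clearbody A; have Ak : 2 * A <= kappa by nra.
have kh : 2 * kappa * h <= 1 by lra.
have hA : 0 <= 2 * h * A by rewrite mulr_ge0 ?mulr_ge0 ?(ltW h0).
have hA1 : 2 * h * A < 1 by nra.
have D0 : 0 < 1 - 2 * h * A by lra.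
have super : t * v + (1 - 2 * kappa * h) * (A / (1 - 2 * h * A)) <= A.
  rewrite -lerBrDl mulrA ler_pdivrMr// tvE.
  have : 0 <= h * A by rewrite mulr_ge0// ltW.
  have : 0 <= h * A * A by rewrite mulr_ge0 ?mulr_ge0 ?(ltW h0).
  have : 0 <= (h * A) * (kappa * p - 2 * A) by rewrite mulr_ge0 ?mulr_ge0 ?(ltW h0)// subr_ge0.
  have : 0 <= (h * A) * (2 * h * A) * (kappa * (2 - p)).
    by rewrite !mulr_ge0 ?(ltW h0) ?(ltW k0) ?(ltW p2).
  lra.
rewrite hA hA1 Ak; suff [H1 H2 H3] : [/\ 0 <= a <= A,
    t ^+ 2 * riccati2 h q v j <= a - t * riccati1 q v j &
    a - t * riccati1 q v j <=
      (1 - 2 * kappa * h) * (A ^+ 2 / (kappa * (1 - 2 * h * A)))] by [].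
set M := A ^+ 2 / _.
have M0 : 0 <= M by rewrite divr_ge0 ?sqr_ge0// ltW// mulr_gt0.
have kM : kappa * M = A ^+ 2 / (1 - 2 * h * A).
  by rewrite /M; field; rewrite !gt_eqF.
rewrite /a; elim: j {a} => [|j].
  rewrite /riccati /riccati1/= !mulr0 subr0 lexx A0; split=> //.
  by rewrite mulr_ge0//; lra.
rewrite riccatiS riccati1S /=.
have := riccati1_ge0 j q0 v0; have := riccati2_ge0 v j q0 (ltW h0).
set a := riccati _ _ _ j; set l := riccati1 _ _ j; set B := riccati2 _ _ _ j.
move=> B0 l0 [/andP[a0 aA] b0 b1].
have Da : 0 < 1 - 2 * h * a by nra.
have Dle : 1 - 2 * h * A <= 1 - 2 * h * a by nra.
have -> : a / (1 - 2 * h * a) = a + 2 * h * (a ^+ 2 / (1 - 2 * h * a)).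
  by rewrite riccati_quad ?gt_eqF// mulrA.
set A2 := a ^+ 2 / _.
have aaA : a ^+ 2 <= A ^+ 2 by rewrite ler_pXn2r ?nnegrE.
have A2M : A2 <= kappa * M.
  rewrite kM /A2 ler_pM ?sqr_ge0 ?invr_ge0 ?(ltW Da)// lef_pV2 ?posrE//.
have A20 : 0 <= A2 by rewrite divr_ge0 ?sqr_ge0// ltW.
have A2l : (t * l) ^+ 2 <= A2.
  have tla : (t * l) ^+ 2 <= a ^+ 2.
    rewrite ler_pXn2r ?nnegrE ?mulr_ge0//.
    have : 0 <= t ^+ 2 * B by rewrite mulr_ge0// sqr_ge0.
    by lra.
  rewrite (le_trans tla)// ler_pdivlMr// ler_piMr ?sqr_ge0//.
  have : 0 <= h * a by rewrite mulr_ge0// ltW.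
  by lra.
have hA2 : h * A2 <= h * (kappa * M) by rewrite ler_wpM2l ?(ltW h0).
have hA20 : 0 <= h * A2 by rewrite mulr_ge0 ?(ltW h0).
have hl : h * (t * l) ^+ 2 <= h * A2 by rewrite ler_wpM2l ?(ltW h0).
have aA2 : a + 2 * h * A2 = a / (1 - 2 * h * a).
  by rewrite /A2; field; rewrite gt_eqF.
split.
- apply/andP; split; first by rewrite addr_ge0 ?mulr_ge0//; lra.
  apply: le_trans super; rewrite lerD2l ler_pM//; first by lra.
  by rewrite aA2 ler_pM ?invr_ge0 ?(ltW Da)// lef_pV2.
- have -> : t * v + q * (a + 2 * h * A2) - t * (v + q * l) =
    q * (a - t * l + 2 * h * A2) by ring.
  by rewrite [leLHS]mulrCA ler_wpM2l//; lra.
- have -> : t * v + q * (a + 2 * h * A2) - t * (v + q * l) =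
    q * (a - t * l + 2 * h * A2) by ring.
  have bM : a - t * l + 2 * h * A2 <= M by lra.
  have b0' : 0 <= a - t * l + 2 * h * A2.
    have : 0 <= t ^+ 2 * B by rewrite mulr_ge0// sqr_ge0.
    by lra.
  by rewrite ler_pM.
Qed.

Lemma riccati_pos_le (R : realType) (kappa T h q v t p : R) j :
  0 < kappa -> 0 < T -> v * T = h -> 0 <= q <= 1 - 2 * kappa * h -> 0 < h ->
  0 <= p < 1 -> 0 <= t <= kappa ^+ 2 * T * p * (2 - p) / 2 ->
  let A := t / (kappa * T * (2 - p)) in
  let a := riccati h q (t * v) j in
  let l := riccati1 q v j in
  a <= t * l + A ^+ 2 / kappa /\
  h * a + h ^+ 2 * a ^+ 2 / (1 - 2 * h * a) <= t * (h * l) + h * (A ^+ 2 / kappa).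
Proof.
move=> k0 T0 vT qb h0 pb tb A a l.
have [/andP[hA0 hA1] Ak /andP[a0 aA] _] := riccati_pos j k0 T0 vT qb h0 pb tb.
rewrite -/A -/a -/l in hA0 hA1 Ak a0 aA *.
clearbody A a l; set M := A ^+ 2 / (kappa * _) => bM.
have D0 : 0 < 1 - 2 * h * A by lra.
have M0 : 0 <= M by rewrite divr_ge0 ?sqr_ge0// ltW// mulr_gt0.
have -> : A ^+ 2 / kappa = M * (1 - 2 * h * A).
  by rewrite /M; field; rewrite !gt_eqF.
have hAM : 0 <= h * (kappa - 2 * A) * M.
  by rewrite mulr_ge0// mulr_ge0 ?(ltW h0)// subr_ge0.
have khM : 0 <= kappa * h * M by rewrite mulr_ge0// mulr_ge0 ?(ltW h0) ?(ltW k0).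
split; first by lra.
have ha : h * a <= h * A by rewrite ler_wpM2l ?(ltW h0).
have Da : 0 < 1 - 2 * h * a by lra.
have a2 : a ^+ 2 / (1 - 2 * h * a) <= kappa * M.
  have -> : kappa * M = A ^+ 2 / (1 - 2 * h * A).
    by rewrite /M; field; rewrite !gt_eqF.
  rewrite ler_pM ?sqr_ge0 ?invr_ge0 ?(ltW Da)//.
    by rewrite ler_pXn2r ?nnegrE// (le_trans a0).
  by rewrite lef_pV2 ?posrE//; lra.
have h2 : h ^+ 2 * (a ^+ 2 / (1 - 2 * h * a)) <= h ^+ 2 * (kappa * M).
  by rewrite ler_wpM2l ?sqr_ge0.
have hb : h * (a - t * l) <= h * ((1 - 2 * kappa * h) * M).
  by rewrite ler_wpM2l ?(ltW h0).
have hhAM : 0 <= h * (h * (kappa - 2 * A) * M) by rewrite mulr_ge0 ?(ltW h0).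
by rewrite -mulrA in h2 *; lra.
Qed.

(** The odd orders in t of the solutions at t and -t cancel, and the squares and cubes
    are compared through a_j >= 2 t lambda_j - u_j >= u_j, where - u_j is the
    solution at -t. The right-hand side is the Taylor polynomial of
    - ln (1 - x) / 2 - ln (1 - y) / 2. *)
Lemma riccati_two_sided (R : realType) (kappa T h q v t p : R) j :
  0 < kappa -> 0 < T -> v * T = h -> 0 <= q <= 1 - 2 * kappa * h -> 0 < h ->
  0 <= p < 1 -> 0 <= t <= kappa ^+ 2 * T * p * (2 - p) / 2 ->
  let a := riccati h q (t * v) j in
  let b := riccati h q (- t * v) j in
  let x := 2 * h * a in
  let y := 2 * h * b in
  2 * (t ^+ 2 * riccati2 h q v j) <= a + b /\
  2 * (t ^+ 2 * (h * riccati2 h q v j + h ^+ 2 * riccati1 q v j ^+ 2)) <=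
  x / 2 + x ^+ 2 / 4 + x ^+ 3 / 6 + (y / 2 + y ^+ 2 / 4 + y ^+ 3 / 6).
Proof.
move=> k0 T0 vT qb h0 pb tb.
have v0 : 0 <= v by rewrite -(pmulr_lge0 _ T0) vT ltW.
have t0 : 0 <= t by case/andP: tb.
have q0 : 0 <= q by case/andP: qb.
have pos i := riccati_pos i k0 T0 vT qb h0 pb tb.
have neg i := riccati_neg i q0 (ltW h0) v0 t0.
pose a i := riccati h q (t * v) i.
pose u i := - riccati h q (- t * v) i.
pose l i := t * riccati1 q v i.
have l0 i : 0 <= l i by rewrite mulr_ge0 ?riccati1_ge0.
have u0 i : 0 <= u i by rewrite oppr_ge0; have [] := neg i.
have ul i : u i <= l i.
  by have [_ /andP[]] := neg i; rewrite /u /l; lra.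
have aul i : 2 * l i - u i <= a i.
  by have [_ /andP[_ ?]] := neg i; have [_ _ _ ? _] := pos i; rewrite /u /l /a; lra.
have ha1 i : 2 * h * a i < 1.
  have [/andP[_ hA1] _ /andP[_ aA] _ _] := pos i.
  by rewrite (le_lt_trans _ hA1)// ler_wpM2l// mulr_ge0 ?(ltW h0).
have sq i : 2 * l i ^+ 2 <= a i ^+ 2 + u i ^+ 2.
  have := aul i; have := ul i; have := l0 i; have := u0 i; nra.
have cube i : u i ^+ 3 <= a i ^+ 3.
  have := aul i; have := ul i; have := l0 i; have := u0 i => *.
  by rewrite ler_pXn2r ?nnegrE//; lra.
have sum i : 2 * (t ^+ 2 * riccati2 h q v i) <= a i - u i.
  elim: i => [|i IH].
    by rewrite /a /u /riccati/= !mulr0 oppr0 subr0.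
  rewrite /a /u !riccatiS /= -/(a i); have : riccati h q (- t * v) i = - u i.
    by rewrite /u opprK.
  move=> ->; have a0 : 0 <= a i by have [_ _ /andP[]] := pos i.
  have h_ge0 := ltW h0.
  have hu : 0 <= h * u i by rewrite mulr_ge0.
  have Da : 0 < 1 - 2 * h * a i by have := ha1 i; lra.
  have Du : 0 < 1 - 2 * h * - u i by lra.
  rewrite !riccati_quad ?gt_eqF// sqrrN.
  have Aa : a i ^+ 2 + 2 * h * a i ^+ 3 <= a i ^+ 2 / (1 - 2 * h * a i).
    rewrite ler_pdivlMr//.
    have -> : (a i ^+ 2 + 2 * h * a i ^+ 3) * (1 - 2 * h * a i) =
      a i ^+ 2 - (2 * h * a i * a i) ^+ 2 by ring.
    by rewrite gerBl sqr_ge0.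
  have Au : u i ^+ 2 - 2 * h * u i ^+ 3 <= u i ^+ 2 / (1 - 2 * h * - u i).
    rewrite ler_pdivlMr//.
    have -> : (u i ^+ 2 - 2 * h * u i ^+ 3) * (1 - 2 * h * - u i) =
      u i ^+ 2 - (2 * h * u i * u i) ^+ 2 by ring.
    by rewrite gerBl sqr_ge0.
  have hc : h * u i ^+ 3 <= h * a i ^+ 3 by rewrite ler_wpM2l.
  have tot : 2 * l i ^+ 2 <=
      a i ^+ 2 / (1 - 2 * h * a i) + u i ^+ 2 / (1 - 2 * h * - u i).
    by have := sq i; lra.
  have htot := ler_wpM2l h_ge0 tot.
  rewrite -[2 * h * a i ^+ 2 / _]mulrA -[2 * h * u i ^+ 2 / _]mulrA.
  set X := a i ^+ 2 / _ in htot *; set Y := u i ^+ 2 / _ in htot *.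
  have -> : t * v + q * (a i + 2 * h * X) -
    - (- t * v + q * (- u i + 2 * h * Y)) = q * (a i - u i + 2 * h * (X + Y)).
    by ring.
  have -> : 2 * (t ^+ 2 * (q * (riccati2 h q v i + 2 * h * riccati1 q v i ^+ 2)))
    = q * (2 * (t ^+ 2 * riccati2 h q v i) + 2 * h * (2 * l i ^+ 2)).
    by rewrite /l; ring.
  by rewrite ler_wpM2l//; lra.
rewrite /= -/(a j) -[riccati h q (- t * v) j]opprK -/(u j).
split; first exact: sum.
have h_ge0 := ltW h0.
have hs := ler_wpM2l h_ge0 (sum j).
have h2 := ler_wpM2l (sqr_ge0 h) (sq j).
have h3 := ler_wpM2l (exprn_ge0 3 h_ge0) (cube j).
rewrite /l in h2; lra.
Qed.

(** * Exponential moments and the moments of order 1, 2 and 4 *)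

Lemma expR_ge_taylor3 (R : realType) (x : R) :
  1 + x + x ^+ 2 / 2 + x ^+ 3 / 6 <= expR x.
Proof.
have dp (t : R) : is_derive t 1 (fun x : R => 1 + x + x ^+ 2 / 2 + x ^+ 3 / 6)
    (1 + t + t ^+ 2 / 2).
  by apply: is_derive_eq; rewrite /GRing.scale/=; field.
have dq (t : R) : is_derive t 1 (fun x : R => - x) (-1).
  exact: is_derive_eq.
have : 0 <= 1 + -1 * ((1 + x + x ^+ 2 / 2 + x ^+ 3 / 6) * expR (- x)).
  have b0 : 0 < `|x| + 1 by rewrite ltr_wpDl.
  have xb : x < `|x| + 1 by rewrite (le_lt_trans (ler_norm x))// ltrDl.
  apply: (@ge0_of_is_derive R _ _ _ x b0 xb
    (fun t _ => @is_derive_polyexp R 1 (-1) _ _ t _ _ (dp t) (dq t))) => //.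
    by rewrite !expr0n/= !mul0r !addr0 oppr0 expR0; ring.
  move=> t _ _; have -> : forall e : R, t * (-1 * ((1 + t + t ^+ 2 / 2 +
     (1 + t + t ^+ 2 / 2 + t ^+ 3 / 6) * -1) * e)) = (t ^+ 2) ^+ 2 / 6 * e.
    by move=> e; field.
  by rewrite mulr_ge0 ?expR_ge0// divr_ge0// sqr_ge0.
rewrite !mulN1r subr_ge0 expRN ler_pdivrMr ?expR_gt0// mul1r.
exact.
Qed.

Lemma expR_le_onemV (R : realType) (x : R) : x < 1 -> expR x <= (1 - x)^-1.
Proof.
move=> x1; rewrite -[expR x]invrK lef_pV2 ?posrE ?invr_gt0 ?expR_gt0 ?subr_gt0//.
by rewrite -expRN; apply: le_trans (expR_ge1Dx _); rewrite addrC.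
Qed.

Lemma expR_le_quad (R : realType) (x : R) : 0 <= x <= 1 / 2 ->
  expR x <= 1 + x + 2 * x ^+ 2.
Proof.
move=> /andP[x0 x1]; apply: le_trans (expR_le_onemV _) _; first by lra.
rewrite -[leLHS]mul1r ler_pdivrMr; last by lra.
by nra.
Qed.

(** This is how the limit t -> 0 is taken in the moment computations. *)
Lemma le0_of_small (R : realType) (a K b : R) : 0 < b ->
  (forall t : R, 0 < t <= b -> a <= K * t) -> a <= 0.
Proof.
move=> b0 ab; rewrite leNgt; apply/negP => a0.
have K0 : 0 < K.
  have : 0 < K * b by apply: lt_le_trans a0 (ab _ _); rewrite b0 lexx.
  by rewrite pmulr_lgt0.
have t0 : 0 < Num.min b (a / (2 * K)).
  by rewrite lt_min b0 divr_gt0// mulr_gt0.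
have := ab (Num.min b (a / (2 * K))); rewrite t0 ge_min lexx => /(_ isT).
apply/negP; rewrite -ltNge.
have : K * Num.min b (a / (2 * K)) <= K * (a / (2 * K)).
  by rewrite ler_wpM2l ?(ltW K0)// ge_min lexx orbT.
have -> : K * (a / (2 * K)) = a / 2 by field; rewrite gt_eqF.
by lra.
Qed.

Section moments.
Context (R : realType) (dO : measure_display) (Omega : measurableType dO)
  (P : probability Omega R).
Implicit Types (Z : Omega -> R).

Definition expmoment Z (t : R) : \bar R := (\int[P]_w (expR (t * Z w))%:E)%E.

Local Notation "''E' f" := (\int[P]_w f w)%R (at level 10, f at level 9).

Lemma integrable_scale (f : Omega -> R) (c : R) :
  P.-integrable setT (EFin \o f) ->
  P.-integrable setT (EFin \o (fun w => c * f w)).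
Proof.
move=> /(integrableZl measurableT c); exact: eq_integrable.
Qed.

Lemma integrable_add (f g : Omega -> R) :
  P.-integrable setT (EFin \o f) -> P.-integrable setT (EFin \o g) ->
  P.-integrable setT (EFin \o (fun w => f w + g w)).
Proof.
move=> fi /(integrableD measurableT fi); exact: eq_integrable.
Qed.

Lemma measurable_expR_scale Z t : measurable_fun setT Z ->
  measurable_fun setT (fun w => expR (t * Z w)).
Proof. by move=> mZ; apply: measurableT_comp => //; exact: measurable_funM. Qed.

Lemma integrable_expmoment Z t : measurable_fun setT Z ->
  (expmoment Z t < +oo)%E -> P.-integrable setT (EFin \o (fun w => expR (t * Z w))).
Proof.
move=> mZ fin; apply/integrableP; split.
  by apply/measurable_EFinP; exact: measurable_expR_scale.
by under eq_integral do rewrite /= ger0_norm ?expR_ge0//.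
Qed.

Lemma expmomentE Z t : measurable_fun setT Z -> (expmoment Z t < +oo)%E ->
  expmoment Z t = ('E (fun w => expR (t * Z w)))%:E.
Proof.
move=> mZ fin; rewrite /Rintegral fineK// ge0_fin_numE//.
by apply: integral_ge0 => w _; rewrite lee_fin expR_ge0.
Qed.

Lemma integrable_cosh Z t : measurable_fun setT Z ->
  (expmoment Z t < +oo)%E -> (expmoment Z (- t) < +oo)%E ->
  P.-integrable setT (EFin \o (fun w => cosh (t * Z w))).
Proof.
move=> mZ fin1 fin2.
have := integrableD measurableT (integrable_expmoment mZ fin1)
  (integrable_expmoment mZ fin2).
move/(integrableZl measurableT 2^-1%R); apply: eq_integrable => // w _ /=.
by rewrite -EFinD -EFinM /cosh mulNr mulrC.
Qed.

Lemma Rintegral_cosh Z t : measurable_fun setT Z ->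
  (expmoment Z t < +oo)%E -> (expmoment Z (- t) < +oo)%E ->
  'E (fun w => cosh (t * Z w)) =
  ('E (fun w => expR (t * Z w)) + 'E (fun w => expR (- t * Z w))) / 2.
Proof.
move=> mZ fin1 fin2.
rewrite -RintegralD//; [|exact: integrable_expmoment|exact: integrable_expmoment].
rewrite mulrC -RintegralZl//; last first.
  exact: (integrableD measurableT (integrable_expmoment mZ fin1)
    (integrable_expmoment mZ fin2)).
by apply: eq_Rintegral => w _; rewrite /cosh mulNr mulrC.
Qed.

(** A power of Z is dominated by a multiple of cosh (t Z). *)
Lemma integrable_moment Z t k : measurable_fun setT Z -> 0 < t ->
  (expmoment Z t < +oo)%E -> (expmoment Z (- t) < +oo)%E ->
  P.-integrable setT (EFin \o (fun w => Z w ^+ k)).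
Proof.
move=> mZ t0 fin1 fin2.
pose K := 1 + (k.*2)`!%:R / t ^+ k.*2.
have tk : 0 < t ^+ k.*2 by rewrite exprn_gt0.
have ic := integrableZl measurableT K (integrable_cosh mZ fin1 fin2).
apply: (le_integrable measurableT _ _ ic).
  by apply/measurable_EFinP; exact: measurable_funX.
move=> w _ /=; rewrite lee_fin.
have c1 : 1 <= cosh (t * Z w).
  have := cosh_taylor_le 1 (t * Z w).
  by rewrite /cosh_taylor big_nat1 expr0 fact0 divr1.
have ck : (t * Z w) ^+ k.*2 / (k.*2)`!%:R <= cosh (t * Z w).
  apply: le_trans (cosh_taylor_le k.+1 _); rewrite cosh_taylorS lerDr.
  by rewrite /cosh_taylor sumr_ge0// => i _; rewrite divr_ge0// -mul2n exprM exprn_ge0// sqr_ge0.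
have f0 : 0 < (k.*2)`!%:R :> R by rewrite ltr0n fact_gt0.
have zk : Z w ^+ k.*2 <= (k.*2)`!%:R / t ^+ k.*2 * cosh (t * Z w).
  rewrite mulrAC ler_pdivlMr//; move: ck.
  by rewrite exprMn ler_pdivrMr// [X in X <= _ -> _]mulrC [cosh _ * _]mulrC.
rewrite [leRHS]ger0_norm; last first.
  by rewrite mulr_ge0// ?addr_ge0 ?divr_ge0 ?(ltW tk) ?ler0n// (le_trans _ c1).
rewrite /K mulrDl mul1r (le_trans _ (lerD c1 zk))//.
rewrite -addnn exprD -expr2 normrX -(real_normK (num_real (Z w ^+ k))) normrX.
set y := `|Z w| ^+ k; have : 0 <= (y - 1) ^+ 2 by rewrite sqr_ge0.
have : 0 <= y ^+ 2 by rewrite sqr_ge0.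
by nra.
Qed.

(** Comparing the exponential moments with Gaussian ones at all small exponents pins
    down the Taylor coefficients at 0. The first two hypotheses give the mean and
    the variance; for the fourth moment, the sum of the two exponential moments is
    2 E cosh (t Z), whose terms of order 6 and more are O(t^6), while its terms of
    order 0 and 2 are at most those of 2 exp(t^2 v / 2). *)
Lemma moments_of_expmoment Z (v C t0 : R) : measurable_fun setT Z ->
  0 < t0 -> 0 <= v -> 0 < C ->
  (forall t : R, 0 <= t <= t0 -> (expmoment Z t <= (expR (C * t ^+ 2))%:E)%E) ->
  (forall t : R, 0 <= t <= t0 ->
     (expmoment Z (- t) <= (expR (t ^+ 2 * (v / 2)))%:E)%E) ->
  (forall t : R, 0 <= t <= t0 ->
     ((2 * expR (t ^+ 2 * (v / 2)))%:E <= expmoment Z t + expmoment Z (- t))%E) ->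
  [/\ 'E Z = 0, 'E (fun w => Z w ^+ 2) <= v &
      3 * v ^+ 2 <= 'E (fun w => Z w ^+ 4)].
Proof.
move=> mZ t00 v0 C0 Hp Hn Hs.
have finp (t : R) : 0 <= t <= t0 -> (expmoment Z t < +oo)%E.
  by move=> tb; rewrite (le_lt_trans (Hp _ tb))// ltry.
have finn (t : R) : 0 <= t <= t0 -> (expmoment Z (- t) < +oo)%E.
  by move=> tb; rewrite (le_lt_trans (Hn _ tb))// ltry.
have t0t0 : 0 <= t0 <= t0 by rewrite lexx ltW.
have iZ k := integrable_moment k mZ t00 (finp _ t0t0) (finn _ t0t0).
have iZ1 : P.-integrable setT (EFin \o Z).
  by apply: eq_integrable (iZ 1%N) => // w _ /=; rewrite expr1.
have i1 (c : R) : P.-integrable setT (EFin \o (fun=> c)).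
  exact: finite_measure_integrable_cst.
have E1 (c : R) : 'E (fun=> c) = c.
  rewrite Rintegral_cst// (_ : fine _ = 1) ?mulr1//.
  exact: (congr1 fine (@probability_setT _ _ _ P)).
have iexp t : 0 <= t <= t0 -> P.-integrable setT (EFin \o (fun w => expR (t * Z w))).
  by move=> tb; apply: integrable_expmoment => //; exact: finp.
have iexpN t : 0 <= t <= t0 ->
    P.-integrable setT (EFin \o (fun w => expR (- t * Z w))).
  by move=> tb; apply: integrable_expmoment => //; exact: finn.
have Hp' t : 0 <= t <= t0 -> 'E (fun w => expR (t * Z w)) <= expR (C * t ^+ 2).
  by move=> tb; rewrite -lee_fin -expmomentE ?finp ?Hp.
have Hn' t : 0 <= t <= t0 ->
    'E (fun w => expR (- t * Z w)) <= expR (t ^+ 2 * (v / 2)).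
  by move=> tb; rewrite -lee_fin -expmomentE ?finn ?Hn.
pose b := Num.min t0 (Num.min 1 (2 * C + v + 1)^-1).
have D0 : 0 < 2 * C + v + 1 by lra.
have b0 : 0 < b by rewrite !lt_min t00 invr_gt0 D0 ltr01.
have bP (t : R) : 0 < t <= b -> [/\ 0 <= t <= t0, 0 <= C * t ^+ 2 <= 1 / 2 &
    0 <= t ^+ 2 * (v / 2) <= 1 / 2].
  move=> /andP[tgt0]; rewrite !le_min => /and3P[tt0 t1].
  rewrite -[_^-1]mul1r ler_pdivlMr// => tD.
  have tt : t ^+ 2 <= t by rewrite expr2; nra.
  have t2 : 0 <= t ^+ 2 by rewrite sqr_ge0.
  have tC : 0 <= C * t by nra.
  have tv : 0 <= t * v by nra.
  split; first by rewrite (ltW tgt0) tt0.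
  - by apply/andP; split; nra.
  - by apply/andP; split; nra.
have quad (x : R) : 0 <= x <= 1 / 2 -> expR x <= 1 + 2 * x.
  by move=> /[dup] xb /expR_le_quad /le_trans; apply; case/andP: xb; nra.
have lin (c : R) : 'E (fun w => 1 + c * Z w) = 1 + c * 'E Z.
  by rewrite RintegralD// ?E1 ?RintegralZl//; exact: integrable_scale.
have ilin (c : R) : P.-integrable setT (EFin \o (fun w => 1 + c * Z w)).
  by apply: integrable_add => //; exact: integrable_scale.
have EZ_le0 : 'E Z <= 0.
  apply: (@le0_of_small _ _ (2 * C) b) => // t tb.
  have [tt0 Ct _] := bP t tb; have tgt0 : 0 < t by case/andP: tb.
  have := Hp' t tt0; have := quad _ Ct.
  have : 1 + t * 'E Z <= 'E (fun w => expR (t * Z w)).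
    by rewrite -lin le_Rintegral// ?iexp// => w _; exact: expR_ge1Dx.
  by move=> L1 L2 L3; rewrite -(ler_pM2l tgt0); lra.
have EZ_ge0 : 0 <= 'E Z.
  rewrite -oppr_le0; apply: (@le0_of_small _ _ v b) => // t tb.
  have [tt0 _ vt] := bP t tb; have tgt0 : 0 < t by case/andP: tb.
  have := Hn' t tt0; have := quad _ vt.
  have : 1 + - t * 'E Z <= 'E (fun w => expR (- t * Z w)).
    by rewrite -lin le_Rintegral// ?iexpN// => w _; exact: expR_ge1Dx.
  by move=> L1 L2 L3; rewrite -(ler_pM2l tgt0); lra.
have EZ0 : 'E Z = 0 by apply/eqP; rewrite eq_le EZ_le0.
have iZk (c : R) k : P.-integrable setT (EFin \o (fun w => c * Z w ^+ k)).
  by apply: integrable_scale.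
have EZ2 : 'E (fun w => Z w ^+ 2) <= v.
  rewrite -subr_le0.
  apply: (@le0_of_small _ _ ('E (fun w => Z w ^+ 3) / 3 + v ^+ 2) b) => // t tb.
  have [tt0 _ vt] := bP t tb.
  have t1 : t <= 1 by case/andP: tb; rewrite /b !le_min => _ /and3P[].
  have tgt0 : 0 < t by case/andP: tb.
  have := Hn' t tt0; have := expR_le_quad vt.
  have j1 := ilin (- t).
  have j2 := integrable_add j1 (iZk (t ^+ 2 / 2) 2%N).
  have j3 := integrable_add j2 (iZk (- (t ^+ 3 / 6)) 3%N).
  have : 1 + t ^+ 2 / 2 * 'E (fun w => Z w ^+ 2) + - (t ^+ 3 / 6) *
      'E (fun w => Z w ^+ 3) <= 'E (fun w => expR (- t * Z w)).
    have -> : 1 + t ^+ 2 / 2 * 'E (fun w => Z w ^+ 2) + - (t ^+ 3 / 6) *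
      'E (fun w => Z w ^+ 3) = 'E (fun w => 1 + - t * Z w +
         t ^+ 2 / 2 * Z w ^+ 2 + - (t ^+ 3 / 6) * Z w ^+ 3).
      rewrite RintegralD// RintegralD ?lin ?EZ0 ?mulr0 ?addr0//.
      by rewrite !RintegralZl.
    apply: le_Rintegral => //; first exact: iexpN.
    by move=> w _; apply: le_trans (expR_ge_taylor3 _); lra.
  set m2 := 'E (fun w => Z w ^+ 2); set m3 := 'E (fun w => Z w ^+ 3) => L1 L2 L3.
  have tv : t ^+ 2 * v ^+ 2 <= t * v ^+ 2.
    by rewrite ler_wpM2r ?sqr_ge0// expr2 ler_piMr// ltW.
  rewrite -(ler_pM2l (exprn_gt0 2 tgt0)).
  have t20 : 0 <= t ^+ 2 by rewrite sqr_ge0.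
  have := ler_wpM2l t20 tv; lra.
split=> //; rewrite -subr_le0.
pose Kc := 'E (fun w => cosh (t0 * Z w)).
apply: (@le0_of_small _ _ (24 * Kc / t0 ^+ 6) b) => // t tb.
have [tt0 _ vt] := bP t tb; have tgt0 : 0 < t by case/andP: tb.
have t1 : t <= 1 by case/andP: tb; rewrite /b !le_min => _ /and3P[].
have ic : P.-integrable setT (EFin \o (fun w => cosh (t0 * Z w))).
  by apply: integrable_cosh => //; [exact: finp|exact: finn].
have Kc0 : 0 <= Kc.
  by apply: Rintegral_ge0 => w _; rewrite divr_ge0// addr_ge0 ?expR_ge0.
have j2 := integrable_add (i1 1) (iZk (t ^+ 2 / 2) 2%N).
have j4 := integrable_add j2 (iZk (t ^+ 4 / 24) 4%N).
have j0 := integrable_scale ((t / t0) ^+ 6) ic.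
have j6 := integrable_add j4 j0.
have up : 'E (fun w => cosh (t * Z w)) <= 1 + t ^+ 2 / 2 *
    'E (fun w => Z w ^+ 2) + t ^+ 4 / 24 * 'E (fun w => Z w ^+ 4) +
    (t / t0) ^+ 6 * Kc.
  have -> : 1 + t ^+ 2 / 2 * 'E (fun w => Z w ^+ 2) + t ^+ 4 / 24 *
      'E (fun w => Z w ^+ 4) + (t / t0) ^+ 6 * Kc =
      'E (fun w => 1 + t ^+ 2 / 2 * Z w ^+ 2 + t ^+ 4 / 24 * Z w ^+ 4 +
        (t / t0) ^+ 6 * cosh (t0 * Z w)).
    rewrite RintegralD// RintegralD// RintegralD// E1 !RintegralZl//.
  apply: le_Rintegral => //.
    by apply: integrable_cosh => //; [exact: finp|exact: finn].
  move=> w _; have -> : t * Z w = t / t0 * (t0 * Z w) by field; rewrite gt_eqF.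
  apply: le_trans (@cosh_scale_le _ 3 _ _ _) _.
    by rewrite divr_ge0 ?(ltW tgt0) ?(ltW t00)//= ler_pdivrMr// mul1r; case/andP: tt0.
  have -> : cosh_taylor 3 (t / t0 * (t0 * Z w)) =
      1 + t ^+ 2 / 2 * Z w ^+ 2 + t ^+ 4 / 24 * Z w ^+ 4.
    rewrite /cosh_taylor !big_nat_recr//= big_geq// add0r.
    by rewrite (_ : (0.*2)`! = 1)%N// (_ : (1.*2)`! = 2)%N// (_ : (2.*2)`! = 24)%N//;
      field; rewrite gt_eqF.
  exact: lexx.
have low : expR (t ^+ 2 * (v / 2)) <= 'E (fun w => cosh (t * Z w)).
  rewrite Rintegral_cosh; [|exact: mZ|exact: finp|exact: finn].
  rewrite ler_pdivlMr// mulrC -lee_fin EFinD.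
  by rewrite -!expmomentE ?Hs//; [exact: finn|exact: finp].
have := expR_ge_taylor3 (t ^+ 2 * (v / 2)).
move: up low.
set m2 := 'E (fun w => Z w ^+ 2) in EZ2 *.
set m4 := 'E (fun w => Z w ^+ 4) => up low L.
have v3 : 0 <= (t ^+ 2 * (v / 2)) ^+ 3 by rewrite exprn_ge0//; case/andP: vt.
have t4 : 0 < t ^+ 4 by rewrite exprn_gt0.
have tEZ2 := ler_wpM2l (sqr_ge0 t) EZ2.
have lim : t ^+ 4 * (3 * v ^+ 2 - m4) <= 24 * ((t / t0) ^+ 6 * Kc) by lra.
rewrite -(ler_pM2l t4) (le_trans lim)//.
have -> : 24 * ((t / t0) ^+ 6 * Kc) = t ^+ 4 * (24 * Kc / t0 ^+ 6 * t ^+ 2).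
  by field; rewrite gt_eqF.
rewrite ler_wpM2l ?(ltW t4)// ler_wpM2l//.
  by rewrite divr_ge0 ?mulr_ge0 ?exprn_ge0 ?(ltW t00).
by rewrite expr2 ler_piMr// ltW.
Qed.
End moments.

(** * The scalar function bounding the cube of the probability *)

Definition tail_bound {R : realType} (y : R) : R :=
  2 * Num.min 1 (1 / (3 * y)) * expR (- y).

(** e^x <= 1 / (1 - x) improved to third order, then raised to the power n: a rational
    upper bound for a numerical exponential. *)
Lemma expR_le_pow (R : realType) n (x c E : R) : 0 <= x < 1 ->
  E <= n%:R * (x + x ^+ 2 / 2 + x ^+ 3 / 3) -> 1 <= c * (1 - x) ^+ n ->
  expR E <= c.
Proof.
move=> /andP[x0 x1] En cx; have x1' : 0 < 1 - x by rewrite subr_gt0.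
have xn : 0 < (1 - x) ^+ n by rewrite exprn_gt0.
rewrite -(ler_pM2r xn) (le_trans _ cx)//.
rewrite (@le_trans _ _ ((expR (x + x ^+ 2 / 2 + x ^+ 3 / 3) * (1 - x)) ^+ n))//.
  by rewrite exprMn -expRM_natl ler_pM2r// ler_expR.
rewrite exprn_ile1 ?mulr_ge0 ?expR_ge0 ?(ltW x1')//.
by rewrite mulrC onem_expR_le1.
Qed.

Lemma expR_half_le (R : realType) : expR (1 / 2) <= 33 / 20 :> R.
Proof. by apply: (@expR_le_pow R 6 (2 / 25)); lra. Qed.

Lemma gap_cubic_le (R : realType) (y : R) : 43 / 100 <= y <= 3 / 5 ->
  3 * (33 / 20) * (439 / 1000 * y + 301 / 1250) ^+ 3 <=
  2 * y ^+ 2 * (3 / 2 - y).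
Proof.
move=> /andP[y0 y1]; have h0 : 0 <= (y - 43 / 100) * (3 / 5 - y).
  by rewrite mulr_ge0// subr_ge0.
have h1 : 0 <= (y - 43 / 100) * (3 / 5 - y) * (y - 43 / 100).
  by rewrite mulr_ge0// subr_ge0.
lra.
Qed.

Lemma large_dev_cubic_ge (R : realType) (y : R) : 43 / 100 <= y <= 3 / 5 ->
  3 * (33 / 20) <= 16 * (581 / 500) ^+ 3 * y ^+ 2 * (3 / 2 - y).
Proof.
move=> /andP[y0 y1].
have : 0 <= (y - 43 / 100) * (3 / 2 * (y + 43 / 100) -
    (y ^+ 2 + 43 / 100 * y + (43 / 100) ^+ 2)).
  by rewrite mulr_ge0 ?subr_ge0//; nra.
lra.
Qed.

Lemma expR_le_near_half (R : realType) (y : R) : y < 3 / 2 ->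
  expR y * (3 / 2 - y) <= 33 / 20.
Proof.
move=> y1; have y2 : y - 1 / 2 < 1 by lra.
have -> : expR y = expR (1 / 2) * expR (y - 1 / 2).
  by rewrite -expRD; congr expR; ring.
apply: le_trans (@expR_half_le R); rewrite -mulrA ler_piMr ?expR_ge0//.
have := expR_le_onemV y2; rewrite -[leRHS]mul1r ler_pdivlMr; last by lra.
by move=> h; rewrite (_ : 3 / 2 - y = 1 - (y - 1 / 2))//; field.
Qed.

Lemma le_tail_bound (R : realType) (y c : R) : 0 < y -> 0 <= c ->
  c * expR y <= 2 -> 3 * y * c * expR y <= 2 -> c <= tail_bound y.
Proof.
move=> y0 c0 c1 c2; rewrite /tail_bound expRN.
rewrite ler_pdivlMr ?expR_gt0// -ler_pdivrMl// le_min.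
apply/andP; split; first by lra.
by rewrite ler_pdivlMr ?mulr_gt0//; lra.
Qed.

(** The right-hand side is at least 1 on this range. *)
Lemma tail_bound_small (R : realType) (y F : R) : 0 < y <= 43 / 100 ->
  0 <= F <= 1 -> F ^+ 3 <= tail_bound y.
Proof.
move=> /andP[y0 y1] /andP[F0 F1].
have ey : expR y <= 2.
  apply: le_trans (expR_le_onemV _) _; first by lra.
  by rewrite invf_ple ?posrE//; lra.
have ey3 : 3 * y * expR y <= 2.
  have y32 : y < 3 / 2 by lra.
  by have := expR_le_near_half y32; have := expR_ge0 y; nra.
have F31 : F ^+ 3 <= 1 by rewrite exprn_ile1.
have F30 : 0 <= F ^+ 3 by rewrite exprn_ge0.
apply: le_tail_bound => //; first by have := expR_ge0 y; nra.
have : 0 <= 3 * y * expR y by rewrite mulr_ge0 ?expR_ge0// mulr_ge0// ltW.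
by nra.
Qed.

(** Beyond y = 1/3 the minimum in tail_bound is 1/(3y). *)
Lemma tail_bound_of_cube (R : realType) (y F c : R) : 1 / 3 <= y -> 0 <= F ->
  F * y <= c -> 3 * c ^+ 3 * expR y <= 2 * y ^+ 2 -> F ^+ 3 <= tail_bound y.
Proof.
move=> y0 F0 Fc cy; have y00 : 0 < y by lra.
have c0 : 0 <= c by rewrite (le_trans _ Fc)// mulr_ge0// ltW.
have Fy : 3 * y * F ^+ 3 * expR y <= 2.
  have y2 : 0 < y ^+ 2 by rewrite exprn_gt0.
  rewrite -(ler_pM2l y2).
  have -> : y ^+ 2 * (3 * y * F ^+ 3 * expR y) = 3 * (F * y) ^+ 3 * expR y.
    by ring.
  rewrite [leRHS]mulrC; apply: le_trans cy.
  rewrite ler_wpM2r ?expR_ge0// ler_wpM2l// lerXn2r ?nnegrE// mulr_ge0//.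
  exact: ltW.
apply: le_tail_bound; rewrite ?exprn_ge0//.
have : 0 <= F ^+ 3 * expR y by rewrite mulr_ge0 ?expR_ge0// exprn_ge0.
by nra.
Qed.

Lemma tail_bound_gap (R : realType) (y F : R) : 43 / 100 <= y <= 3 / 5 ->
  0 <= F -> F <= 999 / 1000 - 14 / 25 * (1 - 43 / 100 / y) ->
  F ^+ 3 <= tail_bound y.
Proof.
move=> yb F0; have y13 : 1 / 3 <= y by lra.
have y00 : 0 < y by lra.
have y3 : 0 < 3 / 2 - y by lra.
have -> : 999 / 1000 - 14 / 25 * (1 - 43 / 100 / y) =
    (439 / 1000 * y + 301 / 1250) / y by field; rewrite gt_eqF.
rewrite ler_pdivlMr// => Fy; apply: (tail_bound_of_cube y13 F0 Fy).
have c0 : 0 <= 439 / 1000 * y + 301 / 1250 by lra.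
have := gap_cubic_le yb; move: c0; set c := _ + _ => c0 c1.
rewrite -(ler_pM2r y3); apply: le_trans c1.
have -> : 3 * c ^+ 3 * expR y * (3 / 2 - y) =
  3 * (expR y * (3 / 2 - y)) * c ^+ 3 by ring.
apply: ler_wpM2r; first exact: exprn_ge0.
by apply: ler_wpM2l => //; apply: expR_le_near_half; rewrite -subr_gt0.
Qed.

Lemma tail_bound_variance_large_dev (R : realType) (y F : R) :
  43 / 100 <= y <= 3 / 5 -> 0 <= F -> F * (2 * y * (581 / 500)) <= 1 ->
  F ^+ 3 <= tail_bound y.
Proof.
move=> yb F0; have y13 : 1 / 3 <= y by lra.
have y3 : 0 < 3 / 2 - y by lra.
have k0 : 0 < 581 / 500 :> R by lra.
move: k0 (large_dev_cubic_ge yb); move: (581 / 500 : R) => k k0 c1 FE.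
have Fy : F * y <= 1 / (2 * k).
  rewrite ler_pdivlMr ?mulr_gt0// (_ : F * y * (2 * k) = F * (2 * y * k))//.
  by ring.
apply: (tail_bound_of_cube y13 F0 Fy).
have k3 : 0 < k ^+ 3 by rewrite exprn_gt0.
rewrite -(ler_pM2r y3).
have -> : 3 * (1 / (2 * k)) ^+ 3 * expR y * (3 / 2 - y) =
  3 * (expR y * (3 / 2 - y)) / (8 * k ^+ 3) by field; rewrite gt_eqF.
rewrite ler_pdivrMr ?mulr_gt0//.
have -> : 2 * y ^+ 2 * (3 / 2 - y) * (8 * k ^+ 3) =
  16 * k ^+ 3 * y ^+ 2 * (3 / 2 - y) by ring.
apply: le_trans c1; rewrite ler_wpM2l// expR_le_near_half//.
by rewrite -subr_gt0.
Qed.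

(** Amounts to y^2 e^(-y) >= 3/16. The minorant 217/500 of y e^(-y/2) comes from the
    tangents of e^(-y/2) at y = 1, 3 and 4. *)
Lemma tail_bound_variance (R : realType) (y F : R) :
  3 / 5 <= y <= 9 / 2 -> 0 <= F -> F * (2 * y) <= 1 ->
  F ^+ 3 <= tail_bound y.
Proof.
move=> /andP[y0 y1] F0 FE; have y13 : 1 / 3 <= y by lra.
have y00 : 0 < y by lra.
have Fy : F * y <= 1 / 2 by rewrite ler_pdivlMr; lra.
apply: (tail_bound_of_cube y13 F0 Fy); clear FE Fy F0.
have e0 : 1 / (33 / 20) <= expR (- (1 / 2)) :> R.
  by rewrite expRN div1r lef_pV2 ?posrE ?expR_gt0 ?expR_half_le//; lra.
have en n : (1 / (33 / 20)) ^+ n <= expR (- (n%:R / 2)) :> R.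
  rewrite -mulrN expRM_natl -[X in _ <= expR (- X) ^+ n]mul1r.
  by rewrite lerXn2r ?nnegrE ?expR_ge0//; lra.
have tangent n : (1 / (33 / 20)) ^+ n * (1 - (y - n%:R) / 2) <=
    expR (- (y / 2)) \/ 1 - (y - n%:R) / 2 < 0.
  case: (ltP (1 - (y - n%:R) / 2) 0) => h; [by right|left].
  have -> : - (y / 2) = - (n%:R / 2) + - ((y - n%:R) / 2) by field.
  rewrite expRD; apply: ler_pM; [|exact: h|exact: en|exact: expR_ge1Dx].
  by apply: exprn_ge0; lra.
have ye : 217 / 500 <= y * expR (- (y / 2)).
  clear e0 en.
  have [y2|y2] := leP y (12 / 5).
    have [h|] := tangent 1%N; last by lra.
    rewrite (le_trans _ (ler_wpM2l (ltW y00) h))// expr1.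
    by nra.
  have [y4|y4] := leP y 4.
    have [h|] := tangent 3%N; last by lra.
    rewrite (le_trans _ (ler_wpM2l (ltW y00) h))//.
    by nra.
  have [h|] := tangent 4%N; last by lra.
  rewrite (le_trans _ (ler_wpM2l (ltW y00) h))//.
  by nra.
have sqE : (y * expR (- (y / 2))) ^+ 2 = y ^+ 2 / expR y.
  by rewrite exprMn -expRM_natl -expRN; congr (_ * expR _); field.
have h : 3 / 16 <= y ^+ 2 / expR y by rewrite -sqE expr2; nra.
have {h} : 3 / 16 * expR y <= y ^+ 2 by rewrite -ler_pdivlMr// expR_gt0.
by have := expR_ge0 y; lra.
Qed.

(** Here y e^(-y/2) is at most its value at 9/2. *)
Lemma tail_bound_large (R : realType) (y F : R) :
  9 / 2 <= y -> 0 <= F -> F <= expR (- (y / 2)) + expR (- y) ->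
  F ^+ 3 <= tail_bound y.
Proof.
move=> y0 F0 FE; have y00 : 0 < y by lra.
set E := expR (- (y / 2)) in FE.
have E0 : 0 < E by exact: expR_gt0.
have EE : expR (- y) = E ^+ 2 by rewrite -expRM_natl; congr expR; field.
have e225 : expR (- (9 / 4)) <= 27 / 250 :> R.
  have e2 : (41 / 25) ^+ 4 <= expR 2 :> R.
    have -> : 2 = 4%:R * (1 / 2) :> R by field.
    rewrite expRM_natl; apply: lerXn2r; rewrite ?nnegrE ?expR_ge0//.
    by apply: le_trans (expR_ge_taylor3 _); lra.
  have e3 : 32 / 25 <= expR (1 / 4) :> R.
    by apply: le_trans (expR_ge_taylor3 _); lra.
  rewrite expRN (_ : 9 / 4 = 2 + 1 / 4 :> R); last by field.
  rewrite expRD -[leLHS]mul1r ler_pdivrMr ?mulr_gt0 ?expR_gt0//.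
  have : (41 / 25) ^+ 4 * (32 / 25) <= expR 2 * expR (1 / 4) :> R.
    by rewrite ler_pM//; lra.
  by lra.
have yE : y * E <= 9 / 2 * (27 / 250).
  have -> : E = expR (- (9 / 4)) / expR ((y - 9 / 2) / 2).
    by rewrite -expRB; congr expR; field.
  rewrite mulrA ler_pdivrMr ?expR_gt0//.
  have : 1 + (y - 9 / 2) / 2 <= expR ((y - 9 / 2) / 2) by exact: expR_ge1Dx.
  have : y * expR (- (9 / 4)) <= y * (27 / 250) by rewrite ler_pM2l.
  by lra.
have E1 : E <= 27 / 250 by nra.
have Fy : 3 * y * F ^+ 3 * expR y <= 2.
  have -> : expR y = E ^- 2 by rewrite -EE expRN invrK.
  rewrite ler_pdivrMr ?exprn_gt0//.
  have F3 : F ^+ 3 <= (E * (1 + E)) ^+ 3.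
    rewrite lerXn2r ?nnegrE ?mulr_ge0 ?addr_ge0 ?(ltW E0)//.
    by rewrite EE in FE; lra.
  apply: (@le_trans _ _ (3 * y * (E * (1 + E)) ^+ 3)).
    by rewrite ler_wpM2l// mulr_ge0// ltW.
  have -> : 3 * y * (E * (1 + E)) ^+ 3 = (3 * (y * E) * (1 + E) ^+ 3) * E ^+ 2.
    by ring.
  rewrite ler_wpM2r ?sqr_ge0//.
  apply: (@le_trans _ _ (3 * (9 / 2 * (27 / 250)) * (1 + 27 / 250) ^+ 3)).
    apply: ler_pM.
    - by rewrite mulr_ge0 ?mulr_ge0 ?(ltW y00) ?(ltW E0).
    - by rewrite exprn_ge0// addr_ge0// ltW.
    - by rewrite ler_pM2l.
    - by apply: lerXn2r; rewrite ?nnegrE ?addr_ge0 ?(ltW E0)//; lra.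
  by lra.
apply: le_tail_bound; rewrite ?exprn_ge0//.
have : 0 <= F ^+ 3 * expR y by rewrite mulr_ge0 ?expR_ge0// exprn_ge0.
by nra.
Qed.

(** * Chernoff's inequality and a fourth moment tail bound *)

Section deviation.
Context (R : realType) (dO : measure_display) (Omega : measurableType dO)
  (P : probability Omega R).
Implicit Types (Z f : Omega -> R).

Local Notation "''E' f" := (\int[P]_w f w)%R (at level 10, f at level 9).

Lemma prob_le_expect (A : set Omega) f : measurable A ->
  P.-integrable setT (EFin \o f) -> (forall w, 0 <= f w) ->
  (forall w, A w -> 1 <= f w) -> fine (P A) <= 'E f.
Proof.
move=> mA fi f0 f1.
have -> : fine (P A) = 'E \1_A.
  by rewrite /Rintegral integral_indic// setIT.
apply: le_Rintegral => //.
  by apply: integrable_indic => //; exact: fin_num_measure.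
move=> w _; rewrite indicE; case: (boolP (w \in A)) => //= wA.
by apply: f1; rewrite inE in wA.
Qed.

Lemma chernoff_expmoment Z (A : set Omega) (t r c : R) : measurable_fun setT Z ->
  measurable A -> (forall w, A w -> t * r <= t * Z w) ->
  (expmoment P Z t <= (expR c)%:E)%E -> fine (P A) <= expR (c - t * r).
Proof.
move=> mZ mA Ar Mc.
have fin : (expmoment P Z t < +oo)%E by rewrite (le_lt_trans Mc)// ltry.
have int := integrable_scale (expR (- (t * r))) (integrable_expmoment mZ fin).
have : fine (P A) <= 'E (fun w => expR (- (t * r)) * expR (t * Z w)).
  apply: prob_le_expect => // w.
  by move=> /Ar Aw; rewrite -expRD -[leLHS]expR0 ler_expR; lra.
move=> /le_trans; apply; rewrite RintegralZl//; last exact: integrable_expmoment.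
rewrite expRD [leRHS]mulrC ler_wpM2l ?expR_ge0//.
by rewrite -lee_fin -expmomentE.
Qed.

(** The factor (W - t0) is negative only for W < t0, where the product of the three
    factors is at least its value at W = 0. *)
Lemma test_polynomial_ge0 (t0 w0 g W : R) : 0 < t0 -> t0 <= w0 -> t0 <= g ->
  0 <= W -> 0 <= t0 * w0 ^+ 2 * g + (W - t0) * (W - w0) ^+ 2 * (W + g).
Proof.
move=> t00 tw tg W0.
have t0' := ltW t00; have g0 : 0 <= g by exact: le_trans tg.
have [Wt|Wt] := leP t0 W.
  apply: addr_ge0; apply: mulr_ge0 => //; first by rewrite mulr_ge0 ?sqr_ge0.
    by rewrite mulr_ge0 ?sqr_ge0 ?subr_ge0.
  exact: addr_ge0.
have h1 : 0 <= (t0 - W) * (W + g) <= t0 * g by apply/andP; split; nra.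
have h2 : 0 <= (W - w0) ^+ 2 <= w0 ^+ 2 by apply/andP; split; nra.
have -> : t0 * w0 ^+ 2 * g + (W - t0) * (W - w0) ^+ 2 * (W + g) =
  t0 * g * w0 ^+ 2 - (t0 - W) * (W + g) * (W - w0) ^+ 2 by ring.
by rewrite subr_ge0 ler_pM//; [case/andP: h1|case/andP: h2|case/andP: h1|case/andP: h2].
Qed.

(** With W = Z^2 / S, the polynomial
    1 + (W - t0) (W - w0)^2 (W + g) / (t0 w0^2 g) is nonnegative and at least 1 where
    W >= t0, so its mean bounds the probability. The value of g makes the ratio of
    its coefficients of W^3 and W^4 that of cosh (l Z), which allows to dominate
    both by K (cosh (l Z) - its lower order terms). What is left has a positive
    coefficient B at W and a negative one at W^2, where E W^2 >= 3 (E W)^2 is used: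
    the resulting bound is concave in E W, with slope at least e at E W = 1, so that
    E W <= th improves it by e (1 - th). *)
Lemma fourth_moment_tail Z (S th l u w0 t0 H b e : R) :
  measurable_fun setT Z -> 0 < S -> 0 <= th <= 1 -> 0 < u ->
  l ^+ 2 * S = u ^+ 2 -> 0 < t0 -> t0 <= w0 ->
  let g := 56 / u ^+ 2 + 2 * w0 + t0 in
  let K := 56 * 720 / u ^+ 8 in
  let B := (g - t0) * w0 ^+ 2 + 2 * w0 * t0 * g - 28 * 720 / u ^+ 6 in
  let C := 2 * w0 * (g - t0) + t0 * g - w0 ^+ 2 + 28 * 60 / u ^+ 4 in
  let V := t0 * w0 ^+ 2 * g in
  0 <= e -> 0 <= C -> K * (H - 1) + B - 3 * C <= b * V -> e * V <= B - 6 * C ->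
  (expmoment P Z l < +oo)%E -> (expmoment P Z (- l) < +oo)%E -> 0 < l ->
  'E (fun w => cosh (l * Z w)) <= H ->
  'E (fun w => Z w ^+ 2) <= S * th ->
  3 * 'E (fun w => Z w ^+ 2) ^+ 2 <= 'E (fun w => Z w ^+ 4) ->
  forall A, measurable A -> (forall w, A w -> t0 * S <= Z w ^+ 2) ->
  fine (P A) <= b - e * (1 - th).
Proof.
move=> mZ S0 /andP[th0 th1] u0 lS t00 tw g K B C V e0 C0 bV eV fin1 fin2 l0 EH EZ2 EZ4.
move=> A mA AS.
have g0 : 0 < g by rewrite /g !addr_gt0// ?divr_gt0 ?exprn_gt0// mulr_gt0//; lra.
have tg : t0 <= g.
  rewrite /g lerDr addr_ge0 ?divr_ge0 ?exprn_ge0 ?(ltW u0)// mulr_ge0//; lra.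
have V0 : 0 < V by rewrite /V !mulr_gt0 ?exprn_gt0//; lra.
have Vn : V != 0 by rewrite gt_eqF.
have K0 : 0 < K.
  have n0 : 0 < 56 * 720 :> R by lra.
  exact: divr_gt0 n0 (exprn_gt0 8 u0).
have iZ k := integrable_moment k mZ l0 fin1 fin2.
have ic := integrable_cosh mZ fin1 fin2.
have i1 (c : R) : P.-integrable setT (EFin \o (fun=> c)).
  exact: finite_measure_integrable_cst.
have E1 (c : R) : 'E (fun=> c) = c.
  rewrite Rintegral_cst// (_ : fine _ = 1) ?mulr1//.
  exact: (congr1 fine (@probability_setT _ _ _ P)).
(* The mean of f only involves E Z^2, E Z^4 and E cosh (l Z). *)
pose f w := - K / V + B / (S * V) * Z w ^+ 2 +
  - (C / (S ^+ 2 * V)) * Z w ^+ 4 + K / V * cosh (l * Z w).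
have j2 := integrable_add (i1 (- K / V)) (integrable_scale (B / (S * V)) (iZ 2%N)).
have j4 := integrable_add j2 (integrable_scale (- (C / (S ^+ 2 * V))) (iZ 4%N)).
have j6 := integrable_add j4 (integrable_scale (K / V) ic).
have f8 : (8`!)%:R = 56 * 720 :> R by rewrite !factS fact0 !natrM; ring.
have f6 : (6`!)%:R = 720 :> R by rewrite !factS fact0 !natrM; ring.
have fE w : 1 + (Z w ^+ 2 / S - t0) * (Z w ^+ 2 / S - w0) ^+ 2 *
    (Z w ^+ 2 / S + g) / V <= f w.
  have := cosh_taylor_le 5 (l * Z w).
  set x := Z w ^+ 2 / S.
  have -> : cosh_taylor 5 (l * Z w) = 1 + u ^+ 2 / 2 * x +
      u ^+ 4 / 24 * x ^+ 2 + u ^+ 6 / 720 * x ^+ 3 + u ^+ 8 / (56 * 720) * x ^+ 4.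
    have lz : (l * Z w) ^+ 2 = u ^+ 2 * x.
      by rewrite -lS /x; field; rewrite gt_eqF.
    have ev k : (l * Z w) ^+ k.*2 = u ^+ k.*2 * x ^+ k.
      by rewrite -mul2n exprM lz exprMn -exprM.
    rewrite /cosh_taylor !big_nat_recr//= big_geq// add0r !ev f8 f6.
    rewrite (_ : (0.*2)`! = 1)%N// (_ : (1.*2)`! = 2)%N// (_ : (2.*2)`! = 24)%N//.
    by rewrite !expr0 !divr1 mulr1 expr1 ![_ * _ / _]mulrAC.
  have -> : f w = (- K + B * x - C * x ^+ 2 + K * cosh (l * Z w)) / V.
    by rewrite /f /x; field; rewrite !gt_eqF.
  move=> /(ler_wpM2l (ltW K0)) KT.
  rewrite -[1](divff Vn) -mulrDl ler_pM2r ?invr_gt0//.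
  have := KT; have un0 : u != 0 by rewrite gt_eqF.
  have -> : K * (1 + u ^+ 2 / 2 * x + u ^+ 4 / 24 * x ^+ 2 + u ^+ 6 / 720 * x ^+ 3 +
      u ^+ 8 / (56 * 720) * x ^+ 4) = K + 28 * 720 / u ^+ 6 * x + 28 * 60 / u ^+ 4 * x ^+ 2 +
      56 / u ^+ 2 * x ^+ 3 + x ^+ 4.
    by rewrite /K; field.
  have -> : 56 / u ^+ 2 = g - 2 * w0 - t0 by rewrite /g; ring.
  rewrite /B /C /V; move: (28 * 720 / u ^+ 6) (28 * 60 / u ^+ 4) => k1 k2.
  clearbody K g; lra.
set m2 := 'E (fun w => Z w ^+ 2) in EZ2 EZ4.
have m20 : 0 <= m2 by apply: Rintegral_ge0 => w _; rewrite sqr_ge0.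
set m4 := 'E (fun w => Z w ^+ 4) in EZ4.
set Ec := 'E (fun w => cosh (l * Z w)) in EH.
have : fine (P A) <= 'E f.
  apply: prob_le_expect => // w.
    apply: le_trans (fE w); rewrite -[1](divff Vn) -mulrDl.
    by rewrite divr_ge0 ?(ltW V0)// test_polynomial_ge0// divr_ge0 ?sqr_ge0// ltW.
  move=> /AS; rewrite -ler_pdivlMr// => xt; apply: le_trans (fE w).
  rewrite lerDl; apply: divr_ge0; last exact: ltW.
  apply: mulr_ge0; first by rewrite mulr_ge0 ?sqr_ge0 ?subr_ge0.
  by apply: addr_ge0; [exact: (le_trans (ltW t00) xt)|exact: ltW].
move=> /le_trans; apply.
have -> : 'E f = - K / V + B / (S * V) * m2 - C / (S ^+ 2 * V) * m4 + K / V * Ec.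
  rewrite /f RintegralD// ?RintegralD//; try by apply: integrable_scale.
  by rewrite E1 !RintegralZl// !mulNr.
pose m := m2 / S.
have m0 : 0 <= m by rewrite divr_ge0// ltW.
have mth : m <= th by rewrite ler_pdivrMr// mulrC.
have mm : 3 * m ^+ 2 <= m4 / S ^+ 2.
  by rewrite ler_pdivlMr ?exprn_gt0// /m exprMn exprVn -mulrA divfK// expf_neq0// gt_eqF.
have -> : - K / V + B / (S * V) * m2 - C / (S ^+ 2 * V) * m4 + K / V * Ec =
    (- K + B * m - C * (m4 / S ^+ 2) + K * Ec) / V.
  by rewrite /m; field; rewrite !gt_eqF.
rewrite ler_pdivrMr//.
have := ler_wpM2l C0 mm; have := ler_wpM2l (ltW K0) EH.
move: (m4 / S ^+ 2) => m4'; clearbody m K B C V; move=> {f fE j2 j4 j6} L1 L2.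
have th1' : 0 <= 1 - th by rewrite subr_ge0.
have eth := ler_wpM2l th1' eV.
have C1 : 0 <= C * (1 - th) ^+ 2 by rewrite mulr_ge0 ?sqr_ge0.
have h2 : 0 <= (th - m) * (B - 3 * C * (th + m)).
  rewrite mulr_ge0 ?subr_ge0//.
  have : 0 <= C * (1 - m) by rewrite mulr_ge0// subr_ge0 (le_trans mth).
  have : 0 <= C * (1 - th) by rewrite mulr_ge0.
  have : 0 <= e * V by rewrite mulr_ge0// ltW.
  clear -eV; lra.
clear -L1 L2 h2 eth C1 bV; lra.
Qed.
End deviation.

(** * Deviation inequality for sub-gamma variables *)

Section gap.
Context (R : realType) (dO : measure_display) (Omega : measurableType dO)
  (P : probability Omega R).
Implicit Types (Z f : Omega -> R).

Local Notation "''E' f" := (\int[P]_w f w)%R (at level 10, f at level 9).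

(** The properties of a centred time average that the tail bound needs: sub-gamma
    above (the parameter p trades the range of t against the constant), sub-Gaussian
    below, and a fourth moment not smaller than that of a Gaussian with the same
    variance. *)
Definition subgamma_below_above Z (kappa T D : R) : Prop :=
  [/\ measurable_fun setT Z,
    forall p t : R, 0 <= p < 1 -> 0 <= t <= kappa ^+ 2 * T * p * (2 - p) / 2 ->
      (expmoment P Z t <=
       (expR (2 * t ^+ 2 * (D / (2 * kappa ^+ 2 * T)) / (2 - p) ^+ 2))%:E)%E,
    forall t : R, 0 <= t ->
      (expmoment P Z (- t) <=
       (expR (t ^+ 2 * (D / (2 * kappa ^+ 2 * T) / 2)))%:E)%E,
    'E (fun w => Z w ^+ 2) <= D / (2 * kappa ^+ 2 * T) &
    3 * 'E (fun w => Z w ^+ 2) ^+ 2 <= 'E (fun w => Z w ^+ 4)].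

(** fourth_moment_tail at the scale S = sigma2 y / y0, chosen so that |Z| >= r means
    Z^2 / S >= 2 y0 (1 + r / D), which is at least t0. All hypotheses on the free
    parameters are numerical; they are met by rational values for r / D in a small
    interval [rho1, rho2]. *)
Lemma gap_cell Z (kappa T D r y : R) (A : set Omega)
    (y0 b e rho1 rho2 u w0 p h1 h2 : R) :
  0 < kappa -> 0 < T -> 0 < D -> 0 < r -> subgamma_below_above Z kappa T D ->
  measurable A -> (forall w, A w -> r <= `|Z w|) ->
  y = kappa ^+ 2 * r ^+ 2 * T / (r + D) -> 0 < y0 <= y ->
  rho1 * D <= r <= rho2 * D -> 0 <= rho1 -> 0 < u -> 0 < p < 1 -> 0 <= e ->
  8 * u ^+ 2 * rho2 ^+ 2 <= y0 * (1 + rho2) * (p * (2 - p)) ^+ 2 ->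
  expR (2 * u ^+ 2 / (2 - p) ^+ 2) <= h1 -> expR (u ^+ 2 / 2) <= h2 ->
  let t0 := 2 * y0 * (1 + rho1) in
  let g := 56 / u ^+ 2 + 2 * w0 + t0 in
  let K := 56 * 720 / u ^+ 8 in
  let B := (g - t0) * w0 ^+ 2 + 2 * w0 * t0 * g - 28 * 720 / u ^+ 6 in
  let C := 2 * w0 * (g - t0) + t0 * g - w0 ^+ 2 + 28 * 60 / u ^+ 4 in
  let V := t0 * w0 ^+ 2 * g in
  t0 <= w0 -> 0 <= C -> K * ((h1 + h2) / 2 - 1) + B - 3 * C <= b * V ->
  e * V <= B - 6 * C ->
  fine (P A) <= b - e * (1 - y0 / y).
Proof.
move=> k0 T0 D0 r0 [mZ Hup Hneg EZ2 EZ4] mA Ar yE /andP[y00 y0y] /andP[r1 r2]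
  rho10 u0 /andP[p0 p1] e0 Nu H1 H2 t0 g K B C V tw C0 bV eV.
set s2 := D / (2 * kappa ^+ 2 * T) in Hup Hneg EZ2.
have s20 : 0 < s2 by rewrite divr_gt0// !mulr_gt0// exprn_gt0.
have y_gt0 : 0 < y by exact: lt_le_trans y0y.
pose S := s2 * (y / y0); have S0 : 0 < S by rewrite mulr_gt0// divr_gt0.
pose l := u / Num.sqrt S.
have sS0 : 0 < Num.sqrt S by rewrite sqrtr_gt0.
have l0 : 0 < l by rewrite divr_gt0.
have lS : l ^+ 2 * S = u ^+ 2.
  by rewrite /l expr_div_n sqr_sqrtr ?(ltW S0)// divfK// gt_eqF.
have rE : r ^+ 2 * y0 = 2 * y0 * (1 + r / D) * (S * y0).
  rewrite /S /s2 yE; field; rewrite !gt_eqF//=; exact: addr_gt0.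
have th01 : 0 <= y0 / y <= 1.
  by rewrite divr_ge0 ?(ltW y00) ?(ltW y_gt0)//= ler_pdivrMr// mul1r.
have l2 : l ^+ 2 * s2 = u ^+ 2 * (y0 / y).
  by rewrite -lS /S; field; rewrite !gt_eqF.
have l2u : l ^+ 2 * s2 <= u ^+ 2.
  by rewrite l2 ler_piMr ?sqr_ge0//; case/andP: th01.
have rho20 : 0 < rho2.
  by rewrite -(pmulr_lgt0 _ D0); exact: lt_le_trans r2.
have q0 : 0 < p * (2 - p) by rewrite mulr_gt0//; lra.
have lp : 0 <= l <= kappa ^+ 2 * T * p * (2 - p) / 2.
  rewrite (ltW l0)/=.
  have rhs0 : 0 <= kappa ^+ 2 * T * p * (2 - p) / 2.
    have p2 : 0 <= 2 - p by lra.
    have kT : 0 <= kappa ^+ 2 * T by rewrite mulr_ge0 ?sqr_ge0 ?(ltW T0).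
    exact: divr_ge0 (mulr_ge0 (mulr_ge0 kT (ltW p0)) p2) (ler0n R 2).
  rewrite -(@ler_pXn2r _ 2)// ?nnegrE ?(ltW l0)//.
  rewrite -(ler_pM2r S0) lS.
  have SE : (kappa ^+ 2 * T * p * (2 - p) / 2) ^+ 2 * S =
      kappa ^+ 2 * T * D * y / (8 * y0) * (p * (2 - p)) ^+ 2.
    by rewrite /S /s2; field; rewrite !gt_eqF.
  rewrite SE; set N := kappa ^+ 2 * T * D; set q := (p * (2 - p)) ^+ 2 in Nu *.
  have q20 : 0 < q by rewrite exprn_gt0.
  have NE : N * r ^+ 2 = y * (D + r) * D.
    by rewrite /N yE; field; rewrite gt_eqF// addr_gt0.
  have N0 : 0 < N by rewrite !mulr_gt0// exprn_gt0.
  rewrite [leRHS]mulrAC ler_pdivlMr; last by rewrite mulr_gt0//; lra.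
  have r22 : 0 < r ^+ 2 * rho2 ^+ 2 by rewrite mulr_gt0 ?exprn_gt0.
  rewrite -(ler_pM2r r22).
  have -> : N * y * q * (r ^+ 2 * rho2 ^+ 2) =
     q * y * rho2 ^+ 2 * (N * r ^+ 2) by ring.
  rewrite NE.
  apply: (@le_trans _ _ (y0 * (y0 * (1 + rho2) * q) * r ^+ 2)).
    rewrite [leLHS](_ : _ = y0 * (8 * u ^+ 2 * rho2 ^+ 2) * r ^+ 2); last by ring.
    by rewrite ler_pM2r ?exprn_gt0// ler_pM2l.
  have rD : (1 + rho2) * r ^+ 2 <= (D + r) * D * rho2 ^+ 2.
    have : r ^+ 2 <= (rho2 * D) ^+ 2.
      by rewrite ler_pXn2r ?nnegrE ?(ltW r0)// (le_trans (ltW r0)).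
    have : 0 <= r * rho2 * (rho2 * D - r) by rewrite mulr_ge0 ?subr_ge0// ltW// mulr_gt0.
    clear; lra.
  rewrite [leLHS](_ : _ = (y0 ^+ 2 * q) * ((1 + rho2) * r ^+ 2)); last by ring.
  rewrite [leRHS](_ : _ = (y ^+ 2 * q) * ((D + r) * D * rho2 ^+ 2)); last by ring.
  apply: ler_pM => //.
  - by rewrite mulr_ge0 ?sqr_ge0 ?(ltW q20).
  - by rewrite mulr_ge0 ?sqr_ge0// addr_ge0// ltW.
  - by rewrite ler_pM2r// ler_pXn2r ?nnegrE ?(ltW y00) ?(ltW y_gt0).
have fin1 : (expmoment P Z l < +oo)%E.
  by rewrite (le_lt_trans (Hup p l _ lp)) ?ltry// (ltW p0) p1.
have fin2 : (expmoment P Z (- l) < +oo)%E.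
  by rewrite (le_lt_trans (Hneg l (ltW l0))) ?ltry.
have p2 : 0 < 2 - p by lra.
have Ecosh : 'E (fun w => cosh (l * Z w)) <= (h1 + h2) / 2.
  rewrite Rintegral_cosh// ler_pM2r ?invr_gt0// lerD//.
    rewrite -lee_fin -expmomentE//; apply: le_trans (Hup p l _ lp) _.
      by rewrite (ltW p0) p1.
    rewrite lee_fin; apply: le_trans H1; rewrite ler_expR ler_pM2r ?invr_gt0 ?exprn_gt0//.
    by rewrite -mulrA ler_pM2l.
  rewrite -lee_fin -expmomentE//; apply: le_trans (Hneg l (ltW l0)) _.
  rewrite lee_fin; apply: le_trans H2; rewrite ler_expR mulrA.
  by rewrite ler_pM2r ?invr_gt0.
apply: (@fourth_moment_tail R dO Omega P Z S (y0 / y) l u w0 t0 ((h1 + h2) / 2)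
  b e) => //.
- by rewrite /t0 mulr_gt0 ?mulr_gt0 ?ltr_wpDr.
- by rewrite /S (_ : _ * _ = s2)//; field; rewrite !gt_eqF.
- move=> w /Ar rZ; apply: (@le_trans _ _ (r ^+ 2)); last first.
    by rewrite -[leRHS]real_normK ?num_real// ler_pXn2r ?nnegrE ?(ltW r0).
  rewrite -(ler_pM2r y00) rE -[leLHS]mulrA (ler_pM2r (mulr_gt0 S0 y00)).
  by rewrite /t0 ler_pM2l ?mulr_gt0// lerD2l ler_pdivlMr.
Qed.
End gap.

Section deviation_inequality.
Context (R : realType) (dO : measure_display) (Omega : measurableType dO)
  (P : probability Omega R).
Implicit Types (Z f : Omega -> R).

Local Notation "''E' f" := (\int[P]_w f w)%R (at level 10, f at level 9).

Lemma subgamma_moment2 Z kappa T D : 0 < kappa -> 0 < T -> 0 < D ->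
  subgamma_below_above P Z kappa T D ->
  P.-integrable setT (EFin \o (fun w => Z w ^+ 2)).
Proof.
move=> k0 T0 D0 [mZ Hup Hneg _ _].
pose t := kappa ^+ 2 * T * (1 / 2) * (2 - 1 / 2) / 2.
have t0 : 0 < t by rewrite /t !mulr_gt0 ?exprn_gt0//; lra.
apply: (@integrable_moment _ _ _ P Z t) => //.
  apply: le_lt_trans (Hup (1 / 2) t _ _) _; rewrite ?ltry//; first lra.
  by rewrite (ltW t0) /t lexx.
by apply: le_lt_trans (Hneg t (ltW t0)) _; rewrite ltry.
Qed.

Lemma chebyshev_subgamma Z (kappa T D r : R) (A : set Omega) :
  0 < kappa -> 0 < T -> 0 < D -> 0 < r -> subgamma_below_above P Z kappa T D ->
  measurable A -> (forall w, A w -> r <= `|Z w|) ->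
  fine (P A) * r ^+ 2 <= D / (2 * kappa ^+ 2 * T).
Proof.
move=> k0 T0 D0 r0 HZ mA Ar; have i2 := subgamma_moment2 k0 T0 D0 HZ.
case: HZ => [mZ _ _ EZ2 _]; apply: le_trans EZ2.
have r2 : 0 < r ^+ 2 by rewrite exprn_gt0.
have iZ := integrable_scale (r ^+ 2)^-1 i2.
have : fine (P A) <= 'E (fun w => (r ^+ 2)^-1 * Z w ^+ 2).
  apply: prob_le_expect => // w.
    by rewrite mulr_ge0 ?invr_ge0 ?sqr_ge0.
  move=> /Ar rZ; rewrite mulrC ler_pdivlMr// mul1r.
  by rewrite -[leRHS]real_normK ?num_real// ler_pXn2r ?nnegrE ?(ltW r0).
by rewrite RintegralZl// mulrC ler_pdivlMr.
Qed.

(** The exponents are t = kappa^2 T p (2 - p) / 2 with p = 2r / (2r + D), which keeps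
    p < 1, for the upper tail and the optimal t = r / sigma2 for the lower one. *)
Lemma chernoff_subgamma Z (kappa T D r : R) (A : set Omega) :
  0 < kappa -> 0 < T -> 0 < D -> 0 < r -> subgamma_below_above P Z kappa T D ->
  measurable A -> (forall w, A w -> r <= `|Z w|) ->
  fine (P A) <= expR (- (kappa ^+ 2 * r ^+ 2 * T / (r + D) / 2)) +
    expR (- (kappa ^+ 2 * r ^+ 2 * T / (r + D))).
Proof.
move=> k0 T0 D0 r0 [mZ Hup Hneg _ _] mA Ar.
have rD : 0 < r + D by rewrite addr_gt0.
have rD2 : 0 < 2 * r + D by rewrite addr_gt0// mulr_gt0.
have Kp : 0 < kappa ^+ 2 * r ^+ 2 * T by rewrite !mulr_gt0 ?exprn_gt0.
have mp : measurable (A `&` [set w | r <= Z w]).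
  apply: measurableI => //; rewrite -[X in measurable X]setTI.
  exact: (measurable_fun_le measurableT (measurable_cst r) mZ).
have mm : measurable (A `&` [set w | Z w <= - r]).
  apply: measurableI => //; rewrite -[X in measurable X]setTI.
  exact: (measurable_fun_le measurableT mZ (measurable_cst (- r))).
set Ap := A `&` _ in mp; set Am := A `&` _ in mm.
have PA : fine (P A) <= fine (P Ap) + fine (P Am).
  have PA' : (P A <= P Ap + P Am)%E.
    apply: (@le_trans _ _ (P (Ap `|` Am))); last exact: measureU2.
    apply: le_measure; rewrite ?inE//; first exact: measurableU.
    move=> w Aw; have := Ar w Aw; rewrite ler_normr => /orP[?|?]; [left|right] => //.
    by split => //=; rewrite lerNr.
  rewrite -fineD ?fin_num_measure//; apply: fine_le => //.
    exact: fin_num_measure.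
  by rewrite fin_numD !fin_num_measure.
apply: (le_trans PA); apply: lerD.
- pose p := 2 * r / (2 * r + D); pose t := kappa ^+ 2 * T * p * (2 - p) / 2.
  have pb : 0 <= p < 1.
    rewrite /p divr_ge0 ?(ltW rD2) ?mulr_ge0 ?(ltW r0)//= ltr_pdivrMr//; lra.
  have t0 : 0 <= t.
    case/andP: pb => p0 p1.
    have p2 : 0 <= 2 - p by lra.
    have kT : 0 <= kappa ^+ 2 * T by rewrite mulr_ge0 ?sqr_ge0 ?ltW.
    exact: divr_ge0 (mulr_ge0 (mulr_ge0 kT p0) p2) _.
  have := Hup p t pb; rewrite t0 lexx => /(_ isT) U.
  have Ar' : forall w, Ap w -> t * r <= t * Z w.
    by move=> w [_ /= rZ]; rewrite ler_wpM2l.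
  apply: le_trans (chernoff_expmoment mZ mp Ar' U) _.
  rewrite ler_expR.
  rewrite [leLHS](_ : _ = - (kappa ^+ 2 * r ^+ 2 * T / (2 * r + D))); last first.
    rewrite /t /p; field; rewrite !gt_eqF//=; lra.
  rewrite lerN2 -[leLHS]mulrA (ler_pM2l Kp) -invfM lef_pV2 ?posrE ?mulr_gt0//; lra.
- pose t := 2 * kappa ^+ 2 * T * r / D.
  have t0 : 0 < t by rewrite /t divr_gt0// !mulr_gt0// exprn_gt0.
  have Ar' : forall w, Am w -> - t * (- r) <= - t * Z w.
    by move=> w [_ /= rZ]; rewrite !mulNr lerN2 ler_pM2l.
  apply: le_trans (chernoff_expmoment mZ mm Ar' (Hneg t (ltW t0))) _.
  rewrite ler_expR.
  rewrite [leLHS](_ : _ = - (kappa ^+ 2 * r ^+ 2 * T / D)); last first.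
    by rewrite /t; field; rewrite !gt_eqF.
  rewrite lerN2 ler_pM2l// lef_pV2 ?posrE//; lra.
Qed.

Lemma deviation_bound Z (kappa T D r : R) (A : set Omega) :
  0 < kappa -> 0 < T -> 0 < D -> 0 < r -> subgamma_below_above P Z kappa T D ->
  measurable A -> (forall w, A w -> r <= `|Z w|) ->
  fine (P A) ^+ 3 <= tail_bound (kappa ^+ 2 * r ^+ 2 * T / (r + D)).
Proof.
move=> k0 T0 D0 r0 HZ mA Ar.
have F0 : 0 <= fine (P A) by exact: fine_ge0.
have cheb := chebyshev_subgamma k0 T0 D0 r0 HZ mA Ar.
have cher := chernoff_subgamma k0 T0 D0 r0 HZ mA Ar.
have cell := gap_cell k0 T0 D0 r0 HZ mA Ar (erefl _).
set y := kappa ^+ 2 * r ^+ 2 * T / (r + D) in cher cell *.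
have rD : 0 < r + D by rewrite addr_gt0.
have y0 : 0 < y by rewrite divr_gt0// !mulr_gt0 ?exprn_gt0.
have yc : fine (P A) * (2 * y * (r + D)) <= D.
  have N0 : 0 < 2 * kappa ^+ 2 * T by rewrite !mulr_gt0 ?exprn_gt0.
  move: cheb; rewrite ler_pdivlMr//; apply: le_trans.
  by rewrite le_eqVlt; apply/orP; left; apply/eqP; rewrite /y; field; rewrite gt_eqF.
clearbody y.
have [y1|y1] := leP y (43 / 100).
  apply: tail_bound_small; first by rewrite y0.
  rewrite F0 -lee_fin fineK ?fin_num_measure//; exact: probability_le1.
have [y2|y2] := leP (9 / 2) y; first exact: tail_bound_large.
have [y3|y3] := leP (3 / 5) y.
  apply: tail_bound_variance => //; first by rewrite y3 (ltW y2).
  rewrite -(ler_pM2r D0) mul1r; apply: le_trans yc.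
  by rewrite -[leLHS]mulrA ler_wpM2l// ler_pM2l ?mulr_gt0// lerDr ltW.
have yb : 43 / 100 <= y <= 3 / 5 by rewrite (ltW y1) (ltW y3).
have [r1|r1] := leP (81 / 500 * D) r.
  apply: (tail_bound_variance_large_dev yb F0).
  rewrite -(ler_pM2r D0) mul1r; apply: le_trans yc.
  rewrite -[leLHS]mulrA ler_wpM2l// -[leLHS]mulrA ler_pM2l ?mulr_gt0//.
  clear -r1; lra.
apply: tail_bound_gap => //.
have y0b : 0 < (43 / 100 : R) <= y by apply/andP; split; lra.
clear -cell y0b r1 r0 D0.
(* Five ranges of r / D. For each of them u is the scale of the cosh, then comes
   the double root w0 of the test polynomial, the parameter p allowed by r / D,
   and rational upper bounds for the two exponentials. *)
have [r2|r2] := leP (3 / 25 * D) r.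
  apply: (cell (43 / 100) (999 / 1000) (14 / 25) (3 / 25) (81 / 500) (6 / 5) 49
    (53 / 100) (19 / 5) (21 / 10)).
  all: try (by move=> *; lra).
  - by apply: (@expR_le_pow R 14 (1 / 11)); [lra|rewrite ler_pdivrMr; lra|lra].
  - by apply: (@expR_le_pow R 4 (1 / 6)); lra.
have [r3|r3] := leP (9 / 100 * D) r.
  apply: (cell (43 / 100) (999 / 1000) (14 / 25) (9 / 100) (3 / 25) (7 / 5) 31
    (11 / 25) (51 / 10) (27 / 10)).
  all: try (move=> *; lra).
  - by apply: (@expR_le_pow R 5 (5 / 18)); [lra|rewrite ler_pdivrMr; lra|lra].
  - by apply: (@expR_le_pow R 4 (7 / 32)); lra.
have [r4|r4] := leP (1 / 20 * D) r.
  apply: (cell (43 / 100) (999 / 1000) (14 / 25) (1 / 20) (9 / 100) (8 / 5) 22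
    (37 / 100) (69 / 10) (18 / 5)).
  all: try (move=> *; lra).
  - by apply: (@expR_le_pow R 13 (4 / 29)); [lra|rewrite ler_pdivrMr; lra|lra].
  - by apply: (@expR_le_pow R 16 (1 / 13)); lra.
have [r5|r5] := leP (1 / 100 * D) r.
  apply: (cell (43 / 100) (999 / 1000) (14 / 25) (1 / 100) (1 / 20) (8 / 5) 21
    (19 / 100) (24 / 5) (18 / 5)).
  all: try (move=> *; lra).
  - by apply: (@expR_le_pow R 18 (1 / 12)); [lra|rewrite ler_pdivrMr; lra|lra].
  - by apply: (@expR_le_pow R 16 (1 / 13)); lra.
apply: (cell (43 / 100) (999 / 1000) (14 / 25) (0) (1 / 100) (8 / 5) 21
  (1 / 25) (19 / 5) (18 / 5)).
all: try (move=> *; lra).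
- by apply: (@expR_le_pow R 14 (1 / 11)); [lra|rewrite ler_pdivrMr; lra|lra].
- by apply: (@expR_le_pow R 16 (1 / 13)); lra.
Qed.
End deviation_inequality.

(** * A Gaussian integral *)

(** The density is a Radon-Nikodym derivative of the law, and nonnegative functions
    integrate against it without any integrability condition. *)
Lemma ge0_integral_normal_prob (R : realType) (m s : R) (f : R -> \bar R) :
  measurable_fun setT f -> (forall x, 0 <= f x)%E ->
  (\int[normal_prob m s]_x f x =
   \int[lebesgue_measure]_x (f x * (normal_pdf m s x)%:E))%E.
Proof.
move=> mf f0; have dom := normal_prob_dominates m s.
pose nu : {finite_measure set _ -> \bar R} := normal_prob m s.
have mpdf : measurable_fun setT (EFin \o normal_pdf m s).
  by apply/measurable_EFinP; exact: measurable_normal_pdf.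
have iF := @Radon_Nikodym_SigmaFinite.f_integrable _ _ _ nu lebesgue_measure dom.
have mF := measurable_int _ iF.
rewrite -(@Radon_Nikodym_SigmaFinite.change_of_variables _ _ _ nu lebesgue_measure)//.
apply: ge0_ae_eq_integral => //.
- exact: emeasurable_funM.
- exact: emeasurable_funM.
- by move=> x _; rewrite mule_ge0// Radon_Nikodym_SigmaFinite.f_ge0.
- by move=> x _; rewrite mule_ge0// lee_fin normal_pdf_ge0.
- apply: ae_eqe_mul2l; apply: integral_ae_eq => // E _ mE.
  by rewrite -Radon_Nikodym_SigmaFinite.f_integral.
Qed.

(** Completing the square turns the integrand into a multiple of the density of the
    normal law of variance s^2 / (1 - 2 s^2 a). *)
Lemma integral_normal_prob_expR_sqr (R : realType) (s a v : R) : 0 < s ->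
  2 * s ^+ 2 * a < 1 ->
  (\int[normal_prob 0 s]_x (expR (a * (v + x) ^+ 2))%:E =
   ((Num.sqrt (1 - 2 * s ^+ 2 * a))^-1 *
    expR (a * v ^+ 2 / (1 - 2 * s ^+ 2 * a)))%:E)%E.
Proof.
move=> s0 sa; set D := 1 - _; have D0 : 0 < D by rewrite subr_gt0.
have sD0 : 0 < Num.sqrt D by rewrite sqrtr_gt0.
pose s' := s / Num.sqrt D; pose m' := 2 * s ^+ 2 * a * v / D.
have s'0 : 0 < s' by rewrite divr_gt0.
have s'2 : s' ^+ 2 = s ^+ 2 / D by rewrite expr_div_n sqr_sqrtr// ltW.
have mq : measurable_fun setT (fun x : R => a * (v + x) ^+ 2).
  apply: measurable_funM => //; apply: measurable_funX.
  by apply: measurable_funD => //; exact: measurable_id.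
rewrite ge0_integral_normal_prob; last 2 first.
- by apply/measurable_EFinP; exact: measurableT_comp.
- by move=> x; rewrite lee_fin expR_ge0.
transitivity (\int[lebesgue_measure]_x
   (((Num.sqrt D)^-1 * expR (a * v ^+ 2 / D))%:E * (normal_pdf m' s' x)%:E))%E.
  apply: eq_integral => x _; rewrite -!EFinM; congr EFin.
  rewrite !normal_pdfE ?gt_eqF//.
  have -> : normal_peak s' = Num.sqrt D * normal_peak s.
    rewrite /normal_peak s'2 (_ : s ^+ 2 / D * pi *+ 2 = s ^+ 2 * pi *+ 2 / D); last first.
      by rewrite !mulr2n; field; rewrite gt_eqF.
    rewrite sqrtrM; last by rewrite mulrn_wge0// mulr_ge0 ?sqr_ge0 ?pi_ge0.
    by rewrite sqrtrV ?(ltW D0)// invfM invrK mulrC.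
  have e : expR (a * (v + x) ^+ 2) * normal_fun 0 s x =
      expR (a * v ^+ 2 / D) * normal_fun m' s' x.
    rewrite /normal_fun -!expRD; congr expR.
    rewrite s'2 /m' !mulr2n /D; field; rewrite !gt_eqF//=.
    by rewrite addr_gt0 ?exprn_gt0.
  by rewrite mulrCA e; field; rewrite gt_eqF.
rewrite integralZl//; last exact: integrable_normal_pdf.
by rewrite integral_normal_pdf mule1.
Qed.

(** * Integrating out a variable independent of the past *)

Section independence.
Context (R : realType) (dO : measure_display) (Omega : measurableType dO)
  (P : probability Omega R) (I : finType) (Y : I -> Omega -> R).
Hypotheses (mY : forall i, measurable_fun setT (Y i))
  (indY : mutually_independent P Y).
Implicit Types S : pred I.

(** A pi-system generating the sigma-algebra of the variables Y i with i in S; taking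
    A i = setT off S keeps the index set of the intersection fixed, as in the
    product rule defining independence. *)
Definition rectangles S : set (set Omega) :=
  [set E | exists A : I -> set R, [/\ forall i, measurable (A i),
     forall i, ~~ S i -> A i = setT & E = \bigcap_(i in setT) Y i @^-1` A i]].

Lemma measurable_rectangle S : rectangles S `<=` measurable.
Proof.
move=> _ [A [mA _ ->]]; apply: fin_bigcap_measurable => // i _.
by rewrite -[X in measurable X]setTI; exact: mY.
Qed.

Lemma rectanglesI S : setI_closed (rectangles S).
Proof.
move=> _ _ [A [mA AS ->]] [B [mB BS ->]].
exists (fun i => A i `&` B i); split.
- by move=> i; exact: measurableI.
- by move=> i iS; rewrite AS// BS// setIT.
- by rewrite -bigcapI; apply: eq_bigcapr => i _; rewrite preimage_setI.
Qed.

Lemma rectanglesT S : rectangles S setT.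
Proof.
by exists (fun=> setT); split=> //; rewrite bigcapT.
Qed.

Lemma measurable_past S (E : set Omega) : <<s rectangles S >> E -> measurable E.
Proof.
apply: smallest_sub; first exact: sigma_algebra_measurable.
exact: measurable_rectangle.
Qed.

Lemma prob_rectangle (A : I -> set R) : (forall i, measurable (A i)) ->
  P (\bigcap_(i in setT) Y i @^-1` A i) = (\prod_(i : I) P (Y i @^-1` A i))%E.
Proof. exact: indY. Qed.

(** Both sides are finite measures in E that agree on the pi-system of rectangles. *)
Lemma independent_past S j (E : set Omega) (A : set R) : ~~ S j ->
  <<s rectangles S >> E -> measurable A ->
  P (E `&` Y j @^-1` A) = (P E * P (Y j @^-1` A))%E.
Proof.
move=> Sj SE mA; set D := Y j @^-1` A.
have mD : measurable D by rewrite -[X in measurable X]setTI; exact: mY.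
have D0 : 0 <= fine (P D) by exact: fine_ge0.
have DE : P D = (fine (P D))%:E by rewrite fineK ?fin_num_measure.
rewrite muleC DE.
have := @g_sigma_algebra_measure_unique _ R Omega (rectangles S)
  (@measurable_rectangle S) (fun=> setT) (fun=> rectanglesT S).
move=> /(_ _ (mrestr P mD) (mscale (NngNum D0) P)) H.
apply: (H _ (@rectanglesI S) _ _ E SE).
- by rewrite bigcup_const//; exists 0%N.
- move=> _ [B [mB BS ->]].
  set X := \bigcap_(i in _) _.
  change (P (X `&` D) = (fine (P D))%:E * P X)%E; rewrite -DE {}/X.
  have Bj : B j = setT by exact: BS.
  pose B' i := if i == j then A else B i.
  have -> : (\bigcap_(i in setT) Y i @^-1` B i) `&` D =
      \bigcap_(i in setT) Y i @^-1` B' i.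
    apply/seteqP; split=> [w [Bw Dw] i _|w Bw].
      by rewrite /B'; case: eqP => [->//|_]; exact: Bw.
    split=> [i _|].
      by have := Bw i Logic.I; rewrite /B'/=; case: eqP => // ->; rewrite Bj.
    by have := Bw j Logic.I; rewrite /B' eqxx.
  rewrite !prob_rectangle//; last by move=> i; rewrite /B'; case: eqP.
  rewrite (bigD1 j)//= [in RHS](bigD1 j)//= /B' eqxx Bj preimage_setT.
  rewrite probability_setT mul1e; congr (_ * _)%E.
  by apply: eq_bigr => i /negbTE ->.
- by move=> k; change (P (setT `&` D) < +oo)%E; rewrite setTI DE ltry.
Qed.

Lemma sub_past S S' : {subset S <= S'} ->
  <<s rectangles S >> `<=` <<s rectangles S' >>.
Proof.
move=> SS'; apply: sub_sigma_algebra2 => _ [A [mA AS ->]].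
exists A; split => // i iS'; apply: AS; apply: contra iS'; exact: SS'.
Qed.

Notation past S := (g_sigma_algebraType (rectangles S)).

Lemma measurable_fun_past S S' (f : Omega -> R) : {subset S <= S'} ->
  measurable_fun [set: past S] f -> measurable_fun [set: past S'] f.
Proof.
move=> SS' mf _ A mA; rewrite setTI; apply: (sub_past SS').
by have := mf measurableT A mA; rewrite setTI.
Qed.

Lemma measurable_fun_of_past S (f : Omega -> R) :
  measurable_fun [set: past S] f -> measurable_fun setT f.
Proof.
move=> mf _ A mA; rewrite setTI; apply: (@measurable_past S).
by have := mf measurableT A mA; rewrite setTI.
Qed.

Lemma measurable_fun_in_past S j : S j -> measurable_fun [set: past S] (Y j).
Proof.
move=> Sj _ A mA; rewrite setTI; apply: sub_sigma_algebra.
exists (fun i => if i == j then A else setT); split.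
- by move=> i; case: eqP.
- by move=> i; case: eqP => [->|]//; rewrite Sj.
- apply/seteqP; split=> [w Aw i _/=|w /(_ j Logic.I)/=]; last by rewrite eqxx.
  by case: eqP => // ->.
Qed.

(** By independence the law of w |-> (w, Y j w), with values in the product of the
    sample space carrying the past sigma-algebra and the line, is a product measure;
    Fubini-Tonelli's theorem applies to it. *)
Lemma integral_past_independent S j (nu : probability (measurableTypeR R) R)
    (f : past S * measurableTypeR R -> \bar R) : ~~ S j ->
  (forall A, measurable A -> P (Y j @^-1` A) = nu A) ->
  measurable_fun setT f -> (forall z, 0 <= f z)%E ->
  (\int[P]_w f (w, Y j w) = \int[P]_w \int[nu]_x f (w, x))%E.
Proof.
move=> Sj lawY mf f0.
have mid : measurable_fun [set: Omega] (fun w : Omega => w : past S).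
  by move=> _ A mA; rewrite setTI; exact: (@measurable_past S).
have mW : measurable_fun [set: Omega]
    (fun w : Omega => (w, Y j w) : past S * measurableTypeR R).
  by apply: measurable_fun_pair => //; exact: mY.
pose idm : {mfun Omega >-> past S} := HB.pack (fun w : Omega => w : past S)
  (isMeasurableFun.Build _ _ _ _ _ mid).
pose W : {mfun Omega >-> (past S * measurableTypeR R)%type} :=
  HB.pack (fun w : Omega => (w, Y j w) : past S * measurableTypeR R)
  (isMeasurableFun.Build _ _ _ _ _ mW).
transitivity (\int[distribution P W]_z f z)%E.
  by rewrite ge0_integral_distribution.
transitivity (\int[(distribution P idm \x nu)%E]_z f z)%E.
  apply: eq_measure_integral => A mA _; apply/esym.
  apply: product_measure_unique => // E B mE mB.
  by have := independent_past Sj mE mB; rewrite lawY.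
rewrite fubini_tonelli1// ge0_integral_distribution//.
  exact: measurable_fun_fubini_tonelli_F.
by move=> w; apply: integral_ge0 => x _; exact: f0.
Qed.

End independence.
Notation past Y S := (g_sigma_algebraType (rectangles Y S)).

(** * Exponential moments of the Gaussian chain *)

Section gaussian_step.
Context (R : realType) (dO : measure_display) (Omega : measurableType dO)
  (P : probability Omega R) (I : finType) (Y : I -> Omega -> R) (s : R).
Hypotheses (mY : forall i, measurable_fun setT (Y i))
  (indY : mutually_independent P Y) (s0 : 0 < s)
  (lawY : forall i A, measurable A -> P (Y i @^-1` A) = normal_prob 0 s A).

(** Conditionally on the past, V + Y j is normal with mean V, and its exponential
    quadratic moment is explicit. *)
Lemma gaussian_step (S : pred I) j (F V : Omega -> R) (a : R) :
  ~~ S j -> measurable_fun [set: past Y S] F -> measurable_fun [set: past Y S] V ->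
  (forall w, 0 <= F w) -> 2 * s ^+ 2 * a < 1 ->
  (\int[P]_w (F w * expR (a * (V w + Y j w) ^+ 2))%:E =
   ((Num.sqrt (1 - 2 * s ^+ 2 * a))^-1)%:E *
   \int[P]_w (F w * expR (a * V w ^+ 2 / (1 - 2 * s ^+ 2 * a)))%:E)%E.
Proof.
move=> Sj mF mV F0 sa.
pose f (z : past Y S * measurableTypeR R) : \bar R :=
  (F z.1 * expR (a * (V z.1 + z.2) ^+ 2))%:E.
have mf : measurable_fun setT f.
  apply/measurable_EFinP; apply: measurable_funM.
    exact: (measurableT_comp mF).
  apply: measurableT_comp => //; apply: measurable_funM => //.
  apply: measurable_funX; apply: measurable_funD => //.
  exact: (measurableT_comp mV).
have f0 z : (0 <= f z)%E by rewrite lee_fin mulr_ge0 ?expR_ge0.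
have := @integral_past_independent _ _ _ P _ Y mY indY S j (normal_prob 0 s) f Sj
  (lawY j) mf f0.
rewrite /f/= => ->.
have sq0 : 0 <= (Num.sqrt (1 - 2 * s ^+ 2 * a))^-1 by rewrite invr_ge0.
rewrite -ge0_integralZl//=; last 2 first.
- apply/measurable_EFinP; apply: measurable_funM.
    exact: (measurable_fun_of_past mY mF).
  apply: measurableT_comp => //; apply: measurable_funM => //.
  apply: measurable_funM => //; apply: measurable_funX.
  exact: (measurable_fun_of_past mY mV).
- by move=> w _; rewrite lee_fin mulr_ge0 ?expR_ge0.
apply: eq_integral => w _.
under eq_integral do rewrite EFinM.
rewrite ge0_integralZl//=; last 2 first.
- apply/measurable_EFinP; apply: measurableT_comp => //.
  apply: measurable_funM => //; apply: measurable_funX.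
  by apply: measurable_funD => //; exact: measurable_id.
- by rewrite lee_fin.
by rewrite integral_normal_prob_expR_sqr// -!EFinM mulrCA.
Qed.
End gaussian_step.

Fixpoint autoregression {R : realType} (c x : R) (xi : nat -> R) (k : nat) : R :=
  if k is k'.+1 then c * autoregression c x xi k' + xi k' else x.

Section chain.
Context (R : realType) (dO : measure_display) (Omega : measurableType dO)
  (P : probability Omega R) (n d : nat) (xi : nat -> 'I_d -> Omega -> R) (s c e : R).
Let Y (p : 'I_n * 'I_d) := xi p.1 p.2.
Hypotheses (mY : forall p, measurable_fun setT (Y p))
  (indY : mutually_independent P Y) (s0 : 0 < s)
  (lawY : forall p A, measurable A -> P (Y p @^-1` A) = normal_prob 0 s A).
Let a j := riccati (s ^+ 2) (c ^+ 2) e j.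
Hypothesis ha : forall j, (j < n)%N -> 2 * s ^+ 2 * a j < 1.

Let X (x : R) (i : 'I_d) k w := autoregression c x (fun l => xi l i w) k.

Let past_of (S : pred ('I_n * 'I_d)) i m : pred ('I_n * 'I_d) :=
  [pred p | S p || ((p.2 == i) && (p.1 < m)%N)].

Lemma measurable_autoregression S x i m k : (k <= m <= n)%N ->
  measurable_fun [set: past Y (past_of S i m)] (X x i k).
Proof.
elim: k => [_|k IH /andP[km mn]]; first exact: measurable_cst.
rewrite /X/=; apply: measurable_funD.
  by apply: measurable_funM => //; apply: IH; rewrite (ltnW km).
have kn : (k < n)%N by exact: leq_trans mn.
apply: (@measurable_fun_in_past R _ Omega _ Y _ (Ordinal kn, i)).
by rewrite /past_of/= eqxx km orbT.
Qed.

(** Induction on the number m of steps of one coordinate, integrating out the last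
    one. F stands for a factor depending on the other coordinates only. *)
Lemma integral_autoregression S x i (F : Omega -> R) m j :
  (forall k, ~~ S (k, i)) -> measurable_fun [set: past Y S] F ->
  (forall w, 0 <= F w) -> (j + m <= n)%N ->
  (\int[P]_w (F w * expR (e * (\sum_(0 <= k < m) X x i k w ^+ 2) +
      a j * X x i m w ^+ 2))%:E =
   (expR (a (j + m) * x ^+ 2) *
     \prod_(j <= l < j + m) (Num.sqrt (1 - 2 * s ^+ 2 * a l))^-1)%:E *
   \int[P]_w (F w)%:E)%E.
Proof.
move=> iS mF F0; elim: m j => [|m IH] j jm.
  rewrite addn0 big_geq// mulr1 -ge0_integralZl//=; last 2 first.
  - by apply/measurable_EFinP; exact: (measurable_fun_of_past mY mF).
  - by move=> w _; rewrite lee_fin.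
  by apply: eq_integral => w _; rewrite big_geq// mulr0 add0r -EFinM mulrC.
have mn : (m < n)%N by rewrite (leq_trans _ jm)// addnS ltnS leq_addl.
have jn : (j < n)%N by rewrite (leq_trans _ jm)// addnS ltnS leq_addr.
pose S' := past_of S i m.
have mF' : measurable_fun [set: past Y S'] F.
  by apply: (measurable_fun_past _ mF) => p Sp; apply/orP; left.
pose G w := F w * expR (e * \sum_(0 <= k < m.+1) X x i k w ^+ 2).
have mG : measurable_fun [set: past Y S'] G.
  apply: measurable_funM => //; apply: measurableT_comp => //.
  apply: measurable_funM => //; under eq_fun do rewrite big_mkord.
  apply: measurable_sum => k; apply: measurable_funX.
  by apply: measurable_autoregression; rewrite -ltnS ltn_ord ltnW.
have mV : measurable_fun [set: past Y S'] (fun w => c * X x i m w).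
  apply: measurable_funM => //.
  by apply: measurable_autoregression; rewrite leqnn ltnW.
have G0 w : 0 <= G w by rewrite mulr_ge0 ?expR_ge0.
have S'j : ~~ S' (Ordinal mn, i).
  by rewrite /S' /past_of/= negb_or iS eqxx ltnn.
transitivity (\int[P]_w (G w * expR (a j *
   (c * X x i m w + Y (Ordinal mn, i) w) ^+ 2))%:E)%E.
  by apply: eq_integral => w _; rewrite /G -mulrA -expRD.
rewrite (gaussian_step mY indY s0 lawY S'j mG mV G0 (ha jn)).
rewrite addnS big_ltn ?ltnS ?leq_addr// -addSn.
rewrite [X in (_ * X)%E](_ : _ = \int[P]_w (F w *
    expR (e * (\sum_(0 <= k < m) X x i k w ^+ 2) + a j.+1 * X x i m w ^+ 2))%:E)%E.
  rewrite IH ?addSn -?addnS// muleA -EFinM; congr (_%:E * _)%E.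
  by rewrite mulrCA.
apply: eq_integral => w _; congr EFin.
rewrite /G -mulrA -expRD; congr (_ * expR _).
have -> : \sum_(0 <= k < m.+1) X x i k w ^+ 2 =
    \sum_(0 <= k < m) X x i k w ^+ 2 + X x i m w ^+ 2 by rewrite big_nat_recr.
rewrite [a j.+1]riccatiS -/(a j) exprMn.
have : 1 - 2 * s ^+ 2 * a j != 0 by rewrite gt_eqF// subr_gt0 ha.
by rewrite /a => ?; field.
Qed.

(** The coordinates are integrated out one after the other; the past of coordinate m
    consists of all the increments of the coordinates before it. *)
Lemma integral_chain (x : 'rV[R]_d) :
  (\int[P]_w (expR (e * (\sum_(0 <= k < n) \sum_i X (x 0 i) i k w ^+ 2)))%:E =
   (expR (a n * (\sum_i x 0 i ^+ 2)) *
     (\prod_(0 <= l < n) (Num.sqrt (1 - 2 * s ^+ 2 * a l))^-1) ^+ d)%:E)%E.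
Proof.
pose K := \prod_(0 <= l < n) (Num.sqrt (1 - 2 * s ^+ 2 * a l))^-1.
pose F m w := expR (e * \sum_(i < d | (i < m)%N) \sum_(0 <= k < n) X (x 0 i) i k w ^+ 2).
suff H m : (m <= d)%N -> (\int[P]_w (F m w)%:E =
    (expR (a n * (\sum_(i < d | (i < m)%N) x 0 i ^+ 2)) * K ^+ m)%:E)%E.
  transitivity (\int[P]_w (F d w)%:E)%E.
    apply: eq_integral => w _; rewrite /F exchange_big/=.
    by congr (expR (_ * _))%:E; apply: eq_bigl => i; rewrite ltn_ord.
  rewrite H//; congr (expR (_ * _) * _)%:E.
  by apply: eq_bigl => i; rewrite ltn_ord.
elim: m => [_|m IH md].
  rewrite big_pred0// mulr0 expR0 expr0 mulr1 -[RHS](@probability_setT _ _ _ P).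
  rewrite -[RHS]mul1e -integral_cst//; apply: eq_integral => w _.
  by rewrite /F big_pred0// mulr0 expR0.
pose i := Ordinal md; pose S : pred ('I_n * 'I_d) := fun p => (p.2 < m)%N.
have splt (f : 'I_d -> R) : \sum_(j < d | (j < m.+1)%N) f j =
    \sum_(j < d | (j < m)%N) f j + f i.
  rewrite (bigD1 i)//= addrC; congr (_ + _); apply: eq_bigl => j.
  by rewrite -val_eqE/= ltnS [(j < m)%N]ltn_neqAle andbC.
have mF : measurable_fun [set: past Y S] (F m).
  apply: measurableT_comp => //; apply: measurable_funM => //.
  under eq_fun => w do rewrite big_mkcond/=. apply: measurable_sum => j.
  case: (boolP (j < m)%N) => jm; last exact: measurable_cst.
  under eq_fun do rewrite big_mkord.
  apply: measurable_sum => k; apply: measurable_funX.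
  apply: (@measurable_fun_past R _ Omega _ Y (past_of pred0 j n)).
    move=> p /orP[|/andP[/eqP pj _]]; first by [].
    by change (is_true (p.2 < m)%N); rewrite pj.
  by apply: measurable_autoregression; rewrite ltnW/= ?leqnn.
have iS k : ~~ S (k, i) by rewrite /S/= ltnn.
have F0 w : 0 <= F m w by exact: expR_ge0.
have := @integral_autoregression S (x 0 i) i (F m) n 0%N iS mF F0 (leqnn n).
rewrite add0n IH ?(ltnW md)// -EFinM => E.
transitivity (\int[P]_w (F m w * expR
  (e * (\sum_(0 <= k < n) X (x 0 i) i k w ^+ 2) + a 0 * X (x 0 i) i n w ^+ 2))%:E)%E.
  apply: eq_integral => w _; congr EFin; rewrite /F splt -expRD; congr expR.
  by rewrite /a /riccati/= mul0r addr0 mulrDr.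
rewrite E splt mulrDr expRD [K ^+ m.+1]exprS -/K; congr EFin; ring.
Qed.
End chain.

(** * Convergence in mean under bounded second moments *)

Section L1_convergence.
Context (R : realType) (dO : measure_display) (Omega : measurableType dO)
  (P : probability Omega R) (f : nat -> Omega -> R) (g : Omega -> R) (C : R).
Hypotheses (mf : forall n, measurable_fun setT (f n)) (mg : measurable_fun setT g)
  (fg : {ae P, forall w, f n w @[n --> \oo] --> g w})
  (fC : forall n, (\int[P]_w (f n w ^+ 2)%:E <= C%:E)%E).

(** Fatou's lemma. *)
Lemma second_moment_limit : (\int[P]_w (g w ^+ 2)%:E <= C%:E)%E.
Proof.
have mf2 n : measurable_fun setT (fun w => (f n w ^+ 2)%:E).
  by apply/measurable_EFinP; exact: measurable_funX.
have f20 n w : setT w -> (0 <= (f n w ^+ 2)%:E)%E by rewrite lee_fin sqr_ge0.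
have lim0 w : setT w -> (0 <= limn_einf (fun n => (f n w ^+ 2)%:E))%E.
  move=> _; rewrite limn_einf_lim; apply: lime_ge; first exact: is_cvg_einfs.
  apply: nearW => n; apply: le_ereal_inf_tmp => _ [m _ <-].
  by rewrite lee_fin sqr_ge0.
apply: (@le_trans _ _ (\int[P]_w limn_einf (fun n => (f n w ^+ 2)%:E))%E).
  apply: ae_ge0_le_integral => //.
  - by move=> w _; rewrite lee_fin sqr_ge0.
  - by apply/measurable_EFinP; exact: measurable_funX.
  - apply: (emeasurable_fun_cvg (fun n w => einfs (fun m => (f m w ^+ 2)%:E) n)).
      exact: measurable_fun_einfs.
    by move=> w _; rewrite limn_einf_lim; exact: is_cvg_einfs.
  - apply: filterS fg => w fgw _.
    have : (f n w ^+ 2)%:E @[n --> \oo] --> (g w ^+ 2)%:E.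
      by apply: cvg_EFin; [exact: nearW|exact: cvgM].
    by move=> /cvg_limn_einf_sup[-> _].
apply: le_trans (fatou P measurableT mf2 f20) _.
rewrite limn_einf_lim; apply: lime_le; first exact: is_cvg_einfs.
apply: nearW => n; apply: le_trans (fC n); apply: ereal_inf_lbound.
by exists n => /=.
Qed.

Lemma integrable_square_of_le (u : Omega -> R) : measurable_fun setT u ->
  (\int[P]_w (u w ^+ 2)%:E <= C%:E)%E -> P.-integrable setT (EFin \o (fun w => u w ^+ 2)).
Proof.
move=> mu uC; apply/integrableP; split.
  by apply/measurable_EFinP; exact: measurable_funX.
apply: le_lt_trans (ltry C); apply: le_trans uC.
by under eq_integral do rewrite /= ger0_norm ?sqr_ge0//.
Qed.

Lemma integrable_of_square (u : Omega -> R) : measurable_fun setT u ->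
  P.-integrable setT (EFin \o (fun w => u w ^+ 2)) -> P.-integrable setT (EFin \o u).
Proof.
move=> mu iu2.
have i1 : P.-integrable setT (EFin \o (fun=> 1 : R)).
  exact: finite_measure_integrable_cst.
apply: (le_integrable measurableT _ _ (integrable_add i1 iu2)).
  exact/measurable_EFinP.
move=> w _ /=; rewrite lee_fin [leRHS]ger0_norm ?addr_ge0 ?sqr_ge0//.
rewrite -(real_normK (num_real (u w))).
have := sqr_ge0 (`|u w| - 1); have := sqr_ge0 (`|u w|); lra.
Qed.

(** |u| <= min(|u|, K) + u^2 / K: the first term tends to 0 in mean by dominated
    convergence, and the second one is uniformly small for large K. *)
Lemma L1_cvg : forall e : R, 0 < e ->
  \forall n \near \oo, (\int[P]_w `|f n w - g w|)%R <= e.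
Proof.
move=> e e0; have g2 := second_moment_limit.
have ig2 := integrable_square_of_le mg g2.
have if2 n := integrable_square_of_le (mf n) (fC n).
have ig := integrable_of_square mg ig2.
have ifn n := integrable_of_square (mf n) (if2 n).
have C0 : 0 <= C.
  rewrite -lee_fin; apply: le_trans g2; apply: integral_ge0 => w _.
  by rewrite lee_fin sqr_ge0.
have R2 (u : Omega -> R) : P.-integrable setT (EFin \o (fun w => u w ^+ 2)) ->
    (\int[P]_w (u w ^+ 2)%:E <= C%:E)%E -> (\int[P]_w (u w ^+ 2))%R <= C.
  by move=> iu; rewrite -lee_fin /Rintegral fineK//; exact: integrable_fin_num.
pose K := 8 * C / e + 1.
have K0 : 0 < K by rewrite ltr_wpDl// divr_ge0 ?(ltW e0)// mulr_ge0.
pose psi n w : R := Num.min `|f n w - g w| K.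
have md n : measurable_fun setT (fun w => `|f n w - g w|).
  by apply: measurableT_comp => //; exact: measurable_funB.
have mpsi n : measurable_fun setT (psi n) by exact: measurable_minr.
have psi_bd n w : `|psi n w| <= K.
  by rewrite ger0_norm ?ge_min ?lexx ?orbT// le_min normr_ge0 ltW.
have psi0 : {ae P, forall w, setT w ->
    (fun n => (psi n w)%:E) @ \oo --> (0%:E : \bar R)}.
  apply: filterS fg => w fgw _; apply: cvg_EFin; first exact: nearW.
  apply/cvgrPdist_le => e' e'0; move/cvgrPdist_le: fgw => /(_ _ e'0).
  apply: filterS => n fgn; rewrite sub0r normrN /= /psi ger0_norm.
    by rewrite ge_min distrC fgn.
  by rewrite le_min normr_ge0 ltW.
have iK : P.-integrable setT (EFin \o (fun=> K)).
  exact: finite_measure_integrable_cst.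
have ipsi n : P.-integrable setT (EFin \o psi n).
  apply: le_integrable iK => //; first exact/measurable_EFinP.
  by move=> w _ /=; rewrite lee_fin [leRHS]ger0_norm ?(ltW K0).
have [_ _ lim] := @dominated_convergence _ _ _ P setT measurableT
  (fun n w => (psi n w)%:E) (cst 0%:E) (cst K%:E)
  (fun n => (measurable_EFinP _ _).2 (mpsi n)) (measurable_cst _) psi0 iK
  (nearW _ (fun w n _ => psi_bd n w)).
have e2 : 0 < e / 2 by rewrite divr_gt0.
have psie : \forall n \near \oo, (\int[P]_w psi n w)%R <= e / 2.
  have lim' : (\int[P]_w psi n w)%R @[n --> \oo] --> (0 : R).
    by move: lim; rewrite integral0 => /fine_cvg.
  move/cvgrPdist_le: lim' => /(_ _ e2); apply: filterS => n.
  by rewrite sub0r normrN; apply: le_trans; exact: ler_norm.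
apply: filterS psie => n psie.
have iq : P.-integrable setT
    (EFin \o (fun w => psi n w + (2 / K * f n w ^+ 2 + 2 / K * g w ^+ 2))).
  by do 2?[apply: integrable_add => //]; exact: integrable_scale.
have id : P.-integrable setT (EFin \o (fun w => `|f n w - g w|)).
  have : P.-integrable setT (EFin \o (fun w => f n w - g w)).
    by apply: eq_integrable (integrableB measurableT (ifn n) ig).
  exact: integrable_norm.
have : (\int[P]_w `|f n w - g w|)%R <=
    (\int[P]_w (psi n w + (2 / K * f n w ^+ 2 + 2 / K * g w ^+ 2)))%R.
  apply: le_Rintegral => // w _.
  have sq : (f n w - g w) ^+ 2 <= 2 * f n w ^+ 2 + 2 * g w ^+ 2.
    have := sqr_ge0 (f n w + g w); lra.
  have dK : `|f n w - g w| <= psi n w + (f n w - g w) ^+ 2 / K.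
    rewrite /psi; case: (leP `|f n w - g w| K) => _.
      by rewrite lerDl divr_ge0 ?sqr_ge0 ?(ltW K0).
    rewrite -(ler_pM2r K0) mulrDl divfK ?gt_eqF//.
    rewrite -(real_normK (num_real (f n w - g w))).
    have := sqr_ge0 (`|f n w - g w| - K / 2); have := sqr_ge0 K; lra.
  apply: le_trans dK _; rewrite lerD2l.
  rewrite [leRHS](_ : _ = (2 * f n w ^+ 2 + 2 * g w ^+ 2) / K).
    by rewrite ler_pM2r ?invr_gt0.
  by field; rewrite gt_eqF.
move=> /le_trans; apply.
have is1 := integrable_scale (2 / K) (if2 n).
have is2 := integrable_scale (2 / K) ig2.
rewrite RintegralD// ?RintegralD// ?RintegralZl//; last exact: integrable_add.
have K2 : 0 <= 2 / K by rewrite divr_ge0 ?(ltW K0).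
have := ler_wpM2l K2 (R2 _ (if2 n) (fC n)); have := ler_wpM2l K2 (R2 _ ig2 g2).
have CK : 2 / K * C <= e / 4.
  rewrite mulrAC ler_pdivrMr// /K mulrDr mulr1.
  rewrite (_ : e / 4 * (8 * C / e) = 2 * C); last by field; rewrite gt_eqF.
  by rewrite lerDl divr_ge0 ?(ltW e0).
move: psie CK; set a := (\int[P]_w psi n w)%R; set b := 2 / K * C.
set c1 := 2 / K * _; set c2 := 2 / K * _; lra.
Qed.

Lemma integrable_limit : P.-integrable setT (EFin \o g).
Proof.
exact: integrable_of_square (integrable_square_of_le mg second_moment_limit).
Qed.
End L1_convergence.

(** * Deviations of the time average of the chain *)

Section chain_deviation.
Context (R : realType) (dO : measure_display) (Omega : measurableType dO)
  (P : probability Omega R) (n d : nat) (xi : nat -> 'I_d -> Omega -> R)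
  (kappa T s c v : R) (x : 'rV[R]_d).
Hypotheses (k0 : 0 < kappa) (T0 : 0 < T) (s0 : 0 < s) (d0 : (0 < d)%N)
  (vT : v * T = s ^+ 2) (nv : n%:R * v = 1)
  (qb : 0 <= c ^+ 2 <= 1 - 2 * kappa * s ^+ 2).
Hypotheses (mxi : forall p : 'I_n * 'I_d, measurable_fun setT (xi p.1 p.2))
  (indxi : mutually_independent P (fun p : 'I_n * 'I_d => xi p.1 p.2))
  (lawxi : forall (p : 'I_n * 'I_d) A, measurable A ->
     P (xi p.1 p.2 @^-1` A) = normal_prob 0 s A).

Local Notation h := (s ^+ 2).
Local Notation q := (c ^+ 2).
Let X i k w := autoregression c (x 0 i) (fun l => xi l i w) k.
Let x2 := \sum_i x 0 i ^+ 2.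
Let lam := riccati1 q v.
Let bet := riccati2 h q v.

Definition chain_mean_square w : R := v * \sum_(0 <= k < n) \sum_i X i k w ^+ 2.
Definition chain_mean : R := lam n * x2 + d%:R * \sum_(0 <= l < n) h * lam l.
Let Z w := chain_mean_square w - chain_mean.
Let D := x2 / (kappa * T) + d%:R / kappa.
Let hvar := bet n * x2 + d%:R * \sum_(0 <= l < n) (h * bet l + h ^+ 2 * lam l ^+ 2).

Let h0 : 0 < h. Proof. by rewrite exprn_gt0. Qed.
Let v0 : 0 < v. Proof. by rewrite -(pmulr_lgt0 _ T0) vT. Qed.
Let q0 : 0 <= q. Proof. by case/andP: qb. Qed.
Let x20 : 0 <= x2. Proof. by apply: sumr_ge0 => i _; rewrite sqr_ge0. Qed.
Let D0 : 0 < D.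
Proof.
rewrite ltr_wpDl ?divr_gt0 ?ltr0n//.
by rewrite divr_ge0 ?mulr_ge0 ?(ltW k0) ?(ltW T0).
Qed.
Let nhT : n%:R * h = T. Proof. by rewrite -vT mulrA nv mul1r. Qed.

Lemma measurable_chain_mean_square : measurable_fun setT chain_mean_square.
Proof.
apply: measurable_funM => //; under eq_fun do rewrite big_mkord.
apply: measurable_sum => k; apply: measurable_sum => i; apply: measurable_funX.
apply: (measurable_fun_of_past mxi).
apply: (@measurable_autoregression _ _ _ _ _ xi c pred0 (x 0 i) i n k).
by rewrite ltnW/=.
Qed.

Let mZ : measurable_fun setT Z.
Proof.
by apply: measurable_funB => //; exact: measurable_chain_mean_square.
Qed.

Let invsqrt u := (Num.sqrt (1 - u))^-1 : R.

Lemma expmoment_chain (th : R) :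
  (forall j, (j < n)%N -> 2 * h * riccati h q (th * v) j < 1) ->
  expmoment P Z th = (expR (riccati h q (th * v) n * x2 - th * chain_mean) *
    (\prod_(0 <= l < n) invsqrt (2 * h * riccati h q (th * v) l)) ^+ d)%:E.
Proof.
move=> ha; have := @integral_chain _ _ _ P n d xi s c (th * v) mxi indxi s0 lawxi
  ha x.
rewrite -/x2 => E; rewrite expRD mulrAC EFinM -E muleC -ge0_integralZl//; last first.
- apply/measurable_EFinP; apply: measurableT_comp => //.
  apply: (eq_measurable_fun (fun w => th * chain_mean_square w)).
    by move=> w _; rewrite /chain_mean_square mulrA.
  by apply: measurable_funM => //; exact: measurable_chain_mean_square.
apply: eq_integral => w _; rewrite -EFinM -expRD; congr (expR _)%:E.
by rewrite /Z /chain_mean_square; ring.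
Qed.

Lemma prod_invsqrt_le (f g : nat -> R) :
  (forall j, invsqrt (f j) <= expR (g j)) ->
  (\prod_(0 <= l < n) invsqrt (f l)) ^+ d <= expR (d%:R * \sum_(0 <= l < n) g l).
Proof.
move=> fg; rewrite expRM_natl.
have p0 : 0 <= \prod_(0 <= l < n) invsqrt (f l).
  by apply: prodr_ge0 => l _; rewrite invr_ge0.
rewrite lerXn2r ?nnegrE ?expR_ge0//.
rewrite expR_sum; apply: ler_prod => l _.
by rewrite invr_ge0 sqrtr_ge0 fg.
Qed.

Lemma prod_invsqrt_ge (f g : nat -> R) :
  (forall j, expR (g j) <= invsqrt (f j)) ->
  expR (d%:R * \sum_(0 <= l < n) g l) <= (\prod_(0 <= l < n) invsqrt (f l)) ^+ d.
Proof.
move=> fg; rewrite expRM_natl.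
have p0 : 0 <= \prod_(0 <= l < n) invsqrt (f l).
  by apply: prodr_ge0 => l _; rewrite invr_ge0.
rewrite lerXn2r ?nnegrE ?expR_ge0//.
rewrite expR_sum; apply: ler_prod => l _.
by rewrite expR_ge0 fg.
Qed.

Let sum_const (u : R) : \sum_(0 <= l < n) h * u = T * u.
Proof. by rewrite big_mkord sumr_const card_ord -mulr_natl mulrA nhT. Qed.

Let hvar_ge0 : 0 <= hvar.
Proof.
have b0 j : 0 <= bet j by exact/riccati2_ge0/ltW.
rewrite addr_ge0 ?mulr_ge0// sumr_ge0// => l _.
exact: addr_ge0 (mulr_ge0 (ltW h0) (b0 l)) (mulr_ge0 (sqr_ge0 h) (sqr_ge0 _)).
Qed.

Let TDE : T * D = (x2 + d%:R * T) / kappa.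
Proof. by rewrite /D; field; rewrite !gt_eqF. Qed.

(** 2 hvar is the variance parameter w; the bounds on the Riccati coefficients sum up to
    sigma2 because n h = T. *)
Lemma hvar_le : hvar <= D / (2 * kappa ^+ 2 * T) / 2.
Proof.
pose M := (2 * kappa * T)^-1 ^+ 2 / kappa.
have M0 : 0 <= M by rewrite divr_ge0 ?sqr_ge0 ?ltW.
have -> : D / (2 * kappa ^+ 2 * T) / 2 = M * x2 + d%:R * (T * M).
  rewrite /M (_ : D = (T * D) / T); last by field; rewrite gt_eqF.
  by rewrite TDE; field; rewrite !gt_eqF.
rewrite lerD//.
  rewrite ler_wpM2r// (le_trans (riccati2_le n k0 T0 vT qb h0))// -/M.
  rewrite ler_piMl// gerBl.
  exact: mulr_ge0 (mulr_ge0 (ler0n R 2) (ltW k0)) (ltW h0).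
rewrite ler_wpM2l// -(sum_const M) ler_sum_nat// => l _.
exact: riccati_step_var_le.
Qed.

(** The second order terms sum up to A^2 (|x|^2 + d T) / kappa = A^2 T D. *)
Lemma expmoment_chain_pos (p t : R) :
  0 <= p < 1 -> 0 <= t <= kappa ^+ 2 * T * p * (2 - p) / 2 ->
  (expmoment P Z t <=
     (expR (2 * t ^+ 2 * (D / (2 * kappa ^+ 2 * T)) / (2 - p) ^+ 2))%:E)%E.
Proof.
move=> pb tb; pose A := t / (kappa * T * (2 - p)).
pose a := riccati h q (t * v).
have a01 j : 0 <= 2 * h * a j < 1.
  have [/andP[_ hA1] _ /andP[a0 aA] _ _] := riccati_pos j k0 T0 vT qb h0 pb tb.
  have h2 : 0 <= 2 * h by exact: mulr_ge0 (ltW h0).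
  apply/andP; split; first exact: mulr_ge0 h2 a0.
  by apply: le_lt_trans hA1; exact: ler_wpM2l.
rewrite expmoment_chain; last by move=> j _; case/andP: (a01 j).
rewrite lee_fin -/a.
have bound j := riccati_pos_le j k0 T0 vT qb h0 pb tb.
have K : (\prod_(0 <= l < n) invsqrt (2 * h * a l)) ^+ d <=
    expR (d%:R * \sum_(0 <= l < n) (t * (h * lam l) + h * (A ^+ 2 / kappa))).
  apply: prod_invsqrt_le => j; have /andP[aj0 aj1] := a01 j.
  apply: le_trans (invsqrt_le_expR_ge0 _) _; first by rewrite aj0.
  rewrite ler_expR; have [_] := bound j; rewrite -/a -/A -/lam; apply: le_trans.
  rewrite le_eqVlt; apply/orP; left; apply/eqP; field.
  by rewrite gt_eqF// subr_gt0.
apply: le_trans (ler_wpM2l (expR_ge0 _) K) _.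
rewrite -expRD ler_expR big_split/= sum_const -mulr_sumr /chain_mean.
have [an _] := bound n; rewrite -/a -/A -/lam in an.
have {}an := ler_wpM2r x20 an.
have -> : 2 * t ^+ 2 * (D / (2 * kappa ^+ 2 * T)) / (2 - p) ^+ 2 = A ^+ 2 * (T * D).
  rewrite /A; field; rewrite !gt_eqF//=.
  by case/andP: pb => _ p1; lra.
rewrite TDE; set S := \sum_(_ <= _ < _) _ in K *.
have -> : A ^+ 2 * ((x2 + d%:R * T) / kappa) =
    A ^+ 2 / kappa * x2 + d%:R * (T * (A ^+ 2 / kappa)) by field; rewrite gt_eqF.
move: (A ^+ 2 / kappa) an => B an; lra.
Qed.

Lemma expmoment_chain_neg (t : R) : 0 <= t ->
  (expmoment P Z (- t) <= (expR (t ^+ 2 * hvar))%:E)%E.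
Proof.
move=> t0; pose a := riccati h q (- t * v).
have neg j := riccati_neg j q0 (ltW h0) (ltW v0) t0.
have ha j : 2 * h * a j <= 0.
  have [a0 _] := neg j; apply: mulr_ge0_le0 a0; exact: mulr_ge0 (ltW h0).
rewrite expmoment_chain; last by move=> j _; rewrite (le_lt_trans (ha j)).
rewrite lee_fin -/a.
have K : (\prod_(0 <= l < n) invsqrt (2 * h * a l)) ^+ d <=
    expR (d%:R * \sum_(0 <= l < n) (- t * (h * lam l) +
      t ^+ 2 * (h * bet l + h ^+ 2 * lam l ^+ 2))).
  apply: prod_invsqrt_le => j.
  apply: le_trans (invsqrt_le_expR_le0 (ha j)) _.
  rewrite ler_expR; have := riccati_neg_step j q0 (ltW h0) (ltW v0) t0.
  apply: le_trans; rewrite -/a.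
  by rewrite le_eqVlt; apply/orP; left; apply/eqP; field.
apply: le_trans (ler_wpM2l (expR_ge0 _) K) _.
rewrite -expRD ler_expR big_split/= -!mulr_sumr /chain_mean /hvar -mulr_sumr.
have [_ /andP[_ an]] := neg n; rewrite -/a -/lam -/bet in an.
have {}an := ler_wpM2r x20 an.
move: an; set S := \sum_(_ <= _ < _) lam _; set S2 := \sum_(_ <= _ < _) (_ + _).
by lra.
Qed.

(** By the arithmetic-geometric mean inequality it is enough to add the exponents of
    lower bounds for the two exponential moments; the first order terms cancel. *)
Lemma expmoment_chain_sum (p t : R) :
  0 <= p < 1 -> 0 <= t <= kappa ^+ 2 * T * p * (2 - p) / 2 ->
  ((2 * expR (t ^+ 2 * hvar))%:E <= expmoment P Z t + expmoment P Z (- t))%E.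
Proof.
move=> pb tb; have t0 : 0 <= t by case/andP: tb.
pose a := riccati h q (t * v); pose b := riccati h q (- t * v).
have two j := riccati_two_sided j k0 T0 vT qb h0 pb tb.
have ha j : 2 * h * a j < 1.
  have [/andP[_ hA1] _ /andP[_ aA] _ _] := riccati_pos j k0 T0 vT qb h0 pb tb.
  apply: le_lt_trans hA1; apply: ler_wpM2l aA; exact: mulr_ge0 (ltW h0).
have hb j : 2 * h * b j < 1.
  have [b0 _] := riccati_neg j q0 (ltW h0) (ltW v0) t0.
  by apply: (@le_lt_trans _ _ 0) => //; apply: mulr_ge0_le0 b0; exact: mulr_ge0 (ltW h0).
rewrite !expmoment_chain// -EFinD lee_fin -/a -/b.
pose f (u : R) := u / 2 + u ^+ 2 / 4 + u ^+ 3 / 6.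
have Ka := prod_invsqrt_ge (fun j => expR_le_invsqrt (ha j)).
have Kb := prod_invsqrt_ge (fun j => expR_le_invsqrt (hb j)).
have amgm (u w z : R) : 2 * z <= u + w -> 2 * expR z <= expR u + expR w.
  move=> zu; rewrite (@le_trans _ _ (2 * (expR (u / 2) * expR (w / 2))))//.
    by rewrite ler_pM2l// -expRD ler_expR; lra.
  have -> : expR u = expR (u / 2) ^+ 2 by rewrite -expRM_natl; congr expR; field.
  have -> : expR w = expR (w / 2) ^+ 2 by rewrite -expRM_natl; congr expR; field.
  have : 0 <= (expR (u / 2) - expR (w / 2)) ^+ 2 by exact: sqr_ge0.
  lra.
apply: le_trans (lerD (ler_wpM2l (expR_ge0 _) Ka) (ler_wpM2l (expR_ge0 _) Kb)).
rewrite -!expRD; apply: amgm.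
have [ab _] := two n; rewrite -/a -/b -/bet in ab.
have {}ab := ler_wpM2r x20 ab.
have S : \sum_(0 <= l < n) 2 * (t ^+ 2 * (h * bet l + h ^+ 2 * lam l ^+ 2)) <=
    \sum_(0 <= l < n) (f (2 * h * a l) + f (2 * h * b l)).
  by apply: ler_sum_nat => l _; have [] := two l.
have {}S := ler_wpM2l (ler0n R d) S.
move: ab S; rewrite big_split/= -!mulr_sumr /hvar.
set S2 := \sum_(_ <= _ < _) (_ + _); rewrite /f.
set S3 := \sum_(_ <= _ < _) _; set S4 := \sum_(_ <= _ < _) _.
by lra.
Qed.

Lemma subgamma_chain : subgamma_below_above P Z kappa T D /\
  (\int[P]_w Z w)%R = 0.
Proof.
pose t0 := kappa ^+ 2 * T * (1 / 2) * (2 - 1 / 2) / 2.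
have t00 : 0 < t0 by rewrite /t0 !mulr_gt0 ?exprn_gt0//; lra.
have pb : 0 <= (1 / 2 : R) < 1 by apply/andP; split; lra.
pose s2 := D / (2 * kappa ^+ 2 * T).
have s20 : 0 < s2 by rewrite divr_gt0// !mulr_gt0 ?exprn_gt0.
have C0 : 0 < 2 * s2 / (2 - 1 / 2) ^+ 2.
  have e0 : 0 < 2 - 1 / 2 :> R by lra.
  exact: divr_gt0 (mulr_gt0 (ltr0n R 2) s20) (exprn_gt0 2 e0).
have [EZ EZ2 EZ4] : [/\ (\int[P]_w Z w)%R = 0,
    (\int[P]_w (Z w ^+ 2))%R <= 2 * hvar &
    3 * (2 * hvar) ^+ 2 <= (\int[P]_w (Z w ^+ 4))%R].
  have h2 : 2 * hvar / 2 = hvar by field.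
  apply: (@moments_of_expmoment _ _ _ P Z _ _ _ mZ t00 _ C0).
  - by rewrite mulr_ge0.
  - move=> t tb; apply: le_trans (expmoment_chain_pos pb tb) _.
    rewrite lee_fin ler_expR le_eqVlt; apply/orP; left; apply/eqP.
    by rewrite -/s2; ring.
  - by move=> t /andP[? _]; rewrite h2; exact: expmoment_chain_neg.
  - by move=> t tb; rewrite h2; exact: expmoment_chain_sum pb tb.
have vle : 2 * hvar <= s2 by have := hvar_le; rewrite -/s2; lra.
split=> //; split=> //.
- exact: expmoment_chain_pos.
- move=> t tt0; apply: le_trans (expmoment_chain_neg tt0) _.
  by rewrite lee_fin ler_expR ler_wpM2l ?sqr_ge0// hvar_le.
- exact: le_trans EZ2 vle.
- apply: le_trans EZ4; rewrite ler_pM2l// ler_pXn2r ?nnegrE ?mulr_ge0//.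
  by apply: Rintegral_ge0 => w _; rewrite sqr_ge0.
Qed.

Lemma chain_mean_bound : 0 <= chain_mean <= D / 2.
Proof.
have l0 j : 0 <= lam j by exact/riccati1_ge0/ltW.
have l1 j : lam j <= (2 * kappa * T)^-1.
  exact: riccati1_le k0 T0 vT qb (ltW h0).
apply/andP; split.
  apply: addr_ge0 (mulr_ge0 (l0 n) x20) (mulr_ge0 (ler0n R d) _).
  by apply: sumr_ge0 => l _; exact: mulr_ge0 (ltW h0) (l0 l).
have -> : D / 2 = (2 * kappa * T)^-1 * x2 + d%:R * (T * (2 * kappa * T)^-1).
  by rewrite /D; field; rewrite !gt_eqF.
apply: lerD; first exact: ler_wpM2r.
rewrite ler_wpM2l// -sum_const; apply: ler_sum => l _.
by apply: ler_wpM2l => //; exact: ltW.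
Qed.

Let iZ : P.-integrable setT (EFin \o Z).
Proof.
exact: integrable_of_square mZ (subgamma_moment2 k0 T0 D0 subgamma_chain.1).
Qed.

Lemma expect_chain_mean_square :
  (\int[P]_w chain_mean_square w)%R = chain_mean.
Proof.
have i1 : P.-integrable setT (EFin \o (fun=> chain_mean)).
  exact: finite_measure_integrable_cst.
transitivity (\int[P]_w (Z w + chain_mean))%R.
  by apply: eq_Rintegral => w _; rewrite /Z subrK.
rewrite RintegralD// subgamma_chain.2 add0r Rintegral_cst//.
rewrite (_ : fine _ = 1) ?mulr1//.
exact: (congr1 fine (@probability_setT _ _ _ P)).
Qed.

Lemma second_moment_chain_mean_square :
  (\int[P]_w (chain_mean_square w ^+ 2)%:E <=
   (2 * (D / (2 * kappa ^+ 2 * T)) + 2 * (D / 2) ^+ 2)%:E)%E.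
Proof.
have [sg _] := subgamma_chain; have i2 := subgamma_moment2 k0 T0 D0 sg.
have [_ _ _ EZ2 _] := sg.
have i1 : P.-integrable setT (EFin \o (fun=> 2 * (D / 2) ^+ 2)).
  exact: finite_measure_integrable_cst.
have i3 := integrable_add (integrable_scale 2 i2) i1.
apply: (@le_trans _ _ (\int[P]_w (2 * Z w ^+ 2 + 2 * (D / 2) ^+ 2)%:E)%E).
  apply: ge0_le_integral => //.
  - by move=> w _; rewrite lee_fin sqr_ge0.
  - apply/measurable_EFinP; apply: measurable_funX.
    exact: measurable_chain_mean_square.
  - exact: measurable_int i3.
  - move=> w _; rewrite lee_fin.
    have -> : chain_mean_square w = Z w + chain_mean by rewrite /Z subrK.
    have /andP[m0 m1] := chain_mean_bound.
    have : chain_mean ^+ 2 <= (D / 2) ^+ 2.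
      by rewrite ler_pXn2r ?nnegrE// (le_trans m0).
    have := sqr_ge0 (Z w - chain_mean); lra.
have -> : (\int[P]_w (2 * Z w ^+ 2 + 2 * (D / 2) ^+ 2)%:E)%E =
    (\int[P]_w (2 * Z w ^+ 2 + 2 * (D / 2) ^+ 2))%R%:E.
  by rewrite /Rintegral fineK//; exact: integrable_fin_num i3.
rewrite lee_fin RintegralD//; last exact: integrable_scale.
rewrite RintegralZl// Rintegral_cst// (_ : fine _ = 1); last first.
  exact: (congr1 fine (@probability_setT _ _ _ P)).
by rewrite mulr1 lerD2r ler_wpM2l.
Qed.
End chain_deviation.

(** * Continuous functions on a segment *)

(** Heine's theorem, through the covering form of compactness applied to the moduli del
    that work near each point. *)
Lemma uniformly_continuous_itv (R : realType) (f : R -> R) (a b e : R) :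
  {within `[a, b], continuous f} -> 0 < e ->
  exists2 del : R, 0 < del & forall s t : R, a <= s <= b -> a <= t <= b ->
    `|s - t| < del -> `|f s - f t| <= e.
Proof.
move=> /subspace_continuousP cf e0; have e20 : 0 < e / 2 by rewrite divr_gt0.
have cK : near_covering_within `[a, b].
  by apply/near_covering_withinP; apply/compact_near_coveringP; exact: segment_compact.
pose Q (del s : R) := forall t, a <= t <= b -> `|s - t| < del -> `|f s - f t| <= e.
have : \forall del \near 0^'+, `[a, b] `<=` Q del.
  apply: (cK R 0^'+ Q) => x xab.
  have /cvgrPdist_lt /(_ _ e20) := cf x xab.
  rewrite near_withinE => /nbhs_ballP[r /= r0 fx].
  have r2 : 0 < r / 2 by rewrite divr_gt0.
  exists (ball x (r / 2), [set del | del < r / 2]) => /=.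
    by split; [exact: nbhsx_ballx|exact: nbhs_right_lt].
  move=> [s del] [/= xs dr] sab t tab st.
  have fs : `|f x - f s| < e / 2.
    by apply: fx => //; apply: le_ball xs; lra.
  have ft : `|f x - f t| < e / 2.
    apply: fx; last by rewrite /= in_itv/=.
    rewrite /ball/= (_ : x - t = (x - s) + (s - t)); last by ring.
    move: xs; rewrite /ball/= => xs; apply: le_lt_trans (ler_normD _ _) _; lra.
  rewrite (_ : f s - f t = (f x - f t) - (f x - f s)); last by ring.
  apply: le_trans (ler_normB _ _) _; lra.
move=> H; have [del [d0 Hd]] : exists del, 0 < del /\ `[a, b] `<=` Q del.
  near (0 : R)^'+ => del; exists del; split; near: del => //.
  exact: nbhs_right_gt.
exists del => // s t sab tab st; apply: (Hd s) => //.
Unshelve. all: by end_near.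
Qed.

Lemma bounded_itv (R : realType) (f : R -> R) (a b : R) : a <= b ->
  {within `[a, b], continuous f} ->
  exists2 M : R, 0 <= M & forall t, a <= t <= b -> `|f t| <= M.
Proof.
move=> ab cf; have [c1 _ H1] := EVT_max ab cf; have [c2 _ H2] := EVT_min ab cf.
exists (`|f c1| + `|f c2|); first by rewrite addr_ge0.
move=> t tab; have tin : t \in `[a, b]%R by rewrite in_itv.
rewrite ler_norml; apply/andP; split.
  have := H2 _ tin; have := ler_norm (- f c2); rewrite normrN => ? ?.
  have := normr_ge0 (f c1); lra.
have := H1 _ tin; have := ler_norm (f c1); have := normr_ge0 (f c2); lra.
Qed.

(** The integral over a subinterval is written as a difference of integrals from 0
    because this is the form in which the integrated equation provides it. *)
Lemma Rintegral_increment (R : realType) (f : R -> R) (T a b u w : R) :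
  {within `[0, T], continuous f} -> 0 <= a -> a <= b -> b <= T ->
  (forall s, a <= s <= b -> `|f s - u| <= w) ->
  `|\int[lebesgue_measure]_(s in `[0, b]) f s -
    \int[lebesgue_measure]_(s in `[0, a]) f s - (b - a) * u| <= (b - a) * w.
Proof.
move=> cf a0 ab bT fw.
have iT : lebesgue_measure.-integrable `[0, T] (EFin \o f).
  by apply: continuous_compact_integrable => //; exact: segment_compact.
have i0 : lebesgue_measure.-integrable `[0, b] (EFin \o f).
  apply: integrableS iT => //; apply: subset_itvl.
  by rewrite bnd_simp.
have iab : lebesgue_measure.-integrable `]a, b] (EFin \o f).
  by apply: integrableS i0 => //; apply: subset_itvr; rewrite bnd_simp.
have ic (v : R) : lebesgue_measure.-integrable `]a, b] (EFin \o (fun=> v)).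
  have : lebesgue_measure.-integrable `[0, b] (EFin \o (fun=> v)).
    apply: continuous_compact_integrable; first exact: segment_compact.
    by move=> y; exact: cvg_cst.
  by apply: integrableS => //; apply: subset_itvr; rewrite bnd_simp.
have Ic (v : R) : \int[lebesgue_measure]_(s in `]a, b]) v = (b - a) * v.
  rewrite Rintegral_cst//.
  rewrite [X in fine X](_ : _ = if (a%:E < b%:E)%E then (b%:E - a%:E)%E else 0%E);
    last exact: lebesgue_measure_itv.
  case: ifPn => [_|].
    by rewrite -EFinD/= mulrC.
  rewrite lte_fin -leNgt => ba; have -> : a = b by apply/eqP; rewrite eq_le ab.
  by rewrite subrr mul0r mulr0.
rewrite Rintegral_itvB//.
rewrite -(Ic u) -RintegralB//.
have ifu : lebesgue_measure.-integrable `]a, b] (EFin \o (fun s => f s - u)).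
  by apply: eq_integrable (integrableB _ iab (ic u)) => //.
apply: le_trans (le_normr_Rintegral _ ifu) _ => //.
rewrite -(Ic w); apply: le_Rintegral => //.
  exact: integrable_norm.
move=> s; rewrite /= in_itv/= => /andP[s1 s2]; apply: fw.
by rewrite (ltW s1).
Qed.

(** * The chain follows the solution *)

(** It agrees with the contraction factor e^(-u) of one step to first order, which is
    enough for consistency. The term - u^2 makes its square at most 1 - 2u, as the
    bounds on the Riccati equation require; the square of 1 - u exceeds 1 - 2u. *)
Definition step_factor {R : realType} (u : R) : R := 1 - u - u ^+ 2.

Lemma step_factor_sqr (R : realType) (u : R) : 0 <= u <= 2 / 5 ->
  0 <= step_factor u ^+ 2 <= 1 - 2 * u.
Proof.
move=> /andP[u0 u1]; rewrite sqr_ge0/= /step_factor.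
have h1 : 0 <= u ^+ 2 * (1 - 2 * u - u ^+ 2).
  rewrite mulr_ge0 ?sqr_ge0//; nra.
lra.
Qed.

Lemma step_factor_le1 (R : realType) (u : R) : 0 <= u <= 2 / 5 ->
  `|step_factor u| <= 1.
Proof.
move=> /[dup] ub /step_factor_sqr /andP[_ u2].
rewrite -(@ler_pXn2r _ 2)// ?nnegrE// real_normK ?num_real// expr1n.
by apply: le_trans u2 _; case/andP: ub => u0 _; lra.
Qed.

Section path.
Context (R : realType) (X b : R -> R) (kappa T x : R).
Hypotheses (k0 : 0 < kappa) (T0 : 0 < T) (cX : {within `[0, T], continuous X})
  (XE : forall t : R, 0 <= t <= T ->
     X t = x - kappa * (\int[lebesgue_measure]_(s in `[0, t]) X s) + b t)
  (b0 : b 0 = 0).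

Let Y n k := autoregression (step_factor (kappa * (T / n%:R))) x
  (fun l => b (l.+1%:R * (T / n%:R)) - b (l%:R * (T / n%:R))) k.

Section step.
Variables (n : nat) (M w : R).
Hypothesis n0 : (0 < n)%N.
Let h : R := T / n%:R.
Hypotheses (hk : kappa * h <= 2 / 5) (M0 : 0 <= M)
  (XM : forall t : R, 0 <= t <= T -> `|X t| <= M) (w0 : 0 <= w)
  (Xw : forall s t : R, 0 <= s <= T -> 0 <= t <= T -> `|s - t| <= h ->
     `|X s - X t| <= w).

Let h0 : 0 < h. Proof. by rewrite divr_gt0 ?ltr0n. Qed.
Let nh : n%:R * h = T.
Proof. by rewrite /h mulrC divfK// gt_eqF ?ltr0n. Qed.
Let grid k : (k <= n)%N -> 0 <= k%:R * h <= T.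
Proof.
move=> kn; rewrite mulr_ge0 ?ler0n ?(ltW h0)//= -nh ler_wpM2r ?(ltW h0)//.
by rewrite ler_nat.
Qed.
Let gridS k : k.+1%:R * h = k%:R * h + h.
Proof. by rewrite -(natr1 k) mulrDl mul1r. Qed.

Let B0 : 0 <= kappa * w + kappa ^+ 2 * h * M.
Proof.
apply: addr_ge0 (mulr_ge0 (ltW k0) w0) _.
exact: mulr_ge0 (mulr_ge0 (sqr_ge0 kappa) (ltW h0)) M0.
Qed.

(** The increments of b are those of X plus kappa times the integral of X, so the error
    at step k + 1 is the previous one, contracted, plus the consistency error
    kappa ((integral of X over the step) - h X_k) - (kappa h)^2 X_k. *)
Lemma chain_path_close k : (k <= n)%N ->
  `|Y n k - X (k%:R * h)| <= k%:R * (h * (kappa * w + kappa ^+ 2 * h * M)).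
Proof.
elim: k => [_|k IH kn].
  rewrite !mul0r XE ?lexx ?(ltW T0)// b0 set_itv1 Rintegral_set1.
  by rewrite mulr0 subr0 addr0 subrr normr0.
have {}IH := IH (ltnW kn).
have /andP[a1 a2] := grid (ltnW kn); have /andP[c1 c2] := grid kn.
have ab : k%:R * h <= k.+1%:R * h by rewrite gridS lerDl ltW.
have inc : `|\int[lebesgue_measure]_(s in `[0, k.+1%:R * h]) X s -
    \int[lebesgue_measure]_(s in `[0, k%:R * h]) X s -
    (k.+1%:R * h - k%:R * h) * X (k%:R * h)| <= (k.+1%:R * h - k%:R * h) * w.
  apply: (Rintegral_increment cX) => // s /andP[s1 s2]; apply: Xw.
  - by rewrite (le_trans a1)//= (le_trans s2).
  - by rewrite a1.
  - rewrite ger0_norm ?subr_ge0//; move: s2; rewrite gridS; lra.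
have db : b (k.+1%:R * h) - b (k%:R * h) = X (k.+1%:R * h) - X (k%:R * h) +
    kappa * (\int[lebesgue_measure]_(s in `[0, k.+1%:R * h]) X s -
    \int[lebesgue_measure]_(s in `[0, k%:R * h]) X s).
  by rewrite (XE (grid kn)) (XE (grid (ltnW kn))); ring.
have -> : Y n k.+1 = step_factor (kappa * h) * Y n k +
  (b (k.+1%:R * h) - b (k%:R * h)) by [].
rewrite db.
move: inc IH; have := XM (grid (ltnW kn)).
rewrite (_ : k.+1%:R * h - k%:R * h = h); last by rewrite gridS; ring.
set u := _ - \int[_]_(_ in _) _; set Xk := X (k%:R * h); set y := Y n k.
move=> XkM du dy.
rewrite (_ : _ - _ = step_factor (kappa * h) * (y - Xk) + (kappa * (u - h * Xk) -
   (kappa * h) ^+ 2 * Xk)); last by rewrite /step_factor; ring.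
have SB (B : R) : k.+1%:R * B = k%:R * B + B by rewrite -natr1; ring.
apply: le_trans (ler_normD _ _) _; rewrite SB; apply: lerD.
  rewrite normrM; apply: le_trans dy; rewrite ler_piMl// step_factor_le1// hk.
  by rewrite mulr_ge0 ?(ltW k0) ?(ltW h0).
apply: le_trans (ler_normB _ _) _; rewrite [X in X + _]normrM (gtr0_norm k0).
rewrite [X in _ + X]normrM (ger0_norm (sqr_ge0 _)).
have := ler_wpM2l (ltW k0) du; have := ler_wpM2l (sqr_ge0 (kappa * h)) XkM.
lra.
Qed.

Lemma chain_square_close (E : R) :
  E = T * (kappa * w + kappa ^+ 2 * h * M) ->
  `|n%:R^-1 * (\sum_(0 <= k < n) Y n k ^+ 2) -
    T^-1 * (\int[lebesgue_measure]_(s in `[0, T]) X s ^+ 2)| <=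
  (E + w) * (2 * M + E).
Proof.
move=> EE; set K := (E + w) * _.
have E0 : 0 <= E.
  by rewrite EE mulr_ge0 ?(ltW T0).
have cX2 : {within `[0, T], continuous (fun s => X s ^+ 2)}.
  move=> t; apply: continuousM => //; exact: cX.
have e1 k : (k <= n)%N -> `|Y n k - X (k%:R * h)| <= E.
  move=> kn; apply: le_trans (chain_path_close kn) _.
  rewrite mulrA EE; apply: ler_wpM2r; last by case/andP: (grid kn).
  exact: B0.
suff H k : (k <= n)%N -> `|\int[lebesgue_measure]_(s in `[0, k%:R * h]) X s ^+ 2 -
    h * (\sum_(0 <= l < k) Y n l ^+ 2)| <= k%:R * (h * K).
  have := H n (leqnn n); rewrite mulrA nh => HT.
  rewrite distrC -(ler_pM2l T0) -[X in X * `|_|](gtr0_norm T0) -normrM.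
  rewrite (_ : T * _ = \int[lebesgue_measure]_(s in `[0, T]) X s ^+ 2 -
    h * \sum_(0 <= k < n) Y n k ^+ 2)//.
  by rewrite /h; field; rewrite (gt_eqF T0) pnatr_eq0 -lt0n n0.
elim: k => [_|k IH kn].
  by rewrite !mul0r big_geq// set_itv1 Rintegral_set1 mulr0 subr0 normr0.
have {}IH := IH (ltnW kn).
have /andP[a1 a2] := grid (ltnW kn); have /andP[c1 c2] := grid kn.
have ab : k%:R * h <= k.+1%:R * h by rewrite gridS lerDl ltW.
have inc : `|\int[lebesgue_measure]_(s in `[0, k.+1%:R * h]) X s ^+ 2 -
    \int[lebesgue_measure]_(s in `[0, k%:R * h]) X s ^+ 2 -
    (k.+1%:R * h - k%:R * h) * Y n k ^+ 2| <= (k.+1%:R * h - k%:R * h) * K.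
  apply: (Rintegral_increment cX2) => // s /andP[s1 s2].
  have sT : 0 <= s <= T by rewrite (le_trans a1)//= (le_trans s2).
  rewrite (_ : X s ^+ 2 - _ = (X s - Y n k) * (X s + Y n k)); last by ring.
  have Xs : `|X s - X (k%:R * h)| <= w.
    apply: Xw => //; first by rewrite a1.
    by rewrite ger0_norm ?subr_ge0//; move: s2; rewrite gridS; lra.
  have XY := e1 k (ltnW kn).
  have dXY : `|X s - Y n k| <= E + w.
    rewrite (_ : _ - _ = (X s - X (k%:R * h)) - (Y n k - X (k%:R * h))); last by ring.
    by apply: le_trans (ler_normB _ _) _; lra.
  have sXY : `|X s + Y n k| <= 2 * M + E.
    rewrite (_ : X s + Y n k = X s + X (k%:R * h) + (Y n k - X (k%:R * h))); last by ring.
    apply: le_trans (ler_normD _ _) _; apply: lerD => //.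
    apply: le_trans (ler_normD _ _) _.
    have := XM sT; have := XM (grid (ltnW kn)); lra.
  by rewrite normrM /K; apply: ler_pM.
move: inc IH; rewrite (_ : k.+1%:R * h - k%:R * h = h); last by rewrite gridS; ring.
have -> : \sum_(0 <= l < k.+1) Y n l ^+ 2 =
  \sum_(0 <= l < k) Y n l ^+ 2 + Y n k ^+ 2 by rewrite big_nat_recr.
move: (\int[lebesgue_measure]_(s in `[0, k.+1%:R * h]) X s ^+ 2)
  (\int[lebesgue_measure]_(s in `[0, k%:R * h]) X s ^+ 2) => I1 I0 d1 d2.
rewrite (_ : _ - _ = (I0 - h * (\sum_(0 <= l < k) Y n l ^+ 2)) +
  (I1 - I0 - h * Y n k ^+ 2)); last by ring.
have SB (B : R) : k.+1%:R * B = k%:R * B + B by rewrite -natr1; ring.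
apply: le_trans (ler_normD _ _) _; rewrite SB; exact: lerD.
Qed.
End step.

Lemma cvg_chain_square :
  (fun n => n.+1%:R^-1 * (\sum_(0 <= k < n.+1) Y n.+1 k ^+ 2)) @ \oo -->
  T^-1 * (\int[lebesgue_measure]_(s in `[0, T]) X s ^+ 2).
Proof.
have [M M0 XM] := bounded_itv (ltW T0) cX.
apply/cvgrPdist_le => e' e0'; have [e ee e0] : exists2 e : R, e' = e & 0 < e by exists e'.
rewrite {e' e0'}ee.
pose K := (2 * kappa * T + 1) * (2 * M + 2 * kappa * T) + 1.
have kT : 0 < kappa * T by rewrite mulr_gt0.
have K0 : 0 < K.
  have K1 : 0 <= 2 * kappa * T + 1 by lra.
  have K2 : 0 <= 2 * M + 2 * kappa * T by lra.
  by rewrite /K ltr_wpDl// mulr_ge0.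
pose w := Num.min 1 (e / K).
have w0 : 0 < w by rewrite lt_min ltr01 divr_gt0.
have w1 : w <= 1 by rewrite ge_min lexx.
have wK : w * K <= e by rewrite -ler_pdivlMr// ge_min lexx orbT.
have [del d0 Xd] := uniformly_continuous_itv cX w0.
pose m := Num.min (Num.min (2 / 5 / kappa) (del / 2)) (w / (kappa * (M + 1))).
have m0 : 0 < m.
  rewrite !lt_min !divr_gt0//.
  by rewrite mulr_gt0// ltr_wpDl.
have hm : \forall n \near \oo, T / n.+1%:R <= m.
  have : (fun n => T / n.+1%:R) @ \oo --> T * 0.
    by apply: cvgM; [exact: cvg_cst|exact: cvg_harmonic].
  rewrite mulr0 => /cvgrPdist_le /(_ _ m0); apply: filterS => n.
  by rewrite sub0r normrN ger0_norm// divr_ge0// ltW.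
near=> n; have hn : T / n.+1%:R <= m by near: n.
move: hn; rewrite !le_min => /andP[/andP[h1 h2] h3].
have h0 : 0 < T / n.+1%:R by rewrite divr_gt0.
have hk : kappa * (T / n.+1%:R) <= 2 / 5.
  by rewrite mulrC -ler_pdivlMr.
have Xw s t : 0 <= s <= T -> 0 <= t <= T -> `|s - t| <= T / n.+1%:R ->
    `|X s - X t| <= w.
  move=> sT tT st; apply: Xd => //; apply: (le_lt_trans st).
  by apply: (le_lt_trans h2); rewrite ltr_pdivrMr// ltr_pMr// ltr1n.
have := chain_square_close (ltn0Sn n) hk M0 XM (ltW w0) Xw (erefl _).
rewrite distrC => /le_trans; apply; apply: le_trans wK.
have hM : kappa * (T / n.+1%:R) * M <= w.
  have M1 : 0 < kappa * (M + 1) by rewrite mulr_gt0// ltr_wpDl.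
  move: h3; rewrite ler_pdivlMr// => h3.
  have : 0 < T / n.+1%:R * kappa by rewrite mulr_gt0.
  by move: h3; move: (T / n.+1%:R) => h'; lra.
set h := T / n.+1%:R in hM *.
have E2 : T * (kappa * w + kappa ^+ 2 * h * M) <= 2 * kappa * T * w.
  have := ler_wpM2l (ltW kT) hM; lra.
have E0 : 0 <= T * (kappa * w + kappa ^+ 2 * h * M).
  apply: mulr_ge0; first exact: ltW.
  apply: addr_ge0; first by rewrite mulr_ge0 ?ltW.
  by rewrite mulr_ge0// mulr_ge0 ?sqr_ge0// ltW.
set E := T * (_ + _) in E2 E0 *.
have kTw : kappa * T * w <= kappa * T by rewrite ler_piMr// ltW.
apply: (@le_trans _ _ (((2 * kappa * T + 1) * w) * (2 * M + 2 * kappa * T))).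
  by apply: ler_pM; lra.
rewrite [leRHS](_ : _ = (2 * kappa * T + 1) * w * (2 * M + 2 * kappa * T) + w).
  by rewrite lerDl ltW.
by rewrite /K; ring.
Unshelve. all: by end_near.
Qed.
End path.

(** * Discretization of the Ornstein-Uhlenbeck process *)

Lemma enorm_sqr (R : realType) n (x : 'rV[R]_n) : enorm x ^+ 2 = \sum_i x 0 i ^+ 2.
Proof. by rewrite sqr_sqrtr// sumr_ge0// => i _; rewrite sqr_ge0. Qed.

Section discretization.
Context (R : realType) (dO : measure_display) (Omega : measurableType dO)
  (P : probability Omega R) (d : nat) (kappa : R) (B X : R -> Omega -> 'rV[R]_d)
  (x : 'rV[R]_d) (T : R).
Hypotheses (k0 : 0 < kappa) (T0 : 0 < T) (hB : brownian_motion P B)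
  (hX : ou_solution P kappa x B X).

Definition increment (n : nat) (k : nat) (i : 'I_d) (w : Omega) : R :=
  B (k.+1%:R * (T / n%:R)) w 0 i - B (k%:R * (T / n%:R)) w 0 i.

Section grid.
Variable n : nat.
Hypothesis n0 : (0 < n)%N.
Let h : R := T / n%:R.
Let h0 : 0 < h. Proof. by rewrite divr_gt0 ?ltr0n. Qed.

Lemma measurable_increment (p : 'I_n * 'I_d) :
  measurable_fun setT (increment n p.1 p.2).
Proof.
have [mB _ _ _ _] := hB.
by apply: measurable_funB; apply: mB; rewrite mulr_ge0// ltW.
Qed.

Lemma independent_increment :
  mutually_independent P (fun p : 'I_n * 'I_d => increment n p.1 p.2).
Proof.
have [_ _ _ indB _] := hB.
apply: (indB (fun k => k%:R * h)); first by rewrite mul0r.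
by move=> k; rewrite ltr_pM2r// ltr_nat.
Qed.

Lemma law_increment (p : 'I_n * 'I_d) A : measurable A ->
  P (increment n p.1 p.2 @^-1` A) = normal_prob 0 (Num.sqrt h) A.
Proof.
have [_ _ _ _ lawB] := hB => mA.
have hh : h = p.1.+1%:R * h - p.1%:R * h.
  by rewrite -natr1 mulrDl mul1r addrAC subrr add0r.
rewrite [in RHS]hh; apply: lawB => //; first by rewrite mulr_ge0// ltW.
by rewrite ltr_pM2r// ltr_nat.
Qed.
End grid.

Definition chain_time_average (n : nat) (w : Omega) : R :=
  chain_mean_square n (increment n) (step_factor (kappa * (T / n%:R))) n%:R^-1 x w.

Lemma continuous_path : {ae P, forall w, forall i,
  {within `[0, T], continuous (fun t => X t w 0 i)}}.
Proof.
have [_ cX _] := hX; apply: filterS cX => w cX i.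
apply: continuous_subspaceW (cX i) => t /=.
by rewrite !in_itv/= andbT => /andP[].
Qed.

(** Continuity provides the integrability of each coordinate. *)
Lemma mean_square_sum w : (forall i,
  {within `[0, T], continuous (fun t => X t w 0 i)}) ->
  mean_square X T w =
  \sum_i T^-1 * \int[lebesgue_measure]_(t in `[0, T]) (X t w 0 i ^+ 2).
Proof.
move=> cX; rewrite /mean_square -mulr_sumr; congr (_ * _).
under eq_Rintegral do rewrite enorm_sqr.
have iX i : lebesgue_measure.-integrable `[0, T]
    (EFin \o (fun t => X t w 0 i ^+ 2)).
  apply: continuous_compact_integrable; first exact: segment_compact.
  by move=> t; apply: continuousM => //; exact: cX.
rewrite /Rintegral sum_fine; last first.
  by move=> i _; exact: integrable_fin_num (iX i).
congr fine; under eq_integral do rewrite -sumEFin.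
by rewrite integral_sum.
Qed.

Lemma cvg_chain_time_average : {ae P, forall w,
  chain_time_average n.+1 w @[n --> \oo] --> mean_square X T w}.
Proof.
have [_ B0 _ _ _] := hB; have [_ _ eqX] := hX.
apply: filterS3 B0 continuous_path eqX => w B0 cX eqX.
rewrite (mean_square_sum cX).
have -> : (fun n => chain_time_average n.+1 w) = (fun n => \sum_i
   n.+1%:R^-1 * \sum_(0 <= k < n.+1) (autoregression
     (step_factor (kappa * (T / n.+1%:R))) (x 0 i)
     (fun l => B (l.+1%:R * (T / n.+1%:R)) w 0 i -
               B (l%:R * (T / n.+1%:R)) w 0 i) k) ^+ 2).
  apply/funext => n; rewrite /chain_time_average /chain_mean_square.
  by rewrite exchange_big/= mulr_sumr.
apply: cvg_big => [|i _]; first exact: add_continuous.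
apply: (@cvg_chain_square R (fun t => X t w 0 i) (fun t => B t w 0 i)) => //.
  by move=> t /andP[t0 _]; exact: eqX.
by rewrite B0 mxE.
Qed.

(** Extended by 0 outside [0, T], the integrand is jointly measurable, so that its
    partial integral is measurable by Tonelli's theorem. *)
Lemma measurable_mean_square : measurable_fun setT (mean_square X T).
Proof.
have [mX _ _] := hX.
pose A : set (measurableTypeR R * Omega) := [set p | 0 <= p.1 <= T].
have mA : measurable A.
  rewrite (_ : A = `[0, T] `*` setT); first exact: measurableX.
  by apply/seteqP; split=> [[t w]/=|[t w] [/=]]; rewrite /A/= in_itv.
pose g (p : measurableTypeR R * Omega) : \bar R := (\sum_i X p.1 p.2 0 i ^+ 2)%:E.
pose f := g \_ A.
have mf : measurable_fun setT f.
  apply: (measurable_restrictT g mA).1; apply/measurable_EFinP.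
  apply: measurable_sum => i; apply: measurable_funX.
  apply: measurable_funS (mX i) => //.
    rewrite (_ : mkset _ = `[0, +oo[ `*` setT); first exact: measurableX.
    by apply/seteqP; split=> [[t w]/=|[t w] [/=]]; rewrite in_itv/= andbT.
  by move=> p /andP[].
have f0 p : (0 <= f p)%E.
  by rewrite /f patchE /g; case: ifP => // _; rewrite lee_fin sumr_ge0// => i _; rewrite sqr_ge0.
have := @measurable_fun_fubini_tonelli_G _ _ _ _ R lebesgue_measure f mf f0.
move=> mG; apply: measurable_funM => //.
rewrite (_ : (fun _ => _) = fine \o fubini_G lebesgue_measure f).
  exact: measurableT_comp.
apply/funext => w; rewrite /Rintegral/= /fubini_G; congr fine.
rewrite [LHS]integral_mkcond; congr integral; apply/funext => t.
rewrite /f !patchE.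
have -> : ((t, w) \in A) = (t \in `[0, T]%classic).
  by apply/idP/idP => /set_mem H; apply/mem_set; move: H; rewrite /A /= in_itv.
by case: ifP => //= _; rewrite /g enorm_sqr.
Qed.
End discretization.

(** * Passage to the limit *)

Lemma continuous_tail_bound (R : realType) (y : R) : 0 < y ->
  {for y, continuous (@tail_bound R)}.
Proof.
move=> y0; apply: (@continuousM R R (fun y => 2 * Num.min 1 (1 / (3 * y)))
    (fun y => expR (- y))).
  apply: (@continuousM R R (cst 2) (fun y => Num.min 1 (1 / (3 * y)))).
    exact: cst_continuous.
  apply: (@continuous_min R R (cst 1) (fun y => 1 / (3 * y))).
    exact: cst_continuous.
  apply: (@continuousM R R (cst 1) (fun y => (3 * y)^-1)).
    exact: cst_continuous.
  apply: (@continuousV R R (fun y => 3 * y)); first by rewrite gt_eqF ?mulr_gt0.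
  apply: (@continuousM R R (cst 3) id); first exact: cst_continuous.
  exact: cvg_id.
apply: (@continuous_comp _ _ _ -%R expR); last exact: continuous_expR.
exact: opp_continuous.
Qed.

Section deviation_time_average.
Context (R : realType) (dO : measure_display) (Omega : measurableType dO)
  (P : probability Omega R) (d : nat) (kappa : R) (B X : R -> Omega -> 'rV[R]_d)
  (x : 'rV[R]_d) (T : R).
Hypotheses (k0 : 0 < kappa) (T0 : 0 < T) (hB : brownian_motion P B)
  (hX : ou_solution P kappa x B X) (d0 : (0 < d)%N).

Local Notation D := ((\sum_i x 0 i ^+ 2) / (kappa * T) + d%:R / kappa).
Local Notation F := (mean_square X T).
Local Notation Fn := (chain_time_average kappa B x T).

(** The interface with the Gaussian chain: the grid is fine enough for step_factor_sqr. *)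
Lemma chain_time_average_deviation n : (0 < n)%N -> kappa * (T / n%:R) <= 2 / 5 ->
  [/\ measurable_fun setT (Fn n),
    subgamma_below_above P (fun w => Fn n w - (\int[P]_w Fn n w)%R) kappa T D &
    (\int[P]_w (Fn n w ^+ 2)%:E <=
      (2 * (D / (2 * kappa ^+ 2 * T)) + 2 * (D / 2) ^+ 2)%:E)%E].
Proof.
move=> n0 hn; set h := T / n%:R.
have h0 : 0 < h by rewrite divr_gt0 ?ltr0n.
have s0 : 0 < Num.sqrt h by rewrite sqrtr_gt0.
have s2 : Num.sqrt h ^+ 2 = h by rewrite sqr_sqrtr// ltW.
have nn : n%:R != 0 :> R by rewrite pnatr_eq0 -lt0n.
have vT : n%:R^-1 * T = Num.sqrt h ^+ 2 by rewrite s2 mulrC.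
have nv : n%:R * n%:R^-1 = 1 :> R by rewrite divff.
have qb : 0 <= step_factor (kappa * h) ^+ 2 <= 1 - 2 * kappa * Num.sqrt h ^+ 2.
  rewrite s2 -(mulrA 2); apply: step_factor_sqr.
  by rewrite hn andbT mulr_ge0// ltW.
have mxi := measurable_increment T0 hB n0.
have indxi := independent_increment T0 hB n0.
have lawxi := law_increment T0 hB n0.
split.
- exact: (measurable_chain_mean_square (step_factor (kappa * h)) n%:R^-1 x mxi).
- have [sg _] := @subgamma_chain R dO Omega P n d (increment B T n) kappa T
    (Num.sqrt h) (step_factor (kappa * h)) n%:R^-1 x k0 T0 s0 d0 vT nv qb mxi indxi lawxi.
  have E := @expect_chain_mean_square R dO Omega P n d (increment B T n) kappa T
    (Num.sqrt h) (step_factor (kappa * h)) n%:R^-1 x k0 T0 s0 d0 vT nv qb mxi indxi lawxi.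
  by rewrite /chain_time_average E.
- exact: (@second_moment_chain_mean_square R dO Omega P n d (increment B T n) kappa T
    (Num.sqrt h) (step_factor (kappa * h)) n%:R^-1 x k0 T0 s0 d0 vT nv qb mxi indxi lawxi).
Qed.

Let D0 : 0 < D.
Proof.
rewrite ltr_wpDl ?divr_gt0 ?ltr0n//.
rewrite divr_ge0 ?mulr_ge0 ?(ltW k0) ?(ltW T0)//.
by apply: sumr_ge0 => i _; rewrite sqr_ge0.
Qed.

Lemma eventually_fine_grid : exists n0, forall n, kappa * (T / (n + n0).+1%:R) <= 2 / 5.
Proof.
exists (Num.truncn (kappa * T / (2 / 5))).+1 => n.
have e0 : 0 < 2 / 5 :> R by rewrite divr_gt0.
rewrite mulrA ler_pdivrMr ?ltr0n// [leRHS]mulrC -ler_pdivrMr//.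
apply: le_trans (ltW (truncnS_gt _)) _.
by rewrite ler_nat addnS !ltnS (leq_trans _ (leqnSn _))// leq_addl.
Qed.

(** L1_cvg asks for a bound on all second moments, so the sequence of grids is started
    at one that is fine enough. *)
Lemma integrable_mean_square : P.-integrable setT (EFin \o F) /\
  forall e : R, 0 < e -> exists n, [/\ (0 < n)%N, kappa * (T / n%:R) <= 2 / 5,
    P.-integrable setT (EFin \o Fn n) &
    (\int[P]_w `|Fn n w - F w|)%R <= e].
Proof.
have [n0 fine_grid] := eventually_fine_grid.
have dev n := chain_time_average_deviation (ltn0Sn (n + n0)) (fine_grid n).
have mf n : measurable_fun setT (Fn (n + n0).+1) by have [] := dev n.
have mF := measurable_mean_square T hX.
have cv : {ae P, forall w, Fn (n + n0).+1 w @[n --> \oo] --> F w}.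
  apply: filterS (cvg_chain_time_average k0 T0 hB hX) => w.
  by rewrite -(cvg_shiftn n0).
have fC n := let: And3 _ _ H := dev n in H.
split; first exact: (integrable_limit mf mF cv fC).
move=> e e0; have := L1_cvg mf mF cv fC e0.
move=> [N _ /(_ N (leqnn N)) HN]; exists (N + n0).+1; split => //.
exact: (integrable_of_square (mf N) (integrable_square_of_le (mf N) (fC N))).
Qed.

Lemma cube_le (a b : R) : a <= b -> a ^+ 3 <= b ^+ 3.
Proof.
move=> ab; have := sqr_ge0 (a + b); have := sqr_ge0 a; have := sqr_ge0 b => *.
rewrite -subr_ge0 (_ : _ - _ = (b - a) * ((a ^+ 2 + b ^+ 2 + (a + b) ^+ 2) / 2)).
  by rewrite mulr_ge0 ?subr_ge0// divr_ge0// !addr_ge0.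
by field.
Qed.

(** Choosing n with E|F_n - F| <= del^2 makes both |E F_n - E F| and P(|F_n - F| >= del) at
    most del, which costs 2 del on r and del on the probability. *)
Lemma deviation_approx (r del : R) : 0 < del <= 1 -> 2 * del < r ->
  (fine (P [set w | r <= `|F w - (\int[P]_w F w)%R|]) - del) ^+ 3 <=
  tail_bound (kappa ^+ 2 * (r - 2 * del) ^+ 2 * T / (r - 2 * del + D)).
Proof.
move=> /andP[del0 del1] rdel; have [iF approx] := integrable_mean_square.
have del2 : 0 < del ^+ 2 by rewrite exprn_gt0.
have [n [n0 hn iFn L1]] := approx _ del2.
have [mFn sg _] := chain_time_average_deviation n0 hn.
have mF := measurable_mean_square T hX.
set mu := (\int[P]_w F w)%R; set m := (\int[P]_w Fn n w)%R in sg.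
have idif : P.-integrable setT (EFin \o (fun w => `|Fn n w - F w|)).
  have : P.-integrable setT (EFin \o (fun w => Fn n w - F w)).
    by apply: eq_integrable (integrableB measurableT iFn iF).
  exact: integrable_norm.
have mmu : `|m - mu| <= del.
  rewrite /m /mu -RintegralB//.
  have i1 : P.-integrable setT (EFin \o (fun w => Fn n w - F w)).
    by apply: eq_integrable (integrableB measurableT iFn iF).
  apply: le_trans (le_normr_Rintegral measurableT i1) _.
  apply: (le_trans L1); rewrite -[leRHS]mulr1 expr2; by rewrite ler_wpM2l ?(ltW del0).
pose A0 := [set w | r <= `|F w - mu|].
pose A1 := [set w | r - 2 * del <= `|Fn n w - m|].
pose A2 := [set w | del <= `|Fn n w - F w|].
have mle (u : Omega -> R) a : measurable_fun setT u -> measurable [set w | a <= u w].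
  move=> mu'; rewrite -[X in measurable X]setTI.
  exact: (measurable_fun_le measurableT (measurable_cst a) mu').
have mA1 : measurable A1.
  by apply: mle; apply: measurableT_comp => //; exact: measurable_funB.
have mA2 : measurable A2.
  by apply: mle; apply: measurableT_comp => //; exact: measurable_funB.
have mA : measurable A0.
  by apply: mle; apply: measurableT_comp => //; exact: measurable_funB.
have PA2 : fine (P A2) <= del.
  have : fine (P A2) <= (\int[P]_w (del^-1 * `|Fn n w - F w|))%R.
    apply: prob_le_expect => //; first exact: integrable_scale.
      by move=> w; rewrite mulr_ge0// invr_ge0 ltW.
    by move=> w A2w; rewrite mulrC ler_pdivlMr// mul1r.
  move=> /le_trans; apply; rewrite RintegralZl//.
  by rewrite mulrC ler_pdivrMr// -expr2.
have PA : fine (P A0) <= fine (P A1) + fine (P A2).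
  have PA' : (P A0 <= P A1 + P A2)%E.
    apply: (@le_trans _ _ (P (A1 `|` A2))); last exact: measureU2.
    apply: le_measure; rewrite ?inE//; first exact: measurableU.
    move=> w; rewrite /A0/= => Fw; have [?|lt] := leP del `|Fn n w - F w|; [by right|left].
    rewrite /A1/=; have := ler_normD (Fn n w - m) (F w - Fn n w + (m - mu)).
    rewrite (_ : Fn n w - m + _ = F w - mu); last by ring.
    have := ler_normD (F w - Fn n w) (m - mu); rewrite (distrC (F w) (Fn n w)).
    lra.
  rewrite -fineD ?fin_num_measure//; apply: fine_le => //.
    exact: fin_num_measure.
  by rewrite fin_numD !fin_num_measure.
have r0 : 0 < r - 2 * del by rewrite subr_gt0.
have dev := deviation_bound k0 T0 D0 r0 sg mA1 (fun w => id).
apply: le_trans dev; apply: cube_le; lra.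
Qed.

(** Let del tend to 0 in deviation_approx. *)
Lemma deviation_mean_square (r : R) : 0 < r ->
  fine (P [set w | r <= `|F w - (\int[P]_w F w)%R|]) ^+ 3 <=
  tail_bound (kappa ^+ 2 * r ^+ 2 * T / (r + D)).
Proof.
move=> r0; set p := fine _.
pose rr (del : R) := r - 2 * del.
pose y (del : R) := kappa ^+ 2 * rr del ^+ 2 * T / (rr del + D).
have crr : rr del @[del --> 0^'+] --> r.
  rewrite [X in _ --> X](_ : r = r - 2 * 0); last by rewrite mulr0 subr0.
  apply: cvgB; first exact: cvg_cst.
  apply: cvgM; first exact: cvg_cst.
  exact: cvg_within.
have rD0 : 0 < r + D by exact: addr_gt0 r0 D0.
have rD : r + D != 0 by rewrite gt_eqF.
have cy : y del @[del --> 0^'+] --> kappa ^+ 2 * r ^+ 2 * T / (r + D).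
  apply: cvgM.
    apply: cvgM; last exact: cvg_cst.
    apply: cvgM; first exact: cvg_cst.
    by rewrite expr2; under eq_fun do rewrite expr2; exact: cvgM.
  apply: cvgV; first exact: rD.
  apply: cvgD; [exact: crr|exact: cvg_cst].
have y0 : 0 < kappa ^+ 2 * r ^+ 2 * T / (r + D).
  by rewrite divr_gt0// !mulr_gt0 ?exprn_gt0.
have ct : tail_bound (y del) @[del --> 0^'+] -->
    tail_bound (kappa ^+ 2 * r ^+ 2 * T / (r + D)).
  exact: (continuous_cvg _ (continuous_tail_bound y0) cy).
have cp : (p - del) ^+ 3 @[del --> 0^'+] --> p ^+ 3.
  have c1 : p - del @[del --> 0^'+] --> p.
    rewrite [X in _ --> X](_ : p = p - 0); last by rewrite subr0.
    apply: cvgB; first exact: cvg_cst.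
    exact: cvg_within.
  rewrite [X in _ --> X](_ : _ = p * p * p); last by ring.
  rewrite (_ : (fun del => _) = fun del => (p - del) * (p - del) * (p - del)); last first.
    by apply/funext => del; ring.
  by apply: cvgM => //; exact: cvgM.
apply: (ler_cvg_to cp ct); near=> del.
apply: deviation_approx.
  by apply/andP; split; near: del; [exact: nbhs_right_gt|exact: nbhs_right_le].
have : del < r / 2 by near: del; apply: nbhs_right_lt; rewrite divr_gt0.
by rewrite ltr_pdivlMr// mulrC.
Unshelve. all: by end_near.
Qed.
End deviation_time_average.

(** * The theorem *)

Lemma mean_square_dim0 (R : realType) (Omega : Type) (X : R -> Omega -> 'rV[R]_0)
  (T : R) (w : Omega) : mean_square X T w = 0.
Proof.
rewrite /mean_square; under eq_Rintegral do rewrite enorm_sqr big_ord0.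
by rewrite /Rintegral integral0 mulr0.
Qed.

Lemma tail_bound_cube (R : realType) (kappa r T D p : R) :
  0 < kappa -> 0 < r -> 0 < T -> 0 < r + D -> 0 <= p ->
  p ^+ 3 <= tail_bound (kappa ^+ 2 * r ^+ 2 * T / (r + D)) ->
  p <= 2 `^ (1 / 3)
       * Num.min 1 ((r + D) / (3 * kappa ^+ 2 * r ^+ 2 * T)) `^ (1 / 3)
       * expR (- (kappa ^+ 2 * r ^+ 2 * T / (3 * (r + D)))).
Proof.
move=> k0 r0 T0 rD p0 pt.
have cube (u : R) : 0 <= u -> (u `^ (1 / 3)) ^+ 3 = u.
  by move=> u0; rewrite -powR_mulrn ?powR_ge0// -powRrM div1r mulVf// powRr1.
have m0 : 0 <= Num.min 1 ((r + D) / (3 * kappa ^+ 2 * r ^+ 2 * T)).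
  rewrite le_min ler01 divr_ge0 ?(ltW rD)// ltW// !mulr_gt0 ?exprn_gt0//.
rewrite -(@ler_pXn2r _ 3)// ?nnegrE//; last first.
  by rewrite !mulr_ge0 ?powR_ge0 ?expR_ge0.
apply: le_trans pt _; rewrite !exprMn !cube// /tail_bound.
rewrite -expRM_natl le_eqVlt; apply/orP; left; apply/eqP; congr (_ * _ * expR _).
  by congr (Num.min _ _); field; rewrite !gt_eqF.
by field; rewrite gt_eqF.
Qed.

(* The deviation is taken in \bar R, so that the statement does not rely on a
   default value for the expectation. *)
Theorem proposition4p14 (R : realType) (dO : measure_display)
    (Omega : measurableType dO) (P : probability Omega R)
    (d : nat) (kappa : R) (hkappa : 0 < kappa)
    (B : R -> Omega -> 'rV[R]_d) (hB : brownian_motion P B)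
    (X : 'rV[R]_d -> R -> Omega -> 'rV[R]_d)
    (hX : forall x, ou_solution P kappa x B (X x))
    (r T : R) (hr : 0 < r) (hT : 0 < T) (x : 'rV[R]_d) :
  let D := enorm x ^+ 2 / (kappa * T) + d%:R / kappa in
  (P [set w | r%:E <= `| (mean_square (X x) T w)%:E
                         - 'E_P[mean_square (X x) T] |]
   <= (2 `^ (1 / 3)
       * Num.min 1 ((r + D) / (3 * kappa ^+ 2 * r ^+ 2 * T)) `^ (1 / 3)
       * expR (- (kappa ^+ 2 * r ^+ 2 * T / (3 * (r + D)))))%:E)%E.
Proof.
cbv zeta; set D : R := enorm x ^+ 2 / (kappa * T) + d%:R / kappa.
rewrite unlock.
have [d0|d0] := posnP d.
  have E0 w : mean_square (X x) T w = 0.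
    by move: {hB hX} D; subst d => _; exact: mean_square_dim0.
  rewrite [X in P X](_ : _ = set0) ?measure0; last first.
    apply/seteqP; split=> // w /=.
    under eq_integral do rewrite /= E0.
    rewrite integral0 E0 subee// abse0 lee_fin leNgt hr//.
  by rewrite lee_fin !mulr_ge0 ?powR_ge0 ?expR_ge0.
have D0 : 0 < D.
  apply: ltr_wpDl; first by rewrite divr_ge0 ?sqr_ge0// mulr_ge0 ?(ltW hT) ?(ltW hkappa).
  by rewrite divr_gt0// ltr0n.
have [iF _] := integrable_mean_square hkappa hT hB (hX x) d0.
have -> : (\int[P]_w (mean_square (X x) T w)%:E)%E =
    (\int[P]_w mean_square (X x) T w)%R%:E.
  by rewrite /Rintegral fineK//; exact: integrable_fin_num iF.
set mu := (\int[P]_w _)%R.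
rewrite (_ : [set w | _] = [set w | (r <= `|mean_square (X x) T w - mu|)%R]); last first.
  by apply/seteqP; split=> w; rewrite /mkset -(lee_fin r).
rewrite -[X in (X <= _)%E]fineK; last first.
  apply: fin_num_measure; rewrite -[X in measurable X]setTI.
  apply: (measurable_fun_le measurableT (measurable_cst r)).
  apply: measurableT_comp => //; apply: measurable_funB => //.
  exact: measurable_mean_square (hX x).
rewrite lee_fin; apply: tail_bound_cube => //; first exact: addr_gt0.
  exact: fine_ge0.
rewrite /D enorm_sqr.
exact: (deviation_mean_square hkappa hT hB (hX x) d0 hr).
Qed.
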